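(* Assume that Assumptions (A1), (A2), (A3), (A4) listed in the context hold. Let $(\hat T^{\mathrm{1NN}},\hat a^{\mathrm{1NN}},\hat\lambda^{\mathrm{1NN}})$ be the nearest-neighbour plan-based estimators defined in the context, and let $a_n,b_m$ be the sequences in (A4). Then there exists a constant $C>0$ such that, for all sufficiently large $n,m$, $$\max\left\{\mathbb E\Bigl[\int_\Omega \|\hat T^{\mathrm{1NN}}(x)-T_0(x)\|^2\,d\mu(x)\Bigr],\ \mathbb E\Bigl[\int_\Omega |\hat\lambda^{\mathrm{1NN}}(x)-\lambda_0(x)|^2\,d\mu(x)\Bigr]\right\}\le C\log n\,\Bigl(M_\mu \mathfrak R_n^{\mathrm{emp}}(d)+M_\nu \mathfrak R_m^{\mathrm{emp}}(d)+a_n+b_m\Bigr),$$ where $\mathfrak R_n^{\mathrm{emp}}(d)=n^{-1/2}$ if $d\le 3$, $\mathfrak R_n^{\mathrm{emp}}(d)=(\log n)n^{-1/2}$ if $d=4$, and $\mathfrak R_n^{\mathrm{emp}}(d)=n^{-2/d}$ if $d\ge5$.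
   Context: **Unbalanced optimal transport (UOT).** $\Omega\subset\mathbb R^d$ is bounded and convex; $\mathcal M_+(\Omega)$ is the set of finite positive Radon measures on $\Omega$. For $\eta,\sigma\in\mathcal M_+(\Omega)$, $D_{\mathrm{KL}}(\eta\mid\sigma)=\int (f\log f-f+1)\,d\sigma$ if $\eta=f\sigma$ (with $0\log0=0$), and $+\infty$ otherwise; for nonnegative vectors $u,v$ the same formula reads $\sum_i v_iF(u_i/v_i)$, $F(r)=r\log r-r+1$. For $\gamma\in\mathcal M_+(\Omega\times\Omega)$, $\gamma_0,\gamma_1$ denote its first and second marginals. Define $$\mathrm{UOT}(\mu,\nu)=\inf_{\gamma\in\mathcal M_+(\Omega\times\Omega)}\Bigl\{\int \tfrac12\|x-y\|^2d\gamma+D_{\mathrm{KL}}(\gamma_0\mid\mu)+D_{\mathrm{KL}}(\gamma_1\mid\nu)\Bigr\}=\sup\Bigl\{\int(1-e^{-\varphi})d\mu+\int(1-e^{-\psi})d\nu\Bigr\},$$ the supremum being over $(\varphi,\psi)\in C_b(\Omega)^2$ with $\varphi(x)+\psi(y)\le\frac12\|x-y\|^2$. With $\varphi^c(x)=\inf_{y\in\Omega}\{\frac12\|x-y\|^2-\varphi(y)\}$, a function is $c$-concave if it is of the form $\psi^c$. When $\mu$ has an a.e. positive density and $\nu\ll dx$, there is a $\mu$-a.e. unique $c$-concave $\varphi_0$ such that $(\varphi_0,\psi_0)$ with $\psi_0=\varphi_0^c$ solves the dual problem. Put $$T_0(x)=x-\nabla\varphi_0(x),\qquad \lambda_0(x)=\exp\bigl(-\varphi_0(x)+\tfrac14\|\nabla\varphi_0(x)\|^2\bigr).$$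 **Data.** $\mu,\nu\in\mathcal M_+(\Omega)$, $M_\mu=\mu(\Omega)$, $M_\nu=\nu(\Omega)$, $\bar\mu=\mu/M_\mu$, $\bar\nu=\nu/M_\nu$. One observes mutually independent samples $X_1,\dots,X_n\sim\bar\mu$, $Y_1,\dots,Y_m\sim\bar\nu$, and mass estimators $\hat M_\mu,\hat M_\nu$. Put $\hat\mu_i=\hat M_\mu/n$, $\hat\nu_j=\hat M_\nu/m$, $\hat\mu_n=\frac{\hat M_\mu}{n}\sum_i\delta_{X_i}$, $\hat\nu_m=\frac{\hat M_\nu}{m}\sum_j\delta_{Y_j}$. **Assumptions.** (A1) There is $\kappa\in(0,1)$ with $(1-\frac1\kappa)I\preceq\nabla^2\varphi_0(x)\preceq(1-\kappa)I$ for all $x\in\Omega$. (A2) $\Omega$ is compact, convex, and there are $\epsilon_0,\delta_0>0$ with $\mathrm{Vol}(B(x,\epsilon)\cap\Omega)\ge\delta_0\mathrm{Vol}(B(x,\epsilon))$ for all $x\in\Omega$, $\epsilon\in(0,\epsilon_0)$. (A3) $\bar\mu,\bar\nu$ have Lebesgue densities $p,q$ with $0<\beta_{\min}\le p,q\le\beta_{\max}<\infty$ on $\Omega$. (A4) There are positive sequences $a_n,b_m\to0$ and a constant $c\in(0,1]$ such that, almost surely, $\hat M_\mu\to M_\mu$, $\hat M_\nu\to M_\nu$, $\hat M_\mu\ge cM_\mu$, $\hat M_\nu\ge cM_\nu$, and $\mathbb E|\hat M_\mu-M_\mu|\le a_n$, $\mathbb E|\hat M_\nu-M_\nu|\le b_m$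 for all sufficiently large $n,m$. **Estimator.** Let $\hat\gamma\in\mathbb R_+^{n\times m}$ be any minimizer of $\sum_{i,j}\frac12\|X_i-Y_j\|^2\gamma_{ij}+D_{\mathrm{KL}}(\gamma_0\mid(\hat\mu_i)_i)+D_{\mathrm{KL}}(\gamma_1\mid(\hat\nu_j)_j)$, where $\gamma_0,\gamma_1$ are the vectors of row and column sums. Put $\hat r_i=\sum_j\hat\gamma_{ij}$, $\hat T_i=\hat r_i^{-1}\sum_j\hat\gamma_{ij}Y_j$ if $\hat r_i>0$ and $\hat T_i=X_i$ if $\hat r_i=0$, $\hat a_i=\sqrt{\hat r_i/\hat\mu_i}$. Fix constants $0<w_-<w_+$ such that $[w_-,w_+]$ contains the range of $e^{-\varphi_0}$; put $\hat\lambda_i=\mathrm{clip}_{[w_-,w_+]}(\hat a_i^2)\exp(\frac14\|X_i-\hat T_i\|^2)$, where $\mathrm{clip}_{[a,b]}(t)=\min\{b,\max\{a,t\}\}$. With the Voronoi cells $V_i=\{x\in\Omega:\|x-X_i\|\le\|x-X_k\|\ \forall k\ne i\}$, set $\hat T^{\mathrm{1NN}}(x)=\sum_i\mathbf 1\{x\in V_i\}\hat T_i$, $\hat a^{\mathrm{1NN}}(x)=\sum_i\mathbf 1\{x\in V_i\}\hat a_i$, $\hat\lambda^{\mathrm{1NN}}(x)=\sum_i\mathbf 1\{x\in V_i\}\hat\lambda_i$. *)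

(* Defs.v *)
From HB Require Import structures.
From mathcomp Require Import all_boot all_order all_algebra.
From mathcomp Require Import all_classical all_reals all_analysis.
From mathcomp Require Import measurable_realfun lra.

Set Implicit Arguments.
Unset Strict Implicit.
Unset Printing Implicit Defensive.
Import Order.TTheory GRing.Theory Num.Def Num.Theory.
Import numFieldNormedType.Exports.

Local Open Scope classical_set_scope.
Local Open Scope ring_scope.

(* Borel sigma-algebra of the usual topology of 'rV[R]_d = R^d. *)
Fact borel_matrix_display : measure_display.
Proof. exact: default_measure_display. Qed.

HB.instance Definition _ (R : realType) (m n : nat) :=
  @isMeasurable.Build borel_matrix_display 'M[R]_(m, n)
    (<<s @open 'M[R]_(m, n) >>)
    (@sigma_algebra0 _ setT (@open 'M[R]_(m, n)))
    (@sigma_algebraC _ (@open 'M[R]_(m, n)))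
    (@sigma_algebra_bigcup _ setT (@open 'M[R]_(m, n))).

Section borel_matrix.
Context (R : realType).

Lemma measurable_mx_open m n (U : set 'M[R]_(m, n)) : open U -> measurable U.
Proof. by move=> oU; exact: sub_sigma_algebra. Qed.

Lemma measurable_mx_coord m n (i : 'I_m) (j : 'I_n) :
  measurable_fun setT (fun A : 'M[R]_(m, n) => A i j).
Proof.
apply: (measurability _ (RGenOpens.measurableE R)).
move=> _ [_ [a [b ->] <-]]; rewrite setTI; apply: measurable_mx_open.
apply: open_comp; last exact: interval_open.
by move=> A _; exact: coord_continuous.
Qed.

Lemma measurable_fun_mx d (T : measurableType d) m n (f : T -> 'M[R]_(m, n)) :
  (forall i j, measurable_fun setT (fun t => f t i j)) ->
  measurable_fun setT f.
Proof.
move=> mf; apply: (measurability (@open 'M[R]_(m, n))) => //.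
move=> _ [U oU <-]; rewrite setTI.
pose box (qe : 'M[rat]_(m, n) * rat) :=
  [set A : 'M[R]_(m, n) |
    forall i j, ball (ratr (qe.1 i j) : R) (ratr qe.2) (A i j)].
have -> : f @^-1` U =
    \bigcup_qe (if `[< box qe `<=` U >] then f @^-1` box qe else set0).
  apply/seteqP; split => [t /= Ut|t [qe _]]; last first.
    by case: asboolP => // + ft; apply.
  have /nbhs_ballP[e /= e0 eU] : nbhs (f t) U by exact: open_nbhs_nbhs.
  have [r] : exists r : rat, 0 < (ratr r : R) < e / 2.
    have [r] := rat_in_itvoo (divr_gt0 e0 (ltr0n R 2)).
    by rewrite in_itv/=; exists r.
  move=> /andP[r0 re].
  have [q qP] : exists q : 'M[rat]_(m, n), forall i j,
      `|f t i j - ratr (q i j)| < (ratr r : R).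
    have H i j : exists q : rat, `|f t i j - ratr q| < (ratr r : R).
      have /rat_in_itvoo[q] : f t i j - ratr r < f t i j + ratr r.
        by rewrite ltrBlDr -addrA ltrDl addr_gt0.
      rewrite in_itv/= => /andP[q1 q2]; exists q.
      by rewrite ltr_norml; apply/andP; split; lra.
    exists (\matrix_(i, j) xget 0 [set q | `|f t i j - ratr q| < (ratr r : R)]).
    move=> i j; rewrite mxE; case: xgetP => [y -> //|].
    by case: (H i j) => q hq /(_ q).
  exists (q, r) => //; rewrite ifT.
    by move=> i j /=; rewrite /ball/= distrC; exact: qP.
  apply/asboolP => A Abox; apply: eU; split => // i j.
  rewrite /ball/= (splitr e).
  rewrite (_ : _ - _ = (f t i j - ratr (q i j)) + (ratr (q i j) - A i j)).
    by rewrite (le_lt_trans (ler_normD _ _))// ltrD//;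
      [exact: lt_trans (qP i j) re|exact: lt_trans (Abox i j) re].
  by rewrite addrA subrK.
apply: countable_bigcupT_measurable => [|qe]; first exact: countableP.
case: ifP => // _.
rewrite (_ : _ @^-1` _ = \bigcap_(i in [set: 'I_m]) \bigcap_(j in [set: 'I_n])
   ((fun t => f t i j) @^-1` ball (ratr (qe.1 i j) : R) (ratr qe.2))).
  apply: fin_bigcap_measurable => // i _; apply: fin_bigcap_measurable => // j _.
  rewrite -[X in measurable X]setTI; apply: mf => //.
  apply: open_measurable; exact: ball_open.
by apply/seteqP; split => [t /= h i _ j _|t /= h i j]; [exact: h|exact: h].
Qed.


Definition rV_cons n (p : R * 'rV[R]_n) : 'rV[R]_n.+1 :=
  \row_i (if unlift ord0 i is Some j then p.2 ord0 j else p.1).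

Lemma measurable_rV_cons n :
  measurable_fun setT (@rV_cons n : measurableTypeR R * 'rV[R]_n -> _).
Proof.
apply: measurable_fun_mx => k i; rewrite (_ : (fun t => _) =
  if unlift ord0 i is Some j then
    (fun t : measurableTypeR R * 'rV[R]_n => t.2 ord0 j)
  else fst); last by apply/funext => t; rewrite mxE; case: unlift.
case: unlift => [j|]; last exact: measurable_fst.
by apply: (measurableT_comp (measurable_mx_coord _ _)).
Qed.

Section lebesgue_step.
Context n (mu : {sigma_finite_measure set 'rV[R]_n -> \bar R}).

Definition lebesgue_rV_step : set 'rV[R]_n.+1 -> \bar R :=
  pushforward (@lebesgue_measure R \x mu)%E
    (@rV_cons n : measurableTypeR R * 'rV[R]_n -> _).

Let mcons (A : set 'rV[R]_n.+1) : measurable A ->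
  measurable ((@rV_cons n : measurableTypeR R * 'rV[R]_n -> _) @^-1` A).
Proof.
by move=> mA; have := measurable_rV_cons measurableT mA; rewrite setTI.
Qed.

Let step0 : lebesgue_rV_step set0 = 0%E.
Proof. by rewrite /lebesgue_rV_step /pushforward preimage_set0 measure0. Qed.

Let step_ge0 A : (0 <= lebesgue_rV_step A)%E.
Proof. by rewrite /lebesgue_rV_step /pushforward; exact: measure_ge0. Qed.

Let step_sigma_additive : semi_sigma_additive lebesgue_rV_step.
Proof.
move=> F mF tF mUF; rewrite /lebesgue_rV_step /pushforward preimage_bigcup.
apply: measure_semi_sigma_additive.
- by move=> k; exact: mcons.
- apply/trivIsetP => /= i j _ _ ij; rewrite -preimage_setI.
  by move/trivIsetP : tF => /(_ _ _ _ _ ij) ->//; rewrite preimage_set0.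
- by rewrite -preimage_bigcup; exact: mcons.
Qed.

HB.instance Definition _ := isMeasure.Build _ _ _ lebesgue_rV_step
  step0 step_ge0 step_sigma_additive.

Lemma lebesgue_rV_step_sigma_finite : sigma_finite setT lebesgue_rV_step.
Proof.
have [F FT Ffin] : sigma_finite setT (@lebesgue_measure R \x mu)%E.
  have /sigma_finiteP[F [TF ndF Foo]] := sigma_finiteT (@lebesgue_measure R).
  have /sigma_finiteP[G [TG ndG Goo]] := sigma_finiteT mu.
  exists (fun k => F k `*` G k).
    rewrite -setXTT TF TG predeqE => -[x y]; split.
      move=> [/= [k _ Fkx] [l _ Gly]]; exists (maxn k l) => //; split.
      - by move: x Fkx; exact/subsetPset/ndF/leq_maxl.
      - by move: y Gly; exact/subsetPset/ndG/leq_maxr.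
    by move=> [k _ []/= ? ?]; split; exists k.
  move=> k; have [? ?] := Foo k; have [? ?] := Goo k.
  split; first exact: measurableX.
  by rewrite product_measure1E// lte_mul_pinfty// ge0_fin_numE.
pose g (v : 'rV[R]_n.+1) : measurableTypeR R * 'rV[R]_n :=
  (v ord0 ord0, \row_j v ord0 (lift ord0 j)).
have mg : measurable_fun setT g.
  apply/measurable_fun_pairP; split; first exact: measurable_mx_coord.
  apply: measurable_fun_mx => k j.
  rewrite (_ : (fun t => _) = fun v : 'rV[R]_n.+1 => v ord0 (lift ord0 j)).
    exact: measurable_mx_coord.
  by apply/funext => v /=; rewrite mxE.
have gK p : g (rV_cons p) = p.
  rewrite /g !mxE unlift_none; case: p => a v /=; congr pair.
  by apply/rowP => j; rewrite !mxE liftK.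
exists (fun k => g @^-1` F k).
  by rewrite -preimage_bigcup -FT preimage_setT.
move=> k; have [mF Foo] := Ffin k; split.
  by rewrite -[X in measurable X]setTI; exact: mg.
rewrite /lebesgue_rV_step /pushforward -comp_preimage.
by rewrite (_ : g \o _ = id) //; apply/funext => p /=; rewrite gK.
Qed.

HB.instance Definition _ := Measure_isSigmaFinite.Build _ _ _ lebesgue_rV_step
  lebesgue_rV_step_sigma_finite.

End lebesgue_step.

Fixpoint lebesgue_rV n : {sigma_finite_measure set 'rV[R]_n -> \bar R} :=
  if n is n'.+1 then lebesgue_rV_step (lebesgue_rV n')
  else dirac (0 : 'rV[R]_0).

Lemma lebesgue_rV_box n (a b : 'rV[R]_n) :
  (forall i, a ord0 i <= b ord0 i) ->
  lebesgue_rV n [set v : 'rV[R]_n | forall i, a ord0 i <= v ord0 i <= b ord0 i] =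
  (\prod_(i < n) (b ord0 i - a ord0 i))%:E.
Proof.
elim: n a b => [|n IH] a b ab.
  by rewrite big_ord0 /= diracE mem_set// => -[].
pose tl (v : 'rV[R]_n.+1) : 'rV[R]_n := \row_j v ord0 (lift ord0 j).
have tlE v j : tl v ord0 j = v ord0 (lift ord0 j) by rewrite mxE.
rewrite [LHS](_ : _ = (@lebesgue_measure R \x lebesgue_rV n)%E
    (`[a ord0 ord0, b ord0 ord0] `*`
     [set v : 'rV[R]_n | forall i, tl a ord0 i <= v ord0 i <= tl b ord0 i])); last first.
  rewrite /= /lebesgue_rV_step /pushforward; congr (_ _).
  apply/seteqP; split => -[x v] /=.
    move=> h; split => [|i]; first by have := h ord0; rewrite mxE unlift_none in_itv.
    by have := h (lift ord0 i); rewrite mxE liftK !tlE.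
  rewrite in_itv/= => -[hx hv] i; rewrite mxE; case: unliftP => [j ->|-> //].
  by have := hv j; rewrite !tlE.
have mbox m (c d : 'rV[R]_m) :
    measurable [set v : 'rV[R]_m | forall i, c ord0 i <= v ord0 i <= d ord0 i].
  rewrite (_ : [set _ | _] = \bigcap_(i in [set: 'I_m])
      ((fun v : 'rV[R]_m => v ord0 i) @^-1` `[c ord0 i, d ord0 i])).
    apply: fin_bigcap_measurable => [|i _]; first exact: finite_finset.
    rewrite -[X in measurable X]setTI.
    have := @measurable_mx_coord 1 m ord0 i; apply; first exact: measurableT.
    exact: measurable_itv.
  by apply/seteqP; split => [v h i _ /=|v h i]; [rewrite in_itv/=|
    have := h i I; rewrite /= in_itv].
rewrite product_measure1E//; last exact: mbox.
rewrite [X in (_ * X)%E]IH => [|i]; last by rewrite !tlE.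
rewrite [X in (X * _)%E](lebesgue_measure_itv `[a ord0 ord0, b ord0 ord0]%R).
rewrite /= lte_fin big_ord_recl.
under eq_bigr do rewrite !tlE.
have := ab ord0; rewrite le_eqVlt => /orP[/eqP->|->//].
by rewrite ltxx subrr !mul0r mul0e.
Qed.

End borel_matrix.

Section uot.
Context (R : realType) (d : nat).
Local Notation E := 'rV[R]_d.
Implicit Types (Om A : set E) (f phi psi : E -> R) (x y v : E).

Definition dotv x y : R := \sum_i x ord0 i * y ord0 i.
Definition sqnorm x : R := dotv x x.
Definition enorm x : R := Num.sqrt (sqnorm x).
Definition eball x (r : R) : set E := [set y | enorm (y - x) < r].

(* phi0 is a function on the compact set Om, so derivatives at x are taken along
   increments y - x with y in Om.  At interior points this is the usual (Frechet)
   notion; on a convex set with nonempty interior, gradient and Hessian are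
   unique also at boundary points. *)
Definition is_gradient A f x (g : E) :=
  (f y - f x - dotv g (y - x)) / enorm (y - x) @[y --> within A x^'] --> (0 : R).

Definition gradient A f x : E := get (is_gradient A f x).

Definition is_hessian A f x (H : 'M[R]_d) :=
  enorm (gradient A f y - gradient A f x - (y - x) *m H) / enorm (y - x)
    @[y --> within A x^'] --> (0 : R).

Definition loewner_le (S T : 'M[R]_d) := forall v, 0 <= dotv (v *m (T - S)) v.

Definition cost x y : R := sqnorm (x - y) / 2.

Definition c_transform Om phi x : \bar R :=
  ereal_inf [set (cost x y - phi y)%:E | y in Om].

Definition c_concave Om phi :=
  exists psi, forall x, Om x -> (phi x)%:E = c_transform Om psi x.

Definition dual_feasible Om phi psi :=
  [/\ {within Om, continuous phi} /\ {within Om, continuous psi},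
      [bounded phi x | x in Om] /\ [bounded psi x | x in Om] &
      forall x y, Om x -> Om y -> phi x + psi y <= cost x y].

Definition dual_value Om (mu nu : set E -> \bar R) phi psi : \bar R :=
  (\int[mu]_(x in Om) (1 - expR (- phi x))%:E +
   \int[nu]_(y in Om) (1 - expR (- psi y))%:E)%E.

Definition solves_dual Om (mu nu : set E -> \bar R) phi psi :=
  dual_feasible Om phi psi /\
  (forall phi' psi', dual_feasible Om phi' psi' ->
    (dual_value Om mu nu phi' psi' <= dual_value Om mu nu phi psi)%E).

Definition optimal_potential Om (mu nu : set E -> \bar R) phi :=
  c_concave Om phi /\
  solves_dual Om mu nu phi (fun y => fine (c_transform Om phi y)).

Definition T0 Om phi x : E := x - gradient Om phi x.

Definition lambda0 Om phi x : R :=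
  expR (- phi x + sqnorm (gradient Om phi x) / 4).

Definition mass Om (mu : set E -> \bar R) : R := fine (mu Om).

Definition normalized Om (mu : set E -> \bar R) (A : set E) : \bar R :=
  ((mass Om mu)^-1%:E * mu A)%E.

Definition hessian_bounds Om phi := exists kappa : R,
  0 < kappa < 1 /\
  forall x, Om x -> (exists g, is_gradient Om phi x g) /\
    exists H, [/\ is_hessian Om phi x H,
      loewner_le ((1 - kappa^-1)%:M) H & loewner_le H ((1 - kappa)%:M)].

Definition regular_domain Om :=
  [/\ compact Om, convex_set Om &
    exists eps0 delta0 : R, [/\ 0 < eps0, 0 < delta0 &
      forall x (eps : R), Om x -> 0 < eps < eps0 ->
        (delta0%:E * lebesgue_rV R d (eball x eps) <=
         lebesgue_rV R d (eball x eps `&` Om))%E]].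

Definition has_density Om (mu : set E -> \bar R) (p : E -> R) :=
  measurable_fun Om p /\
  forall A, measurable A ->
    mu A = (\int[lebesgue_rV R d]_(x in Om `&` A) (p x)%:E)%E.

Definition bounded_densities Om (mu nu : set E -> \bar R) :=
  exists (p q : E -> R) (bmin bmax : R),
    [/\ has_density Om (normalized Om mu) p,
        has_density Om (normalized Om nu) q, 0 < bmin &
        forall x, Om x -> bmin <= p x <= bmax /\ bmin <= q x <= bmax].

(* ln 0 = 0, so that kl_entropy 0 = 1. *)
Definition kl_entropy (r : R) : R := r * ln r - r + 1.

(* Term of index i of the discrete KL divergence sum_i v_i F(u_i / v_i):
   infinite when u is not absolutely continuous with respect to v at i. *)
Definition kl_term (u v : R) : \bar R :=
  if v == 0 then if u == 0 then 0%E else +oo%E else (v * kl_entropy (u / v))%:E.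

Definition kl_vec k (u v : 'I_k -> R) : \bar R := (\sum_i kl_term (u i) (v i))%E.

Section estimator.
Context (n m : nat) (X : 'I_n -> E) (Y : 'I_m -> E) (Mx My : R).
Implicit Types (G : 'M[R]_(n, m)) (i : 'I_n).

Definition row_mass G i : R := \sum_j G i j.
Definition col_mass G (j : 'I_m) : R := \sum_i G i j.

Definition empirical_uot G : \bar R :=
  ((\sum_i \sum_j cost (X i) (Y j) * G i j)%:E +
   kl_vec (row_mass G) (fun=> Mx / n%:R)%R +
   kl_vec (col_mass G) (fun=> My / m%:R)%R)%E.

Definition optimal_plan G :=
  (forall i j, 0 <= G i j) /\
  forall G', (forall i j, 0 <= G' i j) ->
    (empirical_uot G <= empirical_uot G')%E.

Definition That G i : E :=
  if 0 < row_mass G i then (row_mass G i)^-1 *: \sum_j G i j *: Y j else X i.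

Definition ahat G i : R := Num.sqrt (row_mass G i / (Mx / n%:R)).

Definition clip (a b t : R) : R := Num.min b (Num.max a t).

Definition lambdahat (wlo whi : R) G i : R :=
  clip wlo whi (ahat G i ^+ 2) * expR (sqnorm (X i - That G i) / 4).

Definition voronoi Om i : set E :=
  [set x | Om x /\ forall k, k != i -> enorm (x - X i) <= enorm (x - X k)].

Definition nn_extension Om (V : nmodType) (F : 'I_n -> V) x : V :=
  \sum_(i < n | x \in voronoi Om i) F i.

End estimator.

Definition T1NN n m (X : 'I_n -> E) (Y : 'I_m -> E) Om (G : 'M[R]_(n, m)) : E -> E :=
  nn_extension X Om (That X Y G).

Definition a1NN n m (X : 'I_n -> E) (Mx : R) Om (G : 'M[R]_(n, m)) : E -> R :=
  nn_extension X Om (ahat Mx G).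

Definition lambda1NN n m (X : 'I_n -> E) (Y : 'I_m -> E) (Mx : R) (wlo whi : R)
    Om (G : 'M[R]_(n, m)) : E -> R :=
  nn_extension X Om (lambdahat X Y Mx wlo whi G).

Definition emp_rate (n : nat) : R :=
  if (d <= 3)%N then (Num.sqrt n%:R)^-1
  else if d == 4%N then ln n%:R / Num.sqrt n%:R
  else n%:R `^ (- 2 / d%:R).

End uot.

Section sampling.
Context (R : realType) (dW : measure_display) (W : measurableType dW).
Context (P : probability W R).
Local Open Scope ereal_scope.

Definition mutually_independent (I : choiceType) (dT : measure_display)
    (T : measurableType dT) (Z : I -> {RV P >-> T}) :=
  forall (J : seq I) (A : I -> set T), uniq J -> (forall i, measurable (A i)) ->
    P (\bigcap_(i in [set` J]) Z i @^-1` A i) = \prod_(i <- J) P (Z i @^-1` A i).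

Definition joint_samples (dT : measure_display) (T : measurableType dT)
    (X Y : nat -> {RV P >-> T}) (i : nat + nat) : {RV P >-> T} :=
  match i with inl k => X k | inr k => Y k end.

(* Mhat k estimates the mass M with rate a and lower-bound factor c.  The lower
   bound is only required eventually along almost every outcome; this is implied
   by an almost sure lower bound for all k beyond a deterministic threshold. *)
Definition mass_estimator (Mhat : nat -> {RV P >-> R}) (M c : R) (a : nat -> R) :=
  [/\ {ae P, forall w, Mhat k w @[k --> \oo] --> M},
      {ae P, forall w, \forall k \near \oo, (c * M <= Mhat k w)%R} &
      \forall k \near \oo, 'E_P[fun w => `|Mhat k w - M|%R] <= (a k)%:E].

End sampling.

(* Main.v *)
From HB Require Import structures.
Require Import Defs.
From mathcomp Require Import all_boot all_order all_algebra.
From mathcomp Require Import all_classical all_reals all_analysis.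
From mathcomp Require Import measurable_realfun ring lra.

Set Implicit Arguments.
Unset Strict Implicit.
Unset Printing Implicit Defensive.
Import Order.TTheory GRing.Theory Num.Def Num.Theory.
Import numFieldNormedType.Exports.
Local Open Scope classical_set_scope.
Local Open Scope ring_scope.

(* Put u(x) = |x|^2/2 - phi0(x), so that T0 = grad u.  By (A1), u is uniformly
   convex and T0 is Lipschitz on the domain.  Hence Z(y), the minimizer over x of
   cost x y - phi0 x, is unique and Lipschitz in y, and the dual slack
   s(x, y) = cost x y - phi0 x - psi0 y is at least kappa/2 |x - Z(y)|^2.  The
   first variation of the dual problem along phi0 + t h shows that Z pushes
   e^(-psi0) nu forward to e^(-phi0) mu.  It follows that T0(Z(y)) = y for
   nu-almost every y, and then s(x, y) <= |x - Z(y)|^2 / (2 kappa).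

   For an optimal empirical plan g with row masses mu_i a_i^2, the quantity
   sum s(X_i, Y_j) g_ij + sum mu_i (a_i - e^(-phi0(X_i)/2))^2 is at most the same
   duality gap of any competitor.  Lower and upper bounds on s turn this into an
   estimate of the two errors at the sample points, provided that a competitor
   moves the weights mu_i e^(-phi0(X_i)) at X_i to the weights
   nu_j e^(-psi0(Y_j)) at Z(Y_j) at small quadratic cost.  Both weighted samples
   approximate the same measure, so greedy matching on dyadic cells costs
   sum_k 4^(-k) D_k, where D_k is the l^1 discrepancy on cells of side 2^(-k), of
   expectation O(2^(kd/2) n^(-1/2)).  Summing over k gives the empirical rate.

   The sample is (ln n / n)^(1/d)-dense with probability 1 - O(1/n).  Then each
   Voronoi cell has mass O(ln n / n), so the integrated error is O(ln n) times
   the mean error at the sample points, plus the squared mesh size. *)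

(** * Euclidean geometry *)

(** A priori [T0] need not undo [Z]: where [Z y] lies on the boundary of the domain, first-order
    optimality is only a variational inequality. Everything is therefore built on [Z], which exists
    and is Lipschitz for every [y], and [T0 (Z y) = y] is recovered almost everywhere. A competitor
    only needs sub-marginals, because the entropy gap of missing mass is at most that mass;
    unmatched mass is charged to the coarsest discrepancy. In the other direction the entropy gap
    dominates a squared Hellinger distance, which pays for the nearly empty rows, whose barycentres
    carry no information. The cells of one level are disjoint, so the variances of their empirical
    masses sum to O(1/n) whatever their number N; this gives an l^1 deviation of order sqrt(N/n).
    Exceptional outcomes (a sample that is not dense, or a mass estimate off by a factor two) cost a
    bounded loss times their probability; for the masses this is Markov's inequality, so it again
    brings in a_n and b_m. *)

Section euclid.
Context (R : realType) (d : nat).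
Local Notation E := 'rV[R]_d.
Implicit Types (x y z v w : E) (a b : R).

Lemma dotvC x y : dotv x y = dotv y x.
Proof. by apply: eq_bigr => i _; rewrite mulrC. Qed.

Lemma dotvDl x y z : dotv (x + y) z = dotv x z + dotv y z.
Proof. by rewrite /dotv -big_split; apply: eq_bigr => i _; rewrite mxE mulrDl. Qed.

Lemma dotvZl a x y : dotv (a *: x) y = a * dotv x y.
Proof. by rewrite /dotv mulr_sumr; apply: eq_bigr => i _; rewrite mxE mulrA. Qed.

Lemma dotvNl x y : dotv (- x) y = - dotv x y.
Proof. by rewrite -scaleN1r dotvZl mulN1r. Qed.

Lemma dotvBl x y z : dotv (x - y) z = dotv x z - dotv y z.
Proof. by rewrite dotvDl dotvNl. Qed.

Lemma dotvDr x y z : dotv x (y + z) = dotv x y + dotv x z.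
Proof. by rewrite dotvC dotvDl !(dotvC x). Qed.

Lemma dotvZr a x y : dotv x (a *: y) = a * dotv x y.
Proof. by rewrite dotvC dotvZl dotvC. Qed.

Lemma dotvNr x y : dotv x (- y) = - dotv x y.
Proof. by rewrite dotvC dotvNl dotvC. Qed.

Lemma dotvBr x y z : dotv x (y - z) = dotv x y - dotv x z.
Proof. by rewrite dotvDr dotvNr. Qed.

Lemma dotv0l y : dotv 0 y = 0.
Proof. by rewrite -(scale0r 0) dotvZl mul0r. Qed.

Lemma dotv0r y : dotv y 0 = 0.
Proof. by rewrite dotvC dotv0l. Qed.

Definition dotvE := (dotvDl, dotvDr, dotvBl, dotvBr, dotvZl, dotvZr, dotvNl, dotvNr).

Lemma dotv_suml (I : finType) (F : I -> E) y : dotv (\sum_i F i) y = \sum_i dotv (F i) y.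
Proof.
by elim/big_rec2: _ => [|i p q _ <-]; rewrite ?dotv0l ?dotvDl.
Qed.

Lemma sqnorm_ge0 x : 0 <= sqnorm x.
Proof. by apply: sumr_ge0 => i _; rewrite -expr2 sqr_ge0. Qed.

Lemma sqnorm_eq0 x : (sqnorm x == 0) = (x == 0).
Proof.
apply/idP/eqP => [|->]; last by rewrite /sqnorm dotv0l.
rewrite psumr_eq0 => [/allP h|i _]; last by rewrite -expr2 sqr_ge0.
apply/rowP => i; rewrite mxE; apply/eqP.
by have := h i (mem_index_enum i); rewrite /= mulf_eq0 orbb.
Qed.

Lemma sqnormN x : sqnorm (- x) = sqnorm x.
Proof. by rewrite /sqnorm dotvNl dotvNr opprK. Qed.

Lemma sqnormZ a x : sqnorm (a *: x) = a ^+ 2 * sqnorm x.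
Proof. by rewrite /sqnorm dotvZl dotvZr mulrA. Qed.

Lemma sqnormD x y : sqnorm (x + y) = sqnorm x + 2 * dotv x y + sqnorm y.
Proof. by rewrite /sqnorm !dotvE (dotvC y x); ring. Qed.

Lemma sqnormB x y : sqnorm (x - y) = sqnorm x - 2 * dotv x y + sqnorm y.
Proof. by rewrite sqnormD sqnormN dotvNr; ring. Qed.

Lemma sqnormBC x y : sqnorm (x - y) = sqnorm (y - x).
Proof. by rewrite -opprB sqnormN. Qed.

Lemma sqnormD_le x y : sqnorm (x + y) <= 2 * sqnorm x + 2 * sqnorm y.
Proof. by have := sqnorm_ge0 (x - y); rewrite sqnormB sqnormD; lra. Qed.

Lemma enorm_ge0 x : 0 <= enorm x.
Proof. exact: sqrtr_ge0. Qed.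

Lemma enorm_sqr x : enorm x ^+ 2 = sqnorm x.
Proof. by rewrite sqr_sqrtr// sqnorm_ge0. Qed.

Lemma enorm_eq0 x : (enorm x == 0) = (x == 0).
Proof. by rewrite -sqnorm_eq0 -enorm_sqr sqrf_eq0. Qed.

Lemma enorm_gt0 x : (0 < enorm x) = (x != 0).
Proof. by rewrite lt_def enorm_eq0 enorm_ge0 andbT. Qed.

Lemma enorm0 : enorm (0 : E) = 0.
Proof. by apply/eqP; rewrite enorm_eq0. Qed.

Lemma enormN x : enorm (- x) = enorm x.
Proof. by rewrite /enorm sqnormN. Qed.

Lemma enormBC x y : enorm (x - y) = enorm (y - x).
Proof. by rewrite -opprB enormN. Qed.

Lemma enormZ a x : enorm (a *: x) = `|a| * enorm x.
Proof. by rewrite /enorm sqnormZ sqrtrM ?sqr_ge0// sqrtr_sqr. Qed.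

Lemma enorm_le x b : 0 <= b -> (enorm x <= b) = (sqnorm x <= b ^+ 2).
Proof.
by move=> b0; rewrite -enorm_sqr ler_sqr ?nnegrE ?enorm_ge0.
Qed.

Lemma dotv_le x y : dotv x y <= enorm x * enorm y.
Proof.
have [->|y0] := eqVneq y 0; first by rewrite dotv0r enorm0 mulr0.
have [->|x0] := eqVneq x 0; first by rewrite dotv0l enorm0 mul0r.
have X := enorm_gt0 x; rewrite x0 in X.
have Y := enorm_gt0 y; rewrite y0 in Y.
(* Expanded, this square is twice [enorm x * enorm y] times the difference of the two sides. *)
have := sqnorm_ge0 (enorm y *: x - enorm x *: y).
rewrite sqnormB !sqnormZ -!enorm_sqr dotvZl dotvZr => h.
have {}h : 0 <= (enorm x * enorm y) * (enorm x * enorm y - dotv x y) by nra.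
by rewrite pmulr_rge0 ?mulr_gt0// in h; lra.
Qed.

Lemma dotv_norm_le x y : `|dotv x y| <= enorm x * enorm y.
Proof.
rewrite ler_norml dotv_le andbT lerNl -dotvNl.
by rewrite (le_trans (dotv_le _ _))// enormN.
Qed.

Lemma enormD x y : enorm (x + y) <= enorm x + enorm y.
Proof.
rewrite enorm_le ?addr_ge0 ?enorm_ge0// sqnormD -!enorm_sqr.
by have := dotv_le x y; nra.
Qed.

Lemma enormB_trans y x z : enorm (x - z) <= enorm (x - y) + enorm (y - z).
Proof. by rewrite (le_trans _ (enormD _ _))// addrA subrK. Qed.

Lemma enorm_coord x i : `|x ord0 i| <= enorm x.
Proof.
rewrite -(@ler_sqr _ `|_|) ?nnegrE ?enorm_ge0// enorm_sqr real_normK ?num_real//.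
rewrite /sqnorm /dotv (bigD1 i)//= -expr2 lerDl sumr_ge0// => j _.
by rewrite -expr2 sqr_ge0.
Qed.

Lemma sqnorm_coord_le x b : (forall i, `|x ord0 i| <= b) -> sqnorm x <= d%:R * b ^+ 2.
Proof.
move=> h; rewrite /sqnorm /dotv.
rewrite (le_trans (ler_sum _ (G := fun=> b ^+ 2) _))//.
  move=> i _; rewrite -expr2 -(real_normK (num_real _)).
  by rewrite ler_sqr ?nnegrE// (le_trans _ (h i)).
by rewrite sumr_const card_ord mulr_natl.
Qed.

Lemma enorm_coord_le x b : 0 <= b -> (forall i, `|x ord0 i| <= b) ->
  enorm x <= d%:R * b.
Proof.
move=> b0 h; rewrite enorm_le ?mulr_ge0//.
rewrite (le_trans (sqnorm_coord_le h))// exprMn ler_wpM2r ?sqr_ge0//.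
rewrite -natrX ler_nat; case: d => // k; exact: leq_pmulr.
Qed.

(** The library topology on row vectors is that of the maximum norm; this bound and the next one let
    limits and balls be measured with [enorm]. *)
Lemma mx_norm_enorm x : `|x| <= enorm x.
Proof.
rewrite /Num.norm/= mx_normrE bigmax_le ?enorm_ge0// => -[i j] _ /=.
by rewrite ord1 enorm_coord.
Qed.

Lemma enorm_mx_norm x : enorm x <= d%:R * `|x|.
Proof.
apply: enorm_coord_le => // i.
rewrite [leRHS]/Num.norm/= mx_normrE.
by rewrite (bigD1 (ord0, i))//= le_max lexx.
Qed.

Section filters.
Context (T : Type) (F : set_system T) {FF : Filter F}.

Lemma cvg_dotv (f g : T -> E) x y :
  f @ F --> x -> g @ F --> y -> dotv (f t) (g t) @[t --> F] --> dotv x y.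
Proof.
move=> fx gy.
have H (h : T -> E) (u : E) i : h @ F --> u -> h t ord0 i @[t --> F] --> u ord0 i.
  by move=> hu; exact: (cvg_comp h _ hu (@coord_continuous R 1 d ord0 i u)).
rewrite /dotv; apply: cvg_big => [|i _]; first exact: add_continuous.
by apply: cvgM; exact: H.
Qed.

Lemma cvg_enorm (f : T -> E) x : f @ F --> x -> enorm (f t) @[t --> F] --> enorm x.
Proof.
move=> fx; exact: (cvg_comp _ _ (cvg_dotv fx fx) (@sqrt_continuous R _)).
Qed.

Lemma enorm_cvg0 (f : T -> E) x : enorm (f t - x) @[t --> F] --> 0 -> f @ F --> x.
Proof.
move=> fx; apply/cvgrPdist_le => e e0.
move/cvgrPdist_le : fx => /(_ _ e0); apply: filterS => t.
rewrite sub0r normrN ger0_norm ?enorm_ge0// => h.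
by rewrite distrC (le_trans (mx_norm_enorm _)).
Qed.

End filters.

(** Jensen's inequality for the squared norm. Up to the factor [r], the difference of the two sides
    is the weighted variance of [Y] about its mean [M]. *)
Lemma sqnorm_mean_le (I : finType) (p : I -> R) (Y : I -> E) z :
  (forall i, 0 <= p i) -> 0 < \sum_i p i ->
  sqnorm ((\sum_i p i)^-1 *: (\sum_i p i *: Y i) - z) <=
  (\sum_i p i)^-1 * \sum_i p i * sqnorm (Y i - z).
Proof.
move=> p0 r0; set r := \sum_i p i in r0 *; set M := _ *: _.
have rM : r *: M = \sum_i p i *: Y i by rewrite scalerA divff ?gt_eqF// scale1r.
suff : 0 <= \sum_i p i * sqnorm (Y i - z) - r * sqnorm (M - z).
  rewrite subr_ge0 => h; rewrite -[leLHS](mulKf (lt0r_neq0 r0)).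
  by rewrite ler_pM2l ?invr_gt0.
have -> : \sum_i p i * sqnorm (Y i - z) - r * sqnorm (M - z) =
    \sum_i p i * sqnorm (Y i - M).
  rewrite (eq_bigr (fun i => p i * sqnorm (Y i - M) +
      2 * dotv (p i *: Y i - p i *: M) (M - z) + p i * sqnorm (M - z))); last first.
    move=> i _; rewrite -[Y i - z](subrKA M) (sqnormD (Y i - M)) -scalerBr dotvZl.
    by ring.
  rewrite !big_split/= -mulr_suml -/r.
  rewrite -mulr_sumr -dotv_suml sumrB -scaler_suml -/r -rM subrr dotv0l; ring.
by apply: sumr_ge0 => i _; rewrite mulr_ge0// sqnorm_ge0.
Qed.

End euclid.

(** * Potentials with bounded Hessian *)

Section convex_analysis.
Context (R : realType).

(** Differentiability relative to [[0, 1]], written without quotients: at the ends of a segment of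
    the domain only one-sided increments are available. *)
Definition diff_at (F : R -> R) (t l : R) := forall e : R, 0 < e ->
  exists2 del : R, 0 < del & forall s : R, 0 <= s <= 1 -> `|s - t| < del ->
    `|F s - F t - (s - t) * l| <= e * `|s - t|.

Lemma mvt_unit (F DF : R -> R) (b : R) :
  (forall t : R, 0 <= t <= 1 -> diff_at F t (DF t)) -> 0 < b <= 1 ->
  exists2 c : R, 0 < c < b & F b - F 0 = DF c * b.
Proof.
move=> hF /andP[b0 b1].
have dF : forall x : R, x \in `]0, b[%R -> is_derive x 1 F (DF x).
  move=> t; rewrite in_itv/= => /andP[t0 tb].
  have t01 : 0 <= t <= 1 by rewrite ltW//= (le_trans (ltW tb)).
  suff : h^-1 *: (F (h *: 1 + t) - F t) @[h --> 0^'] --> DF t.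
    by move=> H; apply: DeriveDef; [apply/cvg_ex; exists (DF t)|exact: cvg_lim].
  apply/cvgrPdist_le => e e0; have [del del0 hd] := hF t t01 e e0.
  (* Increments smaller than [t] and [b - t] keep [h + t] inside []0, b[]. *)
  have m0 : 0 < Num.min del (Num.min t (b - t)).
    by rewrite !lt_min del0 t0 subr_gt0.
  near=> h.
  have h0 : h != 0 by near: h; exact: nbhs_dnbhs_neq.
  have : `|h| < Num.min del (Num.min t (b - t)).
    near: h; apply: dnbhs0_lt; exact: m0.
  rewrite !lt_min => /and3P[hdel ht hbt].
  rewrite /GRing.scale/= mulr1.
  have := hd (h + t) _ _; rewrite addrK => H.
  have {}H : `|F (h + t) - F t - h * DF t| <= e * `|h|.
    apply: H => //; move: ht hbt; rewrite !ltr_norml; lra.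
  rewrite distrC -(ler_pM2r (_ : 0 < `|h|)) ?normr_gt0//.
  rewrite -normrM mulrBl mulrC mulrA divff// mul1r (mulrC (DF t)).
  exact: H.
have cF : {within `[0, b], continuous F}.
  apply/subspace_continuousP => t /=; rewrite in_itv/= => /andP[t0 tb].
  have t01 : 0 <= t <= 1 by rewrite t0 (le_trans tb).
  apply/cvgrPdist_le => e e0.
  have [del del0 hd] := hF t t01 1 ltr01.
  have m0 : 0 < Num.min del (e / (1 + `|DF t|)).
    by rewrite lt_min del0 divr_gt0// ltr_wpDr.
  rewrite near_withinE; apply/nbhs_ballP; exists (Num.min del (e / (1 + `|DF t|))) => //= s.
  rewrite /ball/= lt_min distrC => /andP[sd se] /=; rewrite in_itv/= => /andP[s0 sb].
  have := hd s _ sd; rewrite s0 (le_trans sb b1) => /(_ isT).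
  rewrite mul1r => h.
  rewrite distrC (_ : F s - F t = F s - F t - (s - t) * DF t + (s - t) * DF t); last by rewrite subrK.
  rewrite (le_trans (ler_normD _ _))// normrM.
  move: se; rewrite ltr_pdivlMr ?ltr_wpDr// mulrDr mulr1; lra.
have [c cb ->] := MVT b0 dF cF.
by exists c; [rewrite in_itv/= in cb|rewrite subr0].
Unshelve. all: by end_near. Qed.

Context (d : nat).
Local Notation E := 'rV[R]_d.

(** Turns a limit of quotients into a bound that also holds at [y = x], thanks to [N x = 0], and
    replaces balls of the maximum norm by Euclidean ones. *)
Lemma quotient_cvg0P (A : set E) (x : E) (N : E -> R) : N x = 0 ->
  (N y / enorm (y - x) @[y --> within A x^'] --> (0 : R)) ->
  forall e : R, 0 < e -> exists2 del : R, 0 < del & forall y, A y ->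
    enorm (y - x) < del -> `|N y| <= e * enorm (y - x).
Proof.
move=> Nx /cvgrPdist_le hN e e0.
have := hN e e0; rewrite near_withinE => /nbhs_ballP[del /= del0 h].
exists del => // y Ay yd; have [->|yx] := eqVneq y x.
  by rewrite Nx subrr enorm0 mulr0 normr0.
have yx0 : 0 < enorm (y - x) by rewrite enorm_gt0 subr_eq0.
have := h y _ yx Ay; rewrite sub0r normrN normrM normfV (gtr0_norm yx0) ler_pdivrMr//.
apply; rewrite -ball_normE /ball_/= distrC.
by rewrite (le_lt_trans (mx_norm_enorm _)).
Qed.


(** The Bregman divergence of [u(x) = sqnorm x / 2 - f x], whose gradient at [z] is [T0 Om f z]. *)
Definition bregman (f : E -> R) (Om : set E) (x z : E) : R :=
  sqnorm (x - z) / 2 - (f x - f z - dotv (gradient Om f z) (x - z)).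

Variables (Om : set E) (f : E -> R) (kappa : R).
Hypothesis Om_convex : convex_set Om.
Hypothesis kappa01 : 0 < kappa < 1.
Hypothesis f_hess : forall x, Om x -> (exists g, is_gradient Om f x g) /\
    exists H, [/\ is_hessian Om f x H,
      loewner_le ((1 - kappa^-1)%:M) H & loewner_le H ((1 - kappa)%:M)].

Local Notation grad := (gradient Om f).

Lemma convex_seg x y (t : R) : Om x -> Om y -> 0 <= t <= 1 -> Om (x + t *: (y - x)).
Proof.
move=> Ox Oy /andP[t0 t1].
have H := Om_convex (Itv01 t0 t1) (mem_set Oy) (mem_set Ox).
move: H; rewrite inE /conv/=; congr Om.
by rewrite /unstable.onem scalerBl scale1r scalerBr addrCA addrC -addrA.
Qed.

Lemma segB (x v : E) (s t : R) : x + s *: v - (x + t *: v) = (s - t) *: v.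
Proof. by rewrite opprD addrACA subrr add0r scalerBl. Qed.

(** Dividing by [1 + c] instead of [c] covers degenerate segments; the same device recurs in the
    next proofs. *)
Lemma scale_small (e del c : R) : 0 < e -> 0 < del -> 0 <= c ->
  exists2 del' : R, 0 < del' & forall s : R, `|s| < del' -> `|s| * c < del.
Proof.
move=> e0 del0 c0; exists (del / (1 + c)) => [|s]; first by rewrite divr_gt0// ltr_wpDr.
rewrite ltr_pdivlMr ?ltr_wpDr// mulrDr mulr1; apply: le_lt_trans.
by rewrite lerDr.
Qed.

Lemma seg_diff x y : Om x -> Om y -> forall t : R, 0 <= t <= 1 ->
  diff_at (fun t => f (x + t *: (y - x))) t (dotv (grad (x + t *: (y - x))) (y - x)).
Proof.
move=> Ox Oy t t01 e e0; set v := y - x.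
have [gex _] := f_hess (convex_seg Ox Oy t01).
have /quotient_cvg0P H := getPex gex.
have e10 : 0 < e / (1 + enorm v) by rewrite divr_gt0// ltr_wpDr// enorm_ge0.
have [|del del0 {}H] := H _ (e / (1 + enorm v)) e10; first by rewrite !subrr dotv0r subr0.
have [del' del'0 hdel'] := scale_small e0 del0 (enorm_ge0 v).
exists del' => // s s01 st.
have := H _ (convex_seg Ox Oy s01); rewrite segB enormZ => /(_ (hdel' _ st)).
rewrite dotvZr; move=> /le_trans; apply.
rewrite mulrCA mulrC ler_wpM2r// mulrAC ler_pdivrMr ?ltr_wpDr ?enorm_ge0//.
by rewrite ler_pM2l// -/v; lra.
Qed.

Lemma seg_hess x y e : Om x -> Om y -> exists DG : R -> R, forall t : R, 0 <= t <= 1 ->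
  diff_at (fun t => dotv (grad (x + t *: (y - x))) e) t (DG t) /\
  (e = y - x -> (1 - kappa^-1) * sqnorm (y - x) <= DG t <= (1 - kappa) * sqnorm (y - x)).
Proof.
move=> Ox Oy; set v := y - x.
(* One Hessian is chosen at each point of the segment; outside [[0, 1]] the value [0] is a dummy. *)
have /choice[H HP] : forall t : R, exists H, 0 <= t <= 1 ->
    [/\ is_hessian Om f (x + t *: v) H,
      loewner_le ((1 - kappa^-1)%:M) H & loewner_le H ((1 - kappa)%:M)].
  move=> t; have [t01|] := boolP (0 <= t <= 1); last by exists 0.
  have [_ [H HP]] := f_hess (convex_seg Ox Oy t01).
  by exists H.
exists (fun t => dotv (v *m H t) e) => t t01; split => [eps eps0|->]; last first.
  have [_ h1 h2] := HP t t01; move: (h1 v) (h2 v).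
  rewrite !mulmxBr !dotvBl !mul_mx_scalar !dotvZl -/(sqnorm v) !subr_ge0.
  by move=> -> ->.
have [/quotient_cvg0P h _ _] := HP t t01.
(* The two denominators absorb the length [enorm v] of the segment and the factor [enorm e] from
   Cauchy-Schwarz. *)
pose eps' := eps / (1 + enorm v) / (1 + enorm e).
have e10 : 0 < eps' by rewrite !divr_gt0// ltr_wpDr// enorm_ge0.
have [|del del0 {}h] := h _ eps' e10; first by rewrite !subrr mul0mx subr0 enorm0.
have [del' del'0 hdel'] := scale_small eps0 del0 (enorm_ge0 v).
exists del' => // s s01 st.
have := h _ (convex_seg Ox Oy s01); rewrite segB enormZ => /(_ (hdel' _ st)).
rewrite ger0_norm ?enorm_ge0// => {}h.
rewrite -scalemxAl in h.
rewrite -dotvBl -dotvZl -dotvBl (le_trans (dotv_norm_le _ _))//.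
rewrite (le_trans (ler_wpM2r (enorm_ge0 _) h))//.
rewrite (_ : eps' * _ * _ = (eps * `|s - t|) * (enorm v / (1 + enorm v)) * (enorm e / (1 + enorm e))); last by rewrite /eps'; ring.
have q (u : E) : enorm u / (1 + enorm u) <= 1.
  by rewrite ler_pdivrMr ?mul1r ?lerDr// ltr_wpDr// enorm_ge0.
have q0 (u : E) : 0 <= enorm u / (1 + enorm u).
  by rewrite divr_ge0 ?addr_ge0 ?enorm_ge0.
have es0 : 0 <= eps * `|s - t| by rewrite mulr_ge0// ltW.
have h1 : eps * `|s - t| * (enorm v / (1 + enorm v)) <= eps * `|s - t|.
  by rewrite -[leRHS]mulr1 ler_wpM2l.
apply: le_trans h1; rewrite -[leRHS]mulr1 ler_wpM2l// mulr_ge0//.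
Qed.

Lemma grad_mono x y (t : R) : Om x -> Om y -> 0 < t <= 1 ->
  t * ((1 - kappa^-1) * sqnorm (y - x)) <=
    dotv (grad (x + t *: (y - x)) - grad x) (y - x)
  <= t * ((1 - kappa) * sqnorm (y - x)).
Proof.
move=> Ox Oy t01; have [DG hDG] := seg_hess (y - x) Ox Oy.
have [|c /andP[c0 ct]] := @mvt_unit (fun t => dotv (grad (x + t *: (y - x))) (y - x)) DG t _ t01.
  by move=> s /hDG[].
rewrite scale0r addr0 -dotvBl => ->.
have [t0 t1] := andP t01.
have [|_ /(_ erefl)/andP[h1 h2]] := hDG c; first by rewrite ltW//= (le_trans (ltW ct)).
by rewrite (mulrC (DG c)) !ler_pM2l// h1.
Qed.

(** Second-order Taylor bounds from the mean value theorem alone. Along the segment, the quadratic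
    [a / 2 * t ^+ 2] is subtracted from [f], with [a] one of the two Hessian bounds times
    [sqnorm (x - z)]; [grad_mono] then compares the derivative at the intermediate point with the
    one at [z]. *)
Lemma bregman_bounds x z : Om x -> Om z ->
  kappa / 2 * sqnorm (x - z) <= bregman f Om x z <= (2 * kappa)^-1 * sqnorm (x - z).
Proof.
move=> Ox Oz; have [k0 k1] := andP kappa01.
pose F (a : R) (t : R) := f (z + t *: (x - z)) - a / 2 * t ^+ 2.
pose DF (a : R) (t : R) := dotv (grad (z + t *: (x - z))) (x - z) - a * t.
have dF a t : 0 <= t <= 1 -> diff_at (F a) t (DF a t).
  move=> t01 e e0; have e20 : 0 < e / 2 by rewrite divr_gt0.
  have [del del0 h] := seg_diff Oz Ox t01 e20.
  have m0 : 0 < Num.min del (e / (1 + `|a|)) by rewrite lt_min del0 divr_gt0// ltr_wpDr.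
  exists (Num.min del (e / (1 + `|a|))) => // s s01; rewrite lt_min => /andP[sd se].
  have {}h := h s s01 sd.
  rewrite /F /DF (_ : _ - _ - _ = (f (z + s *: (x - z)) - f (z + t *: (x - z)) -
      (s - t) * dotv (grad (z + t *: (x - z))) (x - z)) - a / 2 * (s - t) ^+ 2); last by field.
  rewrite (le_trans (ler_normB _ _))// [leRHS](_ : _ = e / 2 * `|s - t| + e / 2 * `|s - t|); last by field.
  rewrite lerD// normrM normrX expr2 mulrA ler_wpM2r//.
  rewrite normrM (ger0_norm (_ : 0 <= 2^-1)) ?invr_ge0// mulrAC ler_wpM2r ?invr_ge0//.
  move: se; rewrite ltr_pdivlMr ?ltr_wpDr// mulrDr mulr1 => se.
  by rewrite mulrC; have := normr_ge0 (s - t); lra.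
have FE a : F a 1 - F a 0 = f x - f z - a / 2.
  by rewrite /F scale1r scale0r addr0 (addrC z) subrK; ring.
have key a : exists2 c : R, 0 < c < 1 & f x - f z - a / 2 = DF a c.
  have [|c c01] := @mvt_unit (F a) (DF a) 1 (dF a); first by rewrite ltr01 lexx.
  by rewrite mulr1 FE => h; exists c.
rewrite /bregman.
have [c c01 h1] := key ((1 - kappa) * sqnorm (x - z)).
have [c' c'01 h2] := key ((1 - kappa^-1) * sqnorm (x - z)).
have [c0 c1] := andP c01; have [c'0 c'1] := andP c'01.
have := @grad_mono z x c Oz Ox; rewrite c0 ltW// => /(_ isT).
have := @grad_mono z x c' Oz Ox; rewrite c'0 ltW// => /(_ isT).
move: h1 h2; rewrite /DF invfM.
move: (grad (z + c *: _)) (grad (z + c' *: _)) (grad z) => a b g.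
rewrite !dotvBl; move: (dotv a _) (dotv b _) (dotv g _) (sqnorm _) (kappa^-1) => {}a {}b {}g q k.
move=> h1 h2 /andP[h3 _] /andP[_ h4]; apply/andP; split; lra.
Qed.

(** The pairing is the sum of the Bregman divergences of [x] from [z] and of [z] from [x]. *)
Lemma T0_mono x z : Om x -> Om z -> 0 <= dotv (T0 Om f x - T0 Om f z) (x - z).
Proof.
move=> Ox Oz; have [k0 k1] := andP kappa01.
have /andP[h1 _] := bregman_bounds Ox Oz; have /andP[h2 _] := bregman_bounds Oz Ox.
move: h1 h2; rewrite /bregman /T0 (sqnormBC z x) -(opprB x z) dotvNr.
move: (grad z) (grad x) => gz gx h1 h2.
have -> : x - gx - (z - gz) = (x - z) - (gx - gz).
  by rewrite !opprB [gz - z]addrC addrACA [- gx + gz]addrC.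
rewrite (dotvBl (x - z)) (dotvBl gx) -/(sqnorm (x - z)).
by have := sqnorm_ge0 (x - z); nra.
Qed.

(** Three-point identity for the Bregman divergence; the divergence of [x'] from [z] is dropped
    because it is nonnegative. *)
Lemma T0_lip_aux x z x' : Om x -> Om z -> Om x' ->
  dotv (T0 Om f z - T0 Om f x) (x' - x) <=
  (2 * kappa)^-1 * (sqnorm (x - z) + sqnorm (x' - x)).
Proof.
move=> Ox Oz Ox'; have [k0 k1] := andP kappa01.
have /andP[_ h1] := bregman_bounds Ox Oz; have /andP[_ h2] := bregman_bounds Ox' Ox.
have /andP[h3 _] := bregman_bounds Ox' Oz.
have h0 : 0 <= kappa / 2 * sqnorm (x' - z) by rewrite mulr_ge0 ?sqnorm_ge0// divr_ge0// ltW.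
suff : bregman f Om x' z = bregman f Om x z + bregman f Om x' x -
    dotv (T0 Om f z - T0 Om f x) (x' - x) by lra.
rewrite /bregman /T0; move: (grad z) (grad x) => gz gx.
have e1 : sqnorm (x' - z) = sqnorm (x' - x) + 2 * dotv (x' - x) (x - z) + sqnorm (x - z).
  by rewrite -sqnormD subrKA.
have e2 : dotv gz (x' - z) = dotv gz (x' - x) + dotv gz (x - z).
  by rewrite -dotvDr subrKA.
have e3 : dotv (z - gz - (x - gx)) (x' - x) =
    - dotv (x' - x) (x - z) - dotv gz (x' - x) + dotv gx (x' - x).
  rewrite (dotvC (x' - x) (x - z)) -dotvNl -dotvBl -dotvDl; congr dotv.
  by apply/rowP => i; rewrite !mxE; ring.
by rewrite e1 e2 e3; lra.
Qed.

(* (A1) does not make the Hessian symmetric, so the two-sided bound on it gives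
   no operator norm bound.  Instead T0_lip_aux is applied at x and at z, with x'
   and z' moved inside the ball of center p. *)
Lemma T0_lipschitz (p : E) (rho : R) : 0 < rho -> eball p rho `<=` Om -> compact Om ->
  exists2 L : R, 0 < L & forall x z, Om x -> Om z ->
    enorm (T0 Om f x - T0 Om f z) <= L * enorm (x - z).
Proof.
move=> rho0 pOm cOm; have [k0 k1] := andP kappa01.
have [D Drho hD] : exists2 D : R, rho <= D & forall x, Om x -> enorm (x - p) <= D.
  have [M [_ /(_ (M + 1))]] := compact_bounded cOm; rewrite ltrDl ltr01 => /(_ isT) hM.
  exists (rho + (d%:R * (M + 1) + enorm p)) => [|x Ox].
    rewrite lerDl addr_ge0 ?enorm_ge0// mulr_ge0//.
    have Op : Om p by apply: pOm; rewrite /eball/= subrr enorm0.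
    exact: le_trans (hM _ Op).
  rewrite (le_trans (enormD _ _))// enormN.
  have : enorm x <= d%:R * (M + 1).
    by rewrite (le_trans (enorm_mx_norm _))// ler_wpM2l// hM.
  by lra.
have D0 : 0 < D by apply: lt_le_trans rho0 _.
exists (4 * D / (kappa * rho)) => [|x z Ox Oz].
  by rewrite divr_gt0// mulr_gt0.
have [->|xz] := eqVneq x z.
  by rewrite !subrr enorm0 mulr0.
pose r := enorm (x - z); have r0 : 0 < r by rewrite enorm_gt0 subr_eq0.
pose w := T0 Om f z - T0 Om f x.
rewrite enormBC -/w -/r.
have [w0|w0] := eqVneq w 0.
  rewrite w0 enorm0 mulr_ge0 ?enorm_ge0// divr_ge0// mulr_ge0// ltW//.
have ew0 : 0 < enorm w by rewrite enorm_gt0.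
(* Targets in the ball are at distance at most [D + rho <= 2 * D], so with this fraction both moves
   have length at most [r]. *)
pose t := r / (2 * D).
have t0 : 0 < t by rewrite divr_gt0// mulr_gt0.
have t1 : t <= 1.
  rewrite ler_pdivrMr ?mulr_gt0// mul1r.
  by have := enormB_trans p x z; rewrite (enormBC p); have := hD _ Ox; have := hD _ Oz; rewrite -/r; lra.
have tr : t * (D + rho) <= r.
  rewrite /t mulrAC ler_pdivrMr ?mulr_gt0// ler_wpM2l ?(ltW r0)//; lra.
(* [y'] is [y] moved by the fraction [t] towards the point at distance [rho / 2] from [p] in the
   direction [s * w]; the sign [s] is [1] for [x] and [-1] for [z]. *)
have key (y : E) (s : R) : s ^+ 2 = 1 -> Om y ->
    exists y', [/\ Om y', sqnorm (y' - y) <= r ^+ 2 &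
      dotv w (y' - y) = t * (dotv w (p - y) + s * (rho / 2) * enorm w)].
  move=> s1 Oy; pose y' := y + t *: ((p + (s * (rho / 2 / enorm w)) *: w) - y).
  have sn : `|s| = 1 by apply/eqP; rewrite -sqrp_eq1// real_normK ?num_real// s1.
  have en : enorm ((s * (rho / 2 / enorm w)) *: w) = rho / 2.
    rewrite enormZ normrM sn mul1r ger0_norm; last by rewrite !divr_ge0 ?ltW.
    by rewrite divfK// gt_eqF.
  have Oq : Om (p + (s * (rho / 2 / enorm w)) *: w).
    by apply: pOm; rewrite /eball/= addrAC subrr add0r en; lra.
  have yy' : y' - y = t *: ((p + (s * (rho / 2 / enorm w)) *: w) - y).
    by rewrite /y' addrAC subrr add0r.
  exists y'; split; first by apply: convex_seg => //; rewrite ltW.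
    rewrite yy' -enorm_sqr ler_sqr ?nnegrE ?enorm_ge0 ?(ltW r0)// enormZ (ger0_norm (ltW t0)).
    apply: le_trans tr; rewrite ler_wpM2l ?(ltW t0)// (addrAC p) (le_trans (enormD _ _))// en.
    by rewrite lerD// ?(enormBC p) ?hD//; lra.
  rewrite yy' dotvZr (addrAC p) (dotvDr w (p - y)) dotvZr -/(sqnorm w) -enorm_sqr; congr (_ * (_ + _)).
  by field; rewrite gt_eqF.
have [|x' [Ox' nx' dx']] := key x 1 _ Ox; first by rewrite expr1n.
have [|z' [Oz' nz' dz']] := key z (-1) _ Oz; first by rewrite sqrrN expr1n.
have up (q : R) : q <= r ^+ 2 -> (2 * kappa)^-1 * (r ^+ 2 + q) <= kappa^-1 * r ^+ 2.
  move=> qr; rewrite (_ : kappa^-1 = (2 * kappa)^-1 * 2); last by field; rewrite gt_eqF.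
  rewrite -mulrA ler_wpM2l ?invr_ge0 ?mulr_ge0 ?(ltW k0)//; lra.
have h2 : dotv w (x' - x) <= kappa^-1 * r ^+ 2.
  by apply: le_trans (up _ nx'); rewrite /r enorm_sqr; exact: T0_lip_aux.
have h3 : - dotv w (z' - z) <= kappa^-1 * r ^+ 2.
  apply: le_trans (up _ nz'); rewrite /r enormBC enorm_sqr -dotvNl opprB.
  exact: T0_lip_aux.
have h1 : 0 <= dotv w (z - x) by exact: T0_mono.
have e1 : dotv w (z - x) = dotv w (p - x) - dotv w (p - z).
  by rewrite -dotvBr; congr dotv; apply/rowP => i; rewrite !mxE; ring.
rewrite dx' in h2; rewrite dz' in h3; rewrite e1 in h1.
(* The sum of [h2] and [h3] contains [t * dotv w (z - x)], nonnegative by monotonicity, and what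
   remains on the left is [t * rho * enorm w]. *)
have : t * rho * enorm w <= 2 * kappa^-1 * r ^+ 2 by nra.
rewrite /t => h.
rewrite -(ler_pM2l (_ : 0 < r * rho / (2 * D))) ?divr_gt0 ?mulr_gt0//.
rewrite (_ : r * rho / (2 * D) * (4 * D / (kappa * rho) * r) = 2 * kappa^-1 * r ^+ 2); last by field; rewrite !gt_eqF.
by apply: le_trans h; rewrite (mulrAC r).
Qed.

End convex_analysis.

(** * Lebesgue measure on R^d *)

Section lebesgue_facts.
Context (R : realType).

(** Fubini along the recursive construction of the measure. If [i] is not the first axis, sections
    at a fixed first coordinate inherit the hypothesis; if it is, integrating in the other order
    leaves sections with at most one point. *)
Lemma lebesgue_rV_section_null n (i : 'I_n) (A : set 'rV[R]_n) :
  measurable A ->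
  (forall x y, A x -> A y -> (forall j, j != i -> x ord0 j = y ord0 j) -> x = y) ->
  lebesgue_rV R n A = 0%E.
Proof.
elim: n i A => [[]//|n IH] i A mA Ainj.
pose X : set (measurableTypeR R * 'rV[R]_n) := (@rV_cons R n) @^-1` A.
have mX : measurable X.
  by have := measurable_rV_cons measurableT mA; rewrite setTI.
rewrite [LHS](_ : _ = (@lebesgue_measure R \x lebesgue_rV R n)%E X)//.
have cons0 (a : R) v : rV_cons (a, v) ord0 ord0 = a by rewrite mxE unlift_none.
have consS (a : R) v k : rV_cons (a, v) ord0 (lift ord0 k) = v ord0 k.
  by rewrite mxE liftK.
case: (unliftP ord0 i) => [j|] ij.
- rewrite [LHS](_ : _ = \int[@lebesgue_measure R]_x (lebesgue_rV R n (xsection X x)))%E//.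
  apply: integral0_eq => x _; apply: (IH j); first exact: measurable_xsection.
  move=> u v; rewrite /xsection/= !inE /X/= => Au Av uv.
  suff /rowP uv' : rV_cons (x, u) = rV_cons (x, v).
    by apply/rowP => k; rewrite -(consS _ x u) -(consS _ x v) uv'.
  apply: Ainj => // l; case: (unliftP ord0 l) => [m|] -> li; last by rewrite !cons0.
  by rewrite !(consS n); apply: uv; apply: contraNneq li => mj; rewrite ij -mj.
- rewrite (product_measure_unique (m' := (@lebesgue_measure R \x^ lebesgue_rV R n)%E))//; last first.
    by move=> B C mB mC; exact: product_measure2E.
  rewrite [LHS](_ : _ = \int[lebesgue_rV R n]_y (@lebesgue_measure R (ysection X y)))%E//.
  apply: integral0_eq => y _.
  have [[x Xx]|/set0P/negP/negPn/eqP ->] := pselect (exists x, ysection X y x); last by rewrite measure0.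
  rewrite (_ : ysection X y = [set x]) ?lebesgue_measure_set1//.
  apply/seteqP; split => [z|z -> //]; move: Xx; rewrite /ysection/= !inE /X/= => Ax Az.
  rewrite -(cons0 _ z y) -(cons0 _ x y) (Ainj _ _ Az Ax)// => l.
  by case: (unliftP ord0 l) => [m|] ->; rewrite ?ij ?eqxx// !consS.
Qed.

Context (d : nat).
Local Notation E := 'rV[R]_d.
Local Notation leb := (lebesgue_rV R d).

Lemma continuous_dotvl (w : E) : continuous (fun x : E => dotv x w).
Proof. by move=> x; exact: (@cvg_dotv R d E (nbhs x) _ id (fun=> w) x w cvg_id (cvg_cst w)). Qed.

Lemma hyperplane_null (w : E) (c : R) : w != 0 -> leb [set x | dotv x w = c] = 0%E.
Proof.
move=> /eqP w0; have [i wi] : exists i, w ord0 i != 0.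
  apply: contrapT => h; apply: w0; apply/rowP => i; rewrite mxE.
  by apply/eqP; apply: contrapT => /negP wi; apply: h; exists i.
apply: (lebesgue_rV_section_null (i := i)).
  rewrite (_ : [set _ | _] = (fun x : E => dotv x w) @^-1` [set c])//.
  rewrite -[X in measurable X]setTI.
  have: measurable_fun [set: E] (fun x : E => dotv x w); last by apply.
  apply: measurable_sum => k; apply: measurable_funM => //; exact: measurable_mx_coord.
move=> x y /= <- + xy; rewrite /dotv (bigD1 i)//= [RHS](bigD1 i)//=.
rewrite [X in _ = _ + X](eq_bigr (fun k => y ord0 k * w ord0 k)); last first.
  by move=> k ki; rewrite xy.
move=> /addIr /(mulIf wi) xyi; apply/rowP => k.
by have [->|/xy] := eqVneq k i.
Qed.

(** The missing weight sits at [p]. Splitting off index [i] divides the other weights by [1 - t i],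
    which is why [t i >= 1] is treated apart. *)
Lemma convex_comb (Om : set E) (p : E) (n : nat) (v : 'I_n -> E) (t : 'I_n -> R) :
  convex_set Om -> Om p -> (forall i, Om (p + v i)) -> (forall i, 0 <= t i) ->
  \sum_i t i <= 1 -> Om (p + \sum_i t i *: v i).
Proof.
move=> cOm Op Opv; elim: (index_enum _) t => [|i s IH] t t0.
  by rewrite !big_nil addr0.
rewrite !big_cons => t1.
have s0 : 0 <= \sum_(j <- s) t j by apply: sumr_ge0.
have [ti|ti] := leP 1 (t i).
  have ti1 : t i = 1 by apply/eqP; rewrite eq_le ti andbT; lra.
  have st0 : \sum_(j <- s) t j = 0 by lra.
  rewrite ti1 scale1r big1_seq ?addr0// => j /= js.
  move/eqP: st0; rewrite psumr_eq0// => /allP/(_ j js)/= /eqP ->.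
  by rewrite scale0r.
have q0 : 0 < 1 - t i by rewrite subr_gt0.
have Oq : Om (p + \sum_(j <- s) (t j / (1 - t i)) *: v j).
  apply: IH => [j|]; first by rewrite divr_ge0// ltW.
  by rewrite -mulr_suml ler_pdivrMr// mul1r; lra.
have := convex_seg cOm Oq (Opv i) (t := t i).
rewrite t0 (ltW ti) => /(_ isT); congr Om.
have -> : \sum_(j <- s) t j *: v j = (1 - t i) *: \sum_(j <- s) (t j / (1 - t i)) *: v j.
  rewrite scaler_sumr; apply: eq_bigr => j _.
  by rewrite scalerA mulrC divfK// gt_eqF.
by apply/rowP => k; rewrite !mxE; ring.
Qed.

(** A convex set whose affine hull is proper lies in a hyperplane and is null. Otherwise it contains
    a nondegenerate simplex, and a ball around the barycentre of that simplex. *)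
Lemma convex_interior (Om : set E) : convex_set Om -> leb Om != 0%E -> measurable Om ->
  exists (p : E) (rho : R), 0 < rho /\ eball p rho `<=` Om.
Proof.
move=> cOm Om0 mOm.
have [p Op] : exists p, Om p.
  apply: contrapT => h; move/eqP: Om0; apply.
  by rewrite (_ : Om = set0) ?measure0//; apply/seteqP; split => // x Ox; apply: h; exists x.
(* [k] independent directions along which [p] can be moved inside [Om]; the largest such [k] is the
   dimension of the affine hull. *)
pose Q k := `[< exists V : 'M[R]_(k, d), (forall i, Om (p + row i V)) /\ \rank V = k >].
have Q0 : exists k, Q k.
  exists 0%N; apply/asboolP; exists 0; split; [by case|by rewrite mxrank0].
have Qd k : Q k -> (k <= d)%N.
  by move=> /asboolP[V [_ <-]]; exact: rank_leq_col.
case: (ex_maxnP Q0 Qd) => k /asboolP[V [VOm rV]] kmax.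
have [kd|kd] := ltnP k d.
  exfalso; move/eqP: Om0; apply.
  have [w w0 Vw] : exists2 w : E, w != 0 & w *m V^T = 0.
    have : kermx V^T != 0.
      by rewrite -mxrank_eq0 mxrank_ker mxrank_tr rV -lt0n subn_gt0.
    case/rowV0Pn => w /sub_kermxP ww w0; by exists w.
  have Vsub x : Om x -> (x - p <= V)%MS.
    move=> Ox; apply: contrapT => /negP xV.
    suff : Q k.+1 by move=> /kmax; rewrite ltnn.
    apply/asboolP; rewrite -addn1; exists (col_mx V (x - p)); split.
      move=> i; rewrite (_ : row i _ = if fintype.split i is inl j then row j V else x - p).
        by case: splitP => j _; [exact: VOm|rewrite subrKC].
      apply/rowP => j; rewrite !mxE; case: splitP => l _; first by rewrite mxE.
      by rewrite ord1.
    apply/eqP; rewrite eqn_leq rank_leq_row /= -addsmxE [X in (X <= _)%N]addn1.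
    rewrite -{1}rV; apply: rank_ltmx; rewrite /ltmx addsmxSl/=.
    by rewrite addsmx_sub submx_refl/=.
  apply/eqP; rewrite eq_le measure_ge0 andbT.
  rewrite -(hyperplane_null (dotv p w) w0); apply: le_measure; rewrite ?inE//.
    rewrite (_ : [set _ | _] = (fun x : E => dotv x w) @^-1` [set dotv p w])//.
    rewrite -[X in measurable X]setTI.
    have: measurable_fun [set: E] (fun x : E => dotv x w); last by apply.
    apply: measurable_sum => l; apply: measurable_funM => //; exact: measurable_mx_coord.
  move=> x Ox /=; apply/eqP; rewrite -subr_eq0 -dotvBl; apply/eqP.
  have /submxP[D ->] := Vsub x Ox.
  have : (D *m V) *m w^T = 0.
    by rewrite -mulmxA -[V *m _]trmxK trmx_mul trmxK Vw trmx0 mulmx0.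
  move/matrixP/(_ ord0 ord0); rewrite mxE [RHS]mxE => <-.
  by apply: eq_bigr => l _; rewrite [w^T _ _]mxE.
have {kd}kd : k = d by apply/eqP; rewrite eqn_leq kd Qd//; apply/asboolP; exists V.
move: V VOm rV {kmax}; rewrite kd => V VOm rV.
have Vu : V \in unitmx by rewrite -row_full_unit /row_full rV.
(* In the basis of the rows of [V], each coordinate of a vector [v] is at most [K * enorm v]. *)
pose K := 1 + \sum_i \sum_j `|invmx V i j|.
have K0 : 0 < K by rewrite ltr_pwDl// sumr_ge0// => i _; rewrite sumr_ge0.
(* [c] is the barycentre of the simplex with vertices [p] and [p + row i V]. Within the radius
   chosen below each of the [d] weights [a] changes by at most [a / d.+1%:R], so the weights stay
   nonnegative with sum at most [1]. *)
pose a : R := d.+1%:R^-1.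
have a0 : 0 < a by rewrite invr_gt0.
pose c := p + \sum_i a *: row i V.
exists c; exists (a / (d.+1%:R * K)); split; first by rewrite divr_gt0// mulr_gt0.
move=> q /= qc; pose l := (q - c) *m invmx V.
have lb i : `|l ord0 i| <= a / d.+1%:R.
  rewrite mxE (le_trans (ler_norm_sum _ _ _))//.
  rewrite (le_trans (ler_sum _ (G := fun j => enorm (q - c) * `|invmx V j i|) _))//.
    by move=> j _; rewrite normrM ler_wpM2r// enorm_coord.
  rewrite -mulr_sumr.
  have : \sum_j `|invmx V j i| <= K.
    rewrite /K (le_trans (ler_sum _ (G := fun j => \sum_m `|invmx V j m|) _))//.
      by move=> j _; rewrite (bigD1 i)//= lerDl sumr_ge0.
    by rewrite lerDr.
  move=> SK; rewrite (le_trans (ler_wpM2l (enorm_ge0 _) SK))//.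
  by rewrite -ler_pdivlMr// -mulrA -invfM ltW.
have -> : q = p + \sum_i (a + l ord0 i) *: row i V.
  have : q = c + l *m V by rewrite mulmxKV// subrKC.
  rewrite mulmx_sum_row => {1}->; rewrite /c -addrA -big_split/=.
  by congr (_ + _); apply: eq_bigr => i _; rewrite scalerDl.
have ad : a / d.+1%:R <= a by rewrite ler_pdivrMr// ler_peMr ?(ltW a0)// ler1n.
apply: convex_comb => // [i|].
  have := lb i; rewrite ler_norml => /andP[h _].
  rewrite -[a]opprK addrC subr_ge0; apply: le_trans h; by rewrite lerN2.
rewrite (le_trans (ler_sum _ (G := fun=> a + a / d.+1%:R) _))//.
  by move=> i _; rewrite lerD2l; have := lb i; rewrite ler_norml => /andP[].
rewrite sumr_const card_ord -[leLHS]mulr_natl mulrDr (mulrCA d%:R).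
have d1 : d%:R * a <= 1 - a.
  by rewrite lerBrDr -[X in _ + X <= _]mul1r -mulrDl natr1 /a divff.
have d2 : a * (d%:R / d.+1%:R) <= a.
  by rewrite ler_piMr ?(ltW a0)// ler_pdivrMr// mul1r ler_nat.
by rewrite (le_trans (lerD d1 d2))// subrK.
Qed.

Lemma open_eball (x : E) (r : R) : open (eball x r).
Proof.
rewrite (_ : eball x r = (fun y : E => enorm (y - x)) @^-1` [set s | s < r])//.
apply: open_comp; last exact: open_lt.
move=> y _; exact: (@cvg_enorm R d E (nbhs y) _ (fun y => y - x) (y - x) (cvgB cvg_id (cvg_cst x))).
Qed.

Lemma measurable_eball (x : E) (r : R) : measurable (eball x r).
Proof. by apply: measurable_mx_open; exact: open_eball. Qed.

Lemma measurable_box (a b : E) :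
  measurable [set v : E | forall i, a ord0 i <= v ord0 i <= b ord0 i].
Proof.
rewrite (_ : [set _ | _] = \bigcap_(i in [set: 'I_d])
    ((fun v : E => v ord0 i) @^-1` `[a ord0 i, b ord0 i])).
  apply: fin_bigcap_measurable => [|i _]; first exact: finite_finset.
  rewrite -[X in measurable X]setTI.
  by have := @measurable_mx_coord R 1 d ord0 i; apply.
by apply/seteqP; split => [v h i _ /=|v h i]; [rewrite in_itv/=|
  have := h i I; rewrite /= in_itv].
Qed.

(** The inscribed cube has half-side [r / (2 * d%:R)], because [enorm] is bounded by [d] times the
    largest coordinate. *)
Lemma eball_volume_ge (x : E) (r : R) : (0 < d)%N -> 0 < r ->
  (((r / d%:R) ^+ d)%:E <= leb (eball x r))%E.
Proof.
move=> d0 r0; have dR0 : 0 < d%:R :> R by rewrite ltr0n.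
have rd : 0 < r / (2 * d%:R) by rewrite divr_gt0// mulr_gt0.
pose h : E := const_mx (r / (2 * d%:R)).
have := @lebesgue_rV_box R d (x - h) (x + h); rewrite /h.
rewrite (eq_bigr (fun=> r / d%:R)); last by move=> i _; rewrite !mxE; field; rewrite gt_eqF.
rewrite prodr_const card_ord => H.
rewrite -H => [|i]; last by rewrite !mxE; lra.
apply: le_measure; rewrite ?inE; [exact: measurable_box|exact: measurable_eball|].
move=> y /= yb; rewrite /eball/=.
rewrite (le_lt_trans (enorm_coord_le (b := r / (2 * d%:R)) _ _)) ?ltW//.
  by move=> i; have := yb i; rewrite !mxE ler_norml => /andP[]; lra.
rewrite [ltLHS](_ : _ = r / 2); last by field; rewrite gt_eqF.
by lra.
Qed.

Lemma eball_volume_le (x : E) (r : R) : 0 < r -> (leb (eball x r) <= ((2 * r) ^+ d)%:E)%E.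
Proof.
move=> r0; pose h : E := const_mx r.
have := @lebesgue_rV_box R d (x - h) (x + h); rewrite /h.
rewrite (eq_bigr (fun=> 2 * r)); last by move=> i _; rewrite !mxE; ring.
rewrite prodr_const card_ord => H.
rewrite -H => [|i]; last by rewrite !mxE; lra.
apply: le_measure; rewrite ?inE; [exact: measurable_eball|exact: measurable_box|].
move=> y /= yb i; have := enorm_coord (y - x) i; rewrite !mxE.
by move=> /le_lt_trans/(_ yb); rewrite ltr_norml => /andP[]; lra.
Qed.

End lebesgue_facts.

(** * The minimizing map Z *)

Section borel_euclid.
Context (R : realType) (d : nat).
Local Notation E := 'rV[R]_d.

Lemma closed_mx_measurable (A : set E) : closed A -> measurable A.
Proof.
by move=> /closed_openC/measurable_mx_open/measurableC; rewrite setCK.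
Qed.

Lemma compact_mx_measurable (A : set E) : compact A -> measurable A.
Proof.
by move=> cA; apply: closed_mx_measurable; apply: compact_closed => //; exact: norm_hausdorff.
Qed.

Lemma within_continuous_measurable (A : set E) (f : E -> R) :
  measurable A -> {within A, continuous f} -> measurable_fun A f.
Proof.
move=> mA /continuousP cf; apply: (measurability _ (RGenOpens.measurableE R)).
move=> _ [_ [a [b ->] <-]].
have oab : open [set` `]a, b[%R] by exact: interval_open.
have /open_subspaceP[V oV VA] := cf _ oab.
rewrite setIC (_ : _ `&` A = V `&` A)//; apply: measurableI => //.
exact: measurable_mx_open.
Qed.

Lemma near_enorm (x : E) (e : R) : 0 < e -> \forall y \near nbhs x, enorm (x - y) <= e.
Proof.
move=> e0; apply/nbhs_ballP; exists (e / (1 + d%:R)) => /=.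
  by rewrite divr_gt0// ltr_wpDr.
move=> y; rewrite -ball_normE /ball_/= ltr_pdivlMr ?ltr_wpDr// => xy.
rewrite (le_trans (enorm_mx_norm _))// mulrC (le_trans _ (ltW xy))//.
by rewrite ler_wpM2l// lerDr.
Qed.

Lemma lip_continuous n (g : E -> 'rV[R]_n) (L : R) : 0 <= L ->
  (forall x y, enorm (g x - g y) <= L * enorm (x - y)) -> continuous g.
Proof.
move=> L0 gL x; apply: (@enorm_cvg0 R n E (nbhs x) _ g (g x)).
apply/cvgrPdist_le => e e0.
have del0 : 0 < e / (1 + L) by rewrite divr_gt0// ltr_wpDr.
near=> y; rewrite sub0r normrN ger0_norm ?enorm_ge0// (le_trans (gL _ _))// enormBC.
have : enorm (x - y) <= e / (1 + L) by near: y; exact: near_enorm.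
rewrite ler_pdivlMr ?ltr_wpDr// mulrDr mulr1.
by have := enorm_ge0 (x - y); lra.
Unshelve. all: by end_near. Qed.

Lemma lip_within_continuous (A : set E) (g : E -> R) (L : R) : 0 <= L ->
  (forall x y, A x -> A y -> `|g x - g y| <= L * enorm (x - y)) ->
  {within A, continuous g}.
Proof.
move=> L0 gL; apply/subspace_continuousP => x Ax; apply/cvgrPdist_le => e e0.
have del0 : 0 < e / (1 + L) by rewrite divr_gt0// ltr_wpDr.
rewrite near_withinE; near=> y => Ay; rewrite (le_trans (gL _ _ _ _))//.
have : enorm (x - y) <= e / (1 + L) by near: y; exact: near_enorm.
rewrite ler_pdivlMr ?ltr_wpDr// mulrDr mulr1.
by have := enorm_ge0 (x - y); lra.
Unshelve. all: by end_near. Qed.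

End borel_euclid.

Section potential.
Context (R : realType) (d : nat).
Local Notation E := 'rV[R]_d.
Variables (Om : set E) (f : E -> R) (kappa : R).
Hypothesis Om_compact : compact Om.
Hypothesis Om_convex : convex_set Om.
Hypothesis Om_neq0 : Om !=set0.
Hypothesis kappa01 : 0 < kappa < 1.
Hypothesis f_hess : forall x, Om x -> (exists g, is_gradient Om f x g) /\
    exists H, [/\ is_hessian Om f x H,
      loewner_le ((1 - kappa^-1)%:M) H & loewner_le H ((1 - kappa)%:M)].
Hypothesis f_cont : {within Om, continuous f}.

Local Notation psi y := (fine (c_transform Om f y)).

(** The map Z of the overview, taken on the whole space, where it is Lipschitz, and not only on
    [Om]. *)
Definition argmin_cost (y : E) : E :=
  get (fun z => Om z /\ forall x, Om x -> cost z y - f z <= cost x y - f x).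

Local Notation Z := argmin_cost.

Lemma argmin_costP y : Om (Z y) /\ forall x, Om x -> cost (Z y) y - f (Z y) <= cost x y - f x.
Proof.
apply: (@getPex E (fun z => Om z /\ forall x, Om x -> cost z y - f z <= cost x y - f x)).
have [|c] := @EVT_min_rV R d (fun x => cost x y - f x) Om Om_neq0 Om_compact.
  move=> x; apply: cvgB; last exact: f_cont.
  apply: (@continuous_subspaceT _ _ Om (fun x => cost x y)) => {}x.
  have cB : (x0 - y) @[x0 --> x] --> (x - y : E).
    exact: (cvgB cvg_id (cvg_cst y)).
  have h := @cvg_dotv R d E (nbhs x) (nbhs_filter x) _ _ _ _ cB cB.
  exact: (cvgM h (cvg_cst (2^-1 : R))).
rewrite inE => Oc h; exists c; split => // x Ox; apply: h; exact: mem_set.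
Qed.

Lemma c_transform_argmin y : psi y = cost (Z y) y - f (Z y).
Proof.
have [OZ Zmin] := argmin_costP y.
suff -> : c_transform Om f y = (cost (Z y) y - f (Z y))%:E by [].
apply/eqP; rewrite eq_le; apply/andP; split.
  by apply: ereal_inf_lbound; exists (Z y) => //; congr (_ - _)%:E; rewrite /cost sqnormBC.
apply/ereal_infP => _ [x Ox <-]; rewrite lee_fin.
by apply: le_trans (Zmin _ Ox) _; rewrite /cost sqnormBC.
Qed.

(** Expansion of the slack around the minimizer: the first term is controlled by uniform convexity,
    the second has a sign by first-order optimality and vanishes when [T0 (Z y) = y]. *)
Lemma slackE x y : cost x y - f x - psi y =
  bregman f Om x (Z y) + dotv (T0 Om f (Z y) - y) (x - Z y).
Proof.
rewrite c_transform_argmin /bregman /T0; move: (gradient _ _ _) => g; move: (Z y) => z.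
rewrite /cost (_ : x - y = (x - z) + (z - y)); last by rewrite subrKA.
rewrite sqnormD (_ : z - g - y = (z - y) - g); last by rewrite addrAC.
by rewrite (dotvBl (z - y)) (dotvC (x - z)); lra.
Qed.

(** Variational inequality at a minimizer over a convex set, which may lie on the boundary. A
    negative pairing would let a short move towards [x] decrease the cost. *)
Lemma argmin_foc x y : Om x -> 0 <= dotv (T0 Om f (Z y) - y) (x - Z y).
Proof.
move=> Ox; have [OZ Zmin] := argmin_costP y.
set q := dotv _ _; rewrite leNgt; apply/negP => q0.
have [k0 k1] := andP kappa01.
pose B := 1 + (2 * kappa)^-1 * sqnorm (x - Z y).
have B0 : 0 < B by rewrite ltr_pwDl// mulr_ge0 ?sqnorm_ge0// invr_ge0 mulr_ge0// ltW.
have B1 : (2 * kappa)^-1 * sqnorm (x - Z y) < B by rewrite ltrDr.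
(* With this step the second-order remainder [t * (B - 1)] is strictly below [- q]. *)
pose t := Num.min 1 (- q / B).
have t0 : 0 < t by rewrite lt_min ltr01 divr_gt0// oppr_gt0.
have t1 : t <= 1 by rewrite ge_min lexx.
have tq : t * B <= - q by rewrite -ler_pdivlMr// ge_min lexx orbT.
have Ot : Om (Z y + t *: (x - Z y)) by apply: convex_seg => //; rewrite ltW.
have /andP[_ h1] := bregman_bounds Om_convex kappa01 f_hess Ot OZ.
have := slackE (Z y + t *: (x - Z y)) y.
have h2 := Zmin _ Ot.
rewrite c_transform_argmin (addrC (Z y)) addrK dotvZr -/q => h3.
rewrite (addrC (Z y)) addrK sqnormZ in h1; rewrite (addrC (Z y)) in h2.
have : 0 <= t * (t * ((2 * kappa)^-1 * sqnorm (x - Z y)) + q) by nra.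
rewrite pmulr_rge0// => h4; nra.
Qed.

Lemma slack_lower x y : Om x -> kappa / 2 * sqnorm (x - Z y) <= cost x y - f x - psi y.
Proof.
move=> Ox; have [OZ _] := argmin_costP y.
have /andP[h _] := bregman_bounds Om_convex kappa01 f_hess Ox OZ.
by rewrite slackE; have := argmin_foc y Ox; lra.
Qed.

Lemma slack_upper x y : Om x -> T0 Om f (Z y) = y ->
  cost x y - f x - psi y <= (2 * kappa)^-1 * sqnorm (x - Z y).
Proof.
move=> Ox Ty; have [OZ _] := argmin_costP y.
have /andP[_ h] := bregman_bounds Om_convex kappa01 f_hess Ox OZ.
by rewrite slackE Ty subrr dotv0l addr0.
Qed.

(** Adding [slack_lower] for [Z y'] at [y] and for [Z y] at [y'] cancels the potential and leaves
    [kappa * sqnorm (Z y - Z y') <= dotv (Z y - Z y') (y - y')]; Cauchy-Schwarz concludes. *)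
Lemma argmin_lip y y' : enorm (Z y - Z y') <= kappa^-1 * enorm (y - y').
Proof.
have [k0 k1] := andP kappa01.
have [OZ _] := argmin_costP y; have [OZ' _] := argmin_costP y'.
have h1 := slack_lower y OZ'; have h2 := slack_lower y' OZ.
have h3 : psi y = cost (Z y) y - f (Z y) by exact: c_transform_argmin.
have h4 : psi y' = cost (Z y') y' - f (Z y') by exact: c_transform_argmin.
have h5 : cost (Z y') y - cost (Z y) y + (cost (Z y) y' - cost (Z y') y') =
    dotv (Z y - Z y') (y - y').
  rewrite /cost !sqnormB; rewrite !dotvE; lra.
have h6 := dotv_le (Z y - Z y') (y - y').
rewrite sqnormBC in h1; rewrite -!enorm_sqr in h1 h2.
have := enorm_ge0 (Z y - Z y'); rewrite le_eqVlt => /orP[/eqP <-|e0].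
  by rewrite mulr_ge0 ?enorm_ge0// invr_ge0 ltW.
rewrite mulrC ler_pdivlMr// -(ler_pM2l e0); lra.
Qed.

End potential.

(** * First variation of the dual problem *)

Lemma perturb_arith (R : realType) (A A' B B' a a' t C Ea Eb : R) :
  A + t * a + - (2 * t ^+ 2) * Ea <= A' -> B + - t * a' + - (C * t ^+ 2) * Eb <= B' ->
  A' + B' <= A + B -> t * (a - a') <= t ^+ 2 * (2 * Ea + C * Eb).
Proof. by move=> *; lra. Qed.

Lemma bounded_near_le (R : realType) (T : Type) (A : set T) (g : T -> R) (M : R) :
  (forall x, A x -> `|g x| <= M) -> [bounded g x | x in A].
Proof.
move=> gM; exists M; split; first exact: num_real.
by move=> N MN x Ax; exact: le_trans (gM x Ax) (ltW MN).
Qed.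

Section bounded_integrals.
Context (R : realType) d (T : measurableType d).
Variables (m : {finite_measure set T -> \bar R}) (A : set T).
Hypothesis mA : measurable A.

(** A class closed under all operations needed below and integrable for every finite measure, so
    that integrability is reduced to closure lemmas. *)
Definition bounded_mfun (g : T -> R) :=
  measurable_fun A g /\ exists2 M : R, 0 <= M & forall x, A x -> `|g x| <= M.

Lemma bounded_mfun_integrable g : bounded_mfun g -> m.-integrable A (EFin \o g).
Proof.
move=> [mg [M M0 gM]]; apply: measurable_bounded_integrable => //.
  by rewrite ltey_eq fin_num_measure.
  exact: bounded_near_le gM.
Qed.

Lemma bounded_mfun_EFin g : bounded_mfun g ->
  (\int[m]_(x in A) (g x)%:E)%E = (\int[m]_(x in A) g x)%:E.
Proof.
by move=> bg; rewrite /Rintegral fineK//; exact/integrable_fin_num/bounded_mfun_integrable.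
Qed.

Lemma bounded_mfun_cst c : bounded_mfun (fun=> c).
Proof. by split; [exact: measurable_cst|exists `|c|]. Qed.

Lemma bounded_mfunD g h : bounded_mfun g -> bounded_mfun h -> bounded_mfun (fun x => g x + h x).
Proof.
move=> [mg [M M0 gM]] [mh [N N0 hN]]; split; first exact: measurable_funD.
exists (M + N) => [|x Ax]; first exact: addr_ge0.
by rewrite (le_trans (ler_normD _ _))// lerD// ?gM ?hN.
Qed.

Lemma bounded_mfunM g h : bounded_mfun g -> bounded_mfun h -> bounded_mfun (fun x => g x * h x).
Proof.
move=> [mg [M M0 gM]] [mh [N N0 hN]]; split; first exact: measurable_funM.
exists (M * N) => [|x Ax]; first exact: mulr_ge0.
by rewrite normrM ler_pM// ?gM ?hN.
Qed.

Lemma bounded_mfunN g : bounded_mfun g -> bounded_mfun (fun x => - g x).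
Proof.
move=> [mg [M M0 gM]]; split; first exact: measurableT_comp.
by exists M => // x Ax; rewrite normrN gM.
Qed.

Lemma bounded_mfun_expR g : bounded_mfun g -> bounded_mfun (fun x => expR (g x)).
Proof.
move=> [mg [M M0 gM]]; split; first exact: measurableT_comp.
exists (expR M) => [|x Ax]; first exact: expR_ge0.
rewrite ger0_norm ?expR_ge0// ler_expR.
by rewrite (le_trans (ler_norm _))// gM.
Qed.

Lemma Rintegral_le_lin3 (g g1 g2 g3 : T -> R) (s t : R) :
  bounded_mfun g -> bounded_mfun g1 -> bounded_mfun g2 -> bounded_mfun g3 ->
  (forall x, A x -> g1 x + s * g2 x + t * g3 x <= g x) ->
  \int[m]_(x in A) g1 x + s * (\int[m]_(x in A) g2 x) + t * (\int[m]_(x in A) g3 x)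
  <= \int[m]_(x in A) g x.
Proof.
move=> bg bg1 bg2 bg3 h.
have b2 := bounded_mfunM (bounded_mfun_cst s) bg2.
have b3 := bounded_mfunM (bounded_mfun_cst t) bg3.
rewrite -RintegralZl//; last exact: bounded_mfun_integrable.
rewrite -RintegralZl//; last exact: bounded_mfun_integrable.
rewrite -RintegralD//; try exact: bounded_mfun_integrable.
rewrite -RintegralD//; try exact: bounded_mfun_integrable.
  by apply: le_Rintegral => //; apply: bounded_mfun_integrable => //;
    do 2! apply: bounded_mfunD => //.
by apply: bounded_mfun_integrable; apply: bounded_mfunD.
Qed.

End bounded_integrals.

(** From [1 - s <= expR (- s)], since the product of [1 - s] and [1 + s + 2 * s ^+ 2] is at least
    [1] as long as [s <= 1/2]. *)
Lemma expR_le_quad (R : realType) (s : R) : `|s| <= 2^-1 -> expR s <= 1 + s + 2 * s ^+ 2.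
Proof.
rewrite ler_norml => /andP[s1 s2].
have h1 : 0 < 1 - s by lra.
have h2 : 1 - s <= expR (- s) by exact: expR_ge1Dx.
rewrite -[expR s]invrK -expRN (le_trans (_ : _ <= (1 - s)^-1))//.
  by rewrite lef_pV2 ?posrE ?expR_gt0.
rewrite -[leLHS]mul1r ler_pdivrMr//; nra.
Qed.

Lemma expR_perturb1 (R : realType) (p t k : R) : `|t| <= 2^-1 -> `|k| <= 1 ->
  1 - expR (- p) + t * (expR (- p) * k) + - (2 * t ^+ 2) * expR (- p) <=
  1 - expR (- (p + t * k)).
Proof.
move=> t2 k1; rewrite opprD expRD.
have tk : `|- (t * k)| <= 2^-1 by rewrite normrN normrM (le_trans _ t2)// ler_piMr.
have := expR_le_quad tk; rewrite sqrrN => e1.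
have k2 : (t * k) ^+ 2 <= t ^+ 2.
  by rewrite exprMn ler_piMr ?sqr_ge0// -real_normK ?num_real// exprn_ile1.
have e0 := expR_gt0 (- p).
have : expR (- p) * expR (- (t * k)) <= expR (- p) * (1 - t * k + 2 * t ^+ 2).
  by rewrite ler_pM2l//; lra.
by lra.
Qed.

(** The feasibility correction [t ^+ 2 * B] enters only at second order: the whole increment is at
    most [|t| * (1 + B)], whose square produces the term in [(1 + B) ^+ 2]. *)
Lemma expR_perturb2 (R : realType) (p t k B : R) :
  0 <= B -> `|t| * (1 + B) <= 2^-1 -> `|k| <= 1 ->
  1 - expR (- p) + - t * (expR (- p) * k) +
    - ((B + 2 * (1 + B) ^+ 2) * t ^+ 2) * expR (- p) <=
  1 - expR (- (p - (t * k + t ^+ 2 * B))).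
Proof.
move=> B0 tB k1; rewrite opprB addrC [t * k + _ - _]addrC expRD.
set s := t * k + t ^+ 2 * B.
have t1 : `|t| <= 1.
  by apply: (@le_trans _ _ 2^-1); [apply: le_trans tB; rewrite ler_peMr// lerDl|lra].
have ths : `|s| <= `|t| * (1 + B).
  rewrite (le_trans (ler_normD _ _))// mulrDr mulr1 lerD//.
    by rewrite normrM ler_piMr.
  by rewrite normrM (ger0_norm B0) ler_wpM2r// normrX expr2 ler_piMr.
have e1 := expR_le_quad (le_trans ths tB).
have s2 : s ^+ 2 <= t ^+ 2 * (1 + B) ^+ 2.
  rewrite -exprMn -[leLHS]real_normK ?num_real// -[leRHS]real_normK ?num_real//.
  by rewrite ler_sqr ?nnegrE// normrM (ger0_norm (_ : 0 <= 1 + B)) ?addr_ge0.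
have e0 := expR_gt0 (- p).
have : expR (- p) * expR s <= expR (- p) * (1 + t * k + t ^+ 2 * (B + 2 * (1 + B) ^+ 2)).
  by rewrite ler_pM2l//; apply: le_trans e1 _; rewrite {1}/s; lra.
by rewrite (addrC _ (1 - _ + _)); lra.
Qed.

Lemma within_compact_bounded (R : realType) (T : topologicalType) (A : set T) (f : T -> R) :
  compact A -> {within A, continuous f} ->
  exists2 M : R, 0 <= M & forall x, A x -> `|f x| <= M.
Proof.
move=> cA cf; have /compact_bounded[M [_ hM]] := continuous_compact cf cA.
exists (`|M| + 1); first by rewrite addr_ge0.
move=> x Ax; apply: (hM (`|M| + 1)); last by exists x.
by rewrite ltr_pwDr// ler_norm.
Qed.

Section first_variation.
Context (R : realType) (d : nat).
Local Notation E := 'rV[R]_d.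
Variables (Om : set E) (f : E -> R) (kappa : R).
Hypothesis Om_compact : compact Om.
Hypothesis Om_convex : convex_set Om.
Hypothesis Om_neq0 : Om !=set0.
Hypothesis kappa01 : 0 < kappa < 1.
Hypothesis f_hess : forall x, Om x -> (exists g, is_gradient Om f x g) /\
    exists H, [/\ is_hessian Om f x H,
      loewner_le ((1 - kappa^-1)%:M) H & loewner_le H ((1 - kappa)%:M)].
Variables mu nu : {finite_measure set E -> \bar R}.

Local Notation Z := (argmin_cost Om f).
Local Notation psi y := (fine (c_transform Om f y)).
Hypothesis opt : solves_dual Om mu nu f (fun y => psi y).

Let f_cont : {within Om, continuous f}.
Proof. by have [[[]]] := opt. Qed.

Let psi_cont : {within Om, continuous (fun y => psi y)}.
Proof. by have [[[]]] := opt. Qed.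

Let mOm : measurable Om := compact_mx_measurable Om_compact.

Let k0 : 0 < kappa. Proof. by case/andP: kappa01. Qed.

Lemma within_bounded_mfun (g : E -> R) : {within Om, continuous g} -> bounded_mfun Om g.
Proof.
by move=> cg; split; [exact: within_continuous_measurable|exact: within_compact_bounded].
Qed.

Section test_function.
Variables (h : E -> R) (L : R).
Hypotheses (L0 : 0 <= L) (hL : forall x y, `|h x - h y| <= L * enorm (x - y)).
Hypothesis h1 : forall x, `|h x| <= 1.

Let B := L ^+ 2 / (2 * kappa).

Let h_cont : {within Om, continuous h}.
Proof. by apply: (lip_within_continuous L0) => x y _ _; exact: hL. Qed.

Let hZ_cont : {within Om, continuous (h \o Z)}.
Proof.
apply: (@lip_within_continuous _ _ _ _ (L * kappa^-1)).
  by rewrite mulr_ge0// invr_ge0 ltW.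
move=> x y _ _; apply: (le_trans (hL _ _)); rewrite -mulrA ler_wpM2l//.
exact: argmin_lip.
Qed.

(* Moving the minimizer Z y changes the cost at second order only, which the
   term t^2 B absorbs. *)
Lemma perturbed_feasible (t : R) :
  dual_feasible Om (fun x => f x + t * h x) (fun y => psi y - (t * h (Z y) + t ^+ 2 * B)).
Proof.
have c1 : {within Om, continuous (fun x => f x + t * h x)}.
  move=> x; apply: cvgD; first exact: f_cont.
  by apply: cvgM; [exact: cvg_cst|exact: h_cont].
have c2 : {within Om, continuous (fun y => psi y - (t * h (Z y) + t ^+ 2 * B))}.
  move=> x; apply: cvgB; first exact: psi_cont.
  apply: cvgD; last exact: cvg_cst.
  by apply: cvgM; [exact: cvg_cst|exact: hZ_cont].
split => //.
  by split; [have [M _ hM] := within_compact_bounded Om_compact c1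
            |have [M _ hM] := within_compact_bounded Om_compact c2];
    exact: bounded_near_le hM.
move=> x y Ox Oy.
have s := slack_lower Om_compact Om_convex Om_neq0 kappa01 f_hess f_cont y Ox.
have hx : t * (h x - h (Z y)) <= `|t| * L * enorm (x - Z y).
  by rewrite (le_trans (ler_norm _))// normrM -mulrA ler_wpM2l.
suff : `|t| * L * enorm (x - Z y) <= kappa / 2 * sqnorm (x - Z y) + t ^+ 2 * B by lra.
rewrite /B -enorm_sqr -[t ^+ 2]real_normK ?num_real//.
move: (enorm _) (`|t|) => q r.
(* Young's inequality with this completed square; it dictates the value [L ^+ 2 / (2 * kappa)] of
   [B]. *)
rewrite -subr_ge0 (_ : _ - _ = (kappa * q - r * L) ^+ 2 / (2 * kappa)).
  by rewrite divr_ge0 ?sqr_ge0// mulr_ge0// ltW.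
by field; rewrite gt_eqF.
Qed.

(** Along the perturbation the dual value grows by at least [t * (a - a')] minus a multiple of
    [t ^+ 2]. Optimality for small [t] of both signs leaves only [a = a']. *)
Lemma first_variation_lip :
  \int[mu]_(x in Om) (expR (- f x) * h x) = \int[nu]_(y in Om) (expR (- psi y) * h (Z y)).
Proof.
have bf := within_bounded_mfun f_cont; have bp := within_bounded_mfun psi_cont.
have bh := within_bounded_mfun h_cont; have bhZ := within_bounded_mfun hZ_cont.
have bef := bounded_mfun_expR (bounded_mfunN bf).
have bep := bounded_mfun_expR (bounded_mfunN bp).
have B0 : 0 <= B by rewrite divr_ge0 ?sqr_ge0// mulr_ge0// ltW.
set a := LHS; set a' := RHS.
pose Ea := \int[mu]_(x in Om) expR (- f x); pose Eb := \int[nu]_(y in Om) expR (- psi y).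
pose C := B + 2 * (1 + B) ^+ 2.
have C0 : 0 <= C by rewrite addr_ge0// mulr_ge0// sqr_ge0.
have Ea0 : 0 <= Ea by apply: Rintegral_ge0 => x _; exact: expR_ge0.
have Eb0 : 0 <= Eb by apply: Rintegral_ge0 => x _; exact: expR_ge0.
have key (t : R) : `|t| * (1 + B) <= 2^-1 -> t * (a - a') <= t ^+ 2 * (2 * Ea + C * Eb).
  move=> tB; have [feas] := opt.
  move=> /(_ _ _ (perturbed_feasible t)); rewrite /dual_value.
  have bmf : bounded_mfun Om (fun x => 1 - expR (- (f x + t * h x))).
    apply: bounded_mfunD; first exact: bounded_mfun_cst.
    apply/bounded_mfunN/bounded_mfun_expR/bounded_mfunN/bounded_mfunD => //.
    by apply: bounded_mfunM => //; exact: bounded_mfun_cst.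
  have bmp : bounded_mfun Om (fun y => 1 - expR (- (psi y - (t * h (Z y) + t ^+ 2 * B)))).
    apply: bounded_mfunD; first exact: bounded_mfun_cst.
    apply/bounded_mfunN/bounded_mfun_expR/bounded_mfunN/bounded_mfunD => //.
    apply/bounded_mfunN/bounded_mfunD; last exact: bounded_mfun_cst.
    by apply: bounded_mfunM => //; exact: bounded_mfun_cst.
  have bm1 : bounded_mfun Om (fun x => 1 - expR (- f x)).
    by apply: bounded_mfunD; [exact: bounded_mfun_cst|exact: bounded_mfunN].
  have bm2 : bounded_mfun Om (fun x => 1 - expR (- psi x)).
    by apply: bounded_mfunD; [exact: bounded_mfun_cst|exact: bounded_mfunN].
  have t2 : `|t| <= 2^-1.
    by apply: le_trans tB; rewrite ler_peMr// lerDl.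
  have i1 := @Rintegral_le_lin3 _ _ _ mu Om mOm _ _ _ _ t (- (2 * t ^+ 2)) bmf bm1 (bounded_mfunM bef bh) bef.
  have i2 := @Rintegral_le_lin3 _ _ _ nu Om mOm _ _ _ _ (- t) (- (C * t ^+ 2)) bmp bm2 (bounded_mfunM bep bhZ) bep.
  rewrite !(bounded_mfun_EFin _ mOm)// -!EFinD lee_fin => i3.
  have {}i1 := i1 _; have {}i2 := i2 _.
  have {}i1 : (\int[mu]_(x in Om) (1 - expR (- f x)) + t * a + - (2 * t ^+ 2) * Ea <=
    \int[mu]_(x in Om) (1 - expR (- (f x + t * h x)))).
    by apply: i1 => x Ox; exact: expR_perturb1.
  have {}i2 : (\int[nu]_(x in Om) (1 - expR (- psi x)) + (- t) * a' + - (C * t ^+ 2) * Eb <=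
    \int[nu]_(y in Om) (1 - expR (- (psi y - (t * h (Z y) + t ^+ 2 * B))))).
    apply: i2 => x Ox; exact: (@expR_perturb2 _ _ t (h (Z x)) B B0 tB (h1 _)).
  exact: (perturb_arith i1 i2 i3).
have : forall e : R, 0 < e -> `|a - a'| <= e.
  move=> e e0; pose K := 2 * Ea + C * Eb.
  have K0 : 0 <= K by rewrite addr_ge0// mulr_ge0.
  pose t := Num.min (e / (1 + K)) (2^-1 / (1 + B)).
  have t0 : 0 < t by rewrite lt_min !divr_gt0// ?ltr_wpDr.
  have tB : t * (1 + B) <= 2^-1.
    by rewrite -ler_pdivlMr ?ltr_wpDr// ge_min lexx orbT.
  have tK : t * (1 + K) <= e.
    by rewrite -ler_pdivlMr ?ltr_wpDr// ge_min lexx.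
  have u1 : t * (a - a') <= t ^+ 2 * K by apply: key; rewrite gtr0_norm.
  have u2 : - t * (a - a') <= t ^+ 2 * K.
    by rewrite -(sqrrN t); apply: key; rewrite normrN gtr0_norm.
  move: u1 u2; rewrite expr2 -mulrA mulNr -mulrN !ler_pM2l// => u1 u2.
  have tK' : t * K <= e by apply: le_trans tK; rewrite ler_pM2l// lerDr.
  by rewrite ler_norml lerNl (le_trans u2 tK') (le_trans u1 tK').
move=> H; apply/eqP; rewrite -subr_eq0 -normr_le0; apply/ler_addgt0Pl => e e0.
by rewrite addr0 H.
Qed.

End test_function.
End first_variation.

(** * Balance of masses under Z *)

Section density_pushforward.
Context d1 (T : measurableType d1) d2 (T' : measurableType d2) (R : realType).
Variables (m : {measure set T -> \bar R}) (D : set T) (Z : T -> T') (g : T -> R).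

(** Packaging the set function as a measure makes uniqueness of measures applicable in
    [mass_balance]; there it is used with the identity on one side and with the minimizing map on
    the other. *)
Lemma density_pushforward_measure :
  measurable D -> measurable_fun setT Z -> measurable_fun D g ->
  (forall x, D x -> 0 <= g x) ->
  exists M : {measure set T' -> \bar R},
    forall A, M A = (\int[m]_(x in D `&` Z @^-1` A) (g x)%:E)%E.
Proof.
move=> mD mZ mg g0.
pose F (A : set T') := (\int[m]_(x in D `&` Z @^-1` A) (g x)%:E)%E.
have F0 : F set0 = 0%E by rewrite /F preimage_set0 setI0 integral_set0.
have Fge0 A : (0 <= F A)%E.
  by apply: integral_ge0 => x [Dx _]; rewrite lee_fin g0.
have mZA A : measurable A -> measurable (D `&` Z @^-1` A).
  by move=> mA; apply: measurableI => //; rewrite -[X in measurable X]setTI; exact: mZ.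
have Fadd : semi_sigma_additive F.
  move=> A mA tA mUA.
  rewrite [X in _ --> X](_ : _ = \sum_(n <oo) F (A n))%E; last first.
    rewrite /F preimage_bigcup setI_bigcupr ge0_integral_bigcup//.
    - by move=> k; exact: mZA.
    - apply/measurable_EFinP; apply: measurable_funS mg => //.
      by move=> x [k _ []].
    - by move=> x [k _ [Dx _]]; rewrite lee_fin g0.
    - apply/trivIsetP => i j _ _ ij; rewrite setIACA setIid -preimage_setI.
      by move/trivIsetP : tA => /(_ i j I I ij) ->; rewrite preimage_set0 setI0.
  by apply: is_cvg_nneseries => n _ _; exact: Fge0.
by exists (HB.pack_for {measure set T' -> \bar R} F (isMeasure.Build _ _ _ F F0 Fge0 Fadd)).
Qed.

(** Monotone convergence: the functions [h n] increase to the indicator of [V]. *)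
Lemma integral_indicator_approx (V : set T) (h : nat -> T -> R) :
  measurable D -> measurable_fun D g -> (forall x, D x -> 0 <= g x) ->
  measurable V ->
  (forall n, measurable_fun D (h n)) -> (forall n x, 0 <= h n x) ->
  (forall x n n', (n <= n')%N -> h n x <= h n' x) ->
  (forall n x, ~ V x -> h n x = 0) ->
  (forall x, V x -> exists N, forall n, (N <= n)%N -> h n x = 1) ->
  (\int[m]_(x in D) (g x * h n x)%:E @[n --> \oo] --> \int[m]_(x in D `&` V) (g x)%:E)%E.
Proof.
move=> mD mg g0 mV mh h0 hmono hV0 hV1.
have := @cvg_monotone_convergence _ T R m D mD (fun n x => (g x * h n x)%:E).
move=> /(_ _ _ _)-/(_ _ _ _).
have gh_lim x : D x -> (limn (fun n => (g x * h n x)%:E) = ((EFin \o g) \_ V) x)%E.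
  move=> Dx; apply/cvg_lim => //; rewrite patchE.
  have [|] := boolP (x \in V); rewrite ?inE ?notin_setE => Vx.
    have [N hN] := hV1 _ Vx; apply: cvg_near_cst; exists N => // n /= /hN ->.
    by rewrite mulr1.
  by apply: cvg_near_cst; near=> n; rewrite hV0// mulr0.
rewrite (eq_integral _ _ (fun x xD => gh_lim x (set_mem xD))) -integral_mkcondr; apply.
- by move=> n; apply/measurable_EFinP; exact: measurable_funM.
- by move=> n x Dx; rewrite lee_fin mulr_ge0// g0.
- by move=> x Dx n n' nn'; rewrite lee_fin ler_wpM2l ?g0// hmono.
Unshelve. all: by end_near. Qed.

End density_pushforward.

Section open_approximation.
Context (R : realType) (d : nat).
Local Notation E := 'rV[R]_d.

Lemma min1_lip (p q : R) : `|Num.min 1 p - Num.min 1 q| <= `|p - q|.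
Proof.
rewrite !minElt; case: ltP => h1; case: ltP => h2; rewrite ?subrr ?normr0//.
  by rewrite !ger0_norm ?subr_ge0 ?(le_trans h2 (ltW h1))//; lra.
rewrite ler0_norm; last by rewrite subr_le0.
by rewrite ler0_norm; lra.
Qed.

(** The approximants are [n] times the distance to the complement, capped at [1]. The whole space is
    treated apart because its complement is empty. *)
Lemma open_lipschitz_approx (U : set E) : open U ->
  exists h : nat -> E -> R,
    [/\ forall n x, 0 <= h n x <= 1,
        forall n, exists2 L, 0 <= L & forall x y, `|h n x - h n y| <= L * enorm (x - y),
        forall x n n', (n <= n')%N -> h n x <= h n' x,
        forall n x, ~ U x -> h n x = 0 &
        forall x, U x -> exists N, forall n, (N <= n)%N -> h n x = 1].
Proof.
move=> oU; have [->|/eqP/setTPn[y0 y0U]] := pselect (U = setT).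
  exists (fun _ _ => 1); split => //.
  - by move=> n x; rewrite ler01 lexx.
  - by move=> n; exists 0 => // x y; rewrite subrr normr0 mul0r.
  - by move=> n x /(_ I).
  - by move=> x _; exists 0%N.
pose S x := [set enorm (x - y) | y in ~` U]; pose dist x := inf (S x).
have S0 x : S x !=set0 by exists (enorm (x - y0)); exists y0.
have Slb x : has_lbound (S x) by exists 0 => _ [y _ <-]; exact: enorm_ge0.
have dist0 x : 0 <= dist x.
  by apply: lb_le_inf => // _ [y _ <-]; exact: enorm_ge0.
have distD x x' : dist x <= enorm (x - x') + dist x'.
  rewrite -lerBlDl; apply: lb_le_inf => // _ [y Uy <-].
  rewrite lerBlDl; apply: le_trans (enormB_trans x' _ _).
  by apply: ge_inf => //; exists y.
have distL x x' : `|dist x - dist x'| <= enorm (x - x').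
  rewrite ler_norml; have := distD x x'; have := distD x' x.
  by rewrite enormBC => h1 h2; apply/andP; split; lra.
have distU x : ~ U x -> dist x = 0.
  move=> Ux; apply/eqP; rewrite eq_le dist0 andbT.
  by apply: ge_inf => //; exists x => //; rewrite subrr enorm0.
have dist_gt0 x : U x -> 0 < dist x.
  move=> Ux; have /nbhs_ballP[r /= r0 rU] : nbhs x U by exact: open_nbhs_nbhs.
  apply: (lt_le_trans r0); apply: lb_le_inf => // _ [y Uy <-].
  rewrite leNgt; apply/negP => yr; apply: Uy; apply: rU.
  by rewrite -ball_normE /ball_/= (le_lt_trans (mx_norm_enorm _)).
exists (fun n x => Num.min 1 (n%:R * dist x)); split.
- by move=> n x; rewrite le_min ler01 mulr_ge0// ge_min lexx.
- move=> n; exists n%:R => // x y.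
  have H : `|n%:R * dist x - n%:R * dist y| <= n%:R * enorm (x - y).
    by rewrite -mulrBr normrM ger0_norm// ler_wpM2l.
  by apply: le_trans H; exact: min1_lip.
- move=> x n n' nn'; rewrite le_min ge_min lexx/= ge_min.
  by rewrite ler_wpM2r ?ler_nat ?orbT.
- by move=> n x /distU ->; rewrite mulr0 min_r.
- move=> x /dist_gt0 dx; have [N hN] := ltr_add_invr dx.
  exists N.+1 => n Nn; rewrite min_l//.
  move: hN; rewrite add0r => /ltW h.
  have : N.+1%:R * N.+1%:R^-1 <= N.+1%:R * dist x by rewrite ler_wpM2l.
  rewrite divff// => /le_trans; apply; rewrite ler_wpM2r// ler_nat//.
Qed.

End open_approximation.

Lemma dotv_coord (R : realType) (d : nat) (w v : 'rV[R]_d) (i : 'I_d) :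
  (forall j, j != i -> v ord0 j = 0) -> dotv w v = w ord0 i * v ord0 i.
Proof.
move=> v0; rewrite /dotv (bigD1 i)//= big1 ?addr0// => j ji.
by rewrite v0// mulr0.
Qed.

Section mass_balance.
Context (R : realType) (d : nat).
Local Notation E := 'rV[R]_d.
Variables (Om : set E) (f : E -> R) (kappa : R).
Hypothesis Om_compact : compact Om.
Hypothesis Om_convex : convex_set Om.
Hypothesis Om_neq0 : Om !=set0.
Hypothesis kappa01 : 0 < kappa < 1.
Hypothesis f_hess : forall x, Om x -> (exists g, is_gradient Om f x g) /\
    exists H, [/\ is_hessian Om f x H,
      loewner_le ((1 - kappa^-1)%:M) H & loewner_le H ((1 - kappa)%:M)].
Variables mu nu : {finite_measure set E -> \bar R}.

Local Notation Z := (argmin_cost Om f).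
Local Notation psi y := (fine (c_transform Om f y)).
Hypothesis opt : solves_dual Om mu nu f (fun y => psi y).

Let f_cont : {within Om, continuous f}.
Proof. by have [[[]]] := opt. Qed.

Let psi_cont : {within Om, continuous (fun y => psi y)}.
Proof. by have [[[]]] := opt. Qed.

Let mOm : measurable Om := compact_mx_measurable Om_compact.

Let k0 : 0 < kappa. Proof. by case/andP: kappa01. Qed.

Lemma argmin_cost_in y : Om (Z y).
Proof. by have [] := argmin_costP Om_compact Om_neq0 f_cont y. Qed.

Lemma argmin_continuous : continuous (Z : E -> E).
Proof.
apply: (@lip_continuous _ _ _ _ kappa^-1); first by rewrite invr_ge0 ltW.
by move=> x y; exact: argmin_lip.
Qed.

Lemma argmin_measurable : measurable_fun [set: E] (Z : E -> E).
Proof.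
apply: (measurability (@open E)) => // _ [U oU <-]; rewrite setTI.
by apply: measurable_mx_open; apply: open_comp => // x _; exact: argmin_continuous.
Qed.

Let mef : measurable_fun Om (fun x => expR (- f x)).
Proof.
apply: measurableT_comp => //; apply: measurableT_comp => //.
exact: within_continuous_measurable.
Qed.

Let mep : measurable_fun Om (fun x => expR (- psi x)).
Proof.
apply: measurableT_comp => //; apply: measurableT_comp => //.
exact: within_continuous_measurable.
Qed.

(** Monotone approximation carries the first variation from Lipschitz functions to open sets, which
    form a pi-system generating the Borel sets. *)
Lemma mass_balance (A : set E) : measurable A ->
  (\int[mu]_(x in Om `&` A) (expR (- f x))%:E =
   \int[nu]_(y in Om `&` Z @^-1` A) (expR (- psi y))%:E)%E.
Proof.
have [M1 M1E] := @density_pushforward_measure _ _ _ _ _ mu Om id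
  (fun x => expR (- f x)) mOm (@measurable_id _ _ setT) mef (fun x _ => expR_ge0 _).
have [M2 M2E] := @density_pushforward_measure _ _ _ _ _ nu Om Z
  (fun x => expR (- psi x)) mOm argmin_measurable mep (fun x _ => expR_ge0 _).
move=> mA; rewrite -M2E -[Om `&` A]/(Om `&` id @^-1` A) -M1E.
apply: (measure_unique (@open E) (fun=> setT)) => //.
- by move=> B C oB oC; exact: openI.
- by move=> _; exact: openT.
- by rewrite bigcup_const//; exists 0%N.
- move=> U oU; have [h [h01 hL hmono hU0 hU1]] := open_lipschitz_approx oU.
  have mU := measurable_mx_open oU.
  have hc n : {within Om, continuous (h n)}.
    by have [L L0 HL] := hL n; apply: (lip_within_continuous L0) => x y _ _; exact: HL.
  have hZc n : {within Om, continuous (fun y => h n (Z y))}.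
    have [L L0 HL] := hL n; apply: (@lip_within_continuous _ _ _ _ (L * kappa^-1)).
      by rewrite mulr_ge0// invr_ge0 ltW.
    move=> x y _ _; apply: (le_trans (HL _ _)); rewrite -mulrA ler_wpM2l//.
    exact: argmin_lip.
  have c1 := @integral_indicator_approx _ _ _ mu Om (fun x => expR (- f x)) U h mOm mef
    (fun x _ => expR_ge0 _) mU.
  have c2 := @integral_indicator_approx _ _ _ nu Om (fun x => expR (- psi x)) (Z @^-1` U)
    (fun n y => h n (Z y)) mOm mep (fun x _ => expR_ge0 _).
  have {}c1 := c1 _ _ hmono hU0 hU1.
  have {}c2 := c2 _ _ _ (fun y => hmono (Z y)) (fun n y => hU0 n (Z y)) (fun y => hU1 (Z y)).
  have mh n : measurable_fun Om (h n) by exact: within_continuous_measurable.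
  have mhZ n : measurable_fun Om (fun y => h n (Z y)) by exact: within_continuous_measurable.
  have mZU : measurable (Z @^-1` U).
    by rewrite -[X in measurable X]setTI; exact: argmin_measurable.
  have h0 n x : 0 <= h n x by case/andP: (h01 n x).
  have hn1 n x : `|h n x| <= 1 by rewrite ger0_norm//; case/andP: (h01 n x).
  have {}c1 := c1 mh h0; have {}c2 := c2 mZU mhZ (fun n y => h0 n (Z y)).
  have E n : (\int[mu]_(x in Om) (expR (- f x) * h n x)%:E =
              \int[nu]_(x in Om) (expR (- psi x) * h n (Z x))%:E)%E.
    have [L L0 HL] := hL n.
    rewrite (bounded_mfun_EFin _ mOm); last first.
      apply: bounded_mfunM; last exact: within_bounded_mfun.
      exact/bounded_mfun_expR/bounded_mfunN/within_bounded_mfun.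
    rewrite (bounded_mfun_EFin _ mOm); last first.
      apply: bounded_mfunM; last exact: within_bounded_mfun.
      exact/bounded_mfun_expR/bounded_mfunN/within_bounded_mfun.
    congr EFin; exact: (first_variation_lip Om_compact Om_convex Om_neq0 kappa01 f_hess opt L0 HL (hn1 n)).
  rewrite M1E M2E; rewrite (funext E) in c1.
  exact: (cvg_unique _ c1 c2).
- move=> _; rewrite M1E preimage_setT setIT (bounded_mfun_EFin _ mOm) ?ltry//.
  exact/bounded_mfun_expR/bounded_mfunN/within_bounded_mfun.
Qed.

Variable L : R.
Hypotheses (L0 : 0 <= L)
  (T0L : forall x z, Om x -> Om z -> enorm (T0 Om f x - T0 Om f z) <= L * enorm (x - z)).
Hypothesis mu_ac : forall A, measurable A -> lebesgue_rV R d A = 0%E -> mu A = 0%E.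

Lemma T0_argmin_continuous : continuous (fun y => T0 Om f (Z y)).
Proof.
apply: (@lip_continuous _ _ _ _ (L * kappa^-1)); first by rewrite mulr_ge0// invr_ge0 ltW.
move=> x y; apply: (le_trans (T0L (argmin_cost_in x) (argmin_cost_in y))).
by rewrite -mulrA ler_wpM2l// argmin_lip.
Qed.

Lemma argmin_image_null (K : set E) : compact K -> K `<=` Om ->
  lebesgue_rV R d (Z @` K) = 0%E -> nu K = 0%E.
Proof.
move=> cK KO ZK0.
have mK := compact_mx_measurable cK.
have mZK : measurable (Z @` K).
  apply: compact_mx_measurable; apply: continuous_compact => //.
  exact/continuous_subspaceT/argmin_continuous.
have ZKO : Om `&` Z @` K = Z @` K.
  by apply/setIidPr => _ [y _ <-]; exact: argmin_cost_in.
have mP : measurable (Om `&` Z @^-1` (Z @` K)).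
  by apply: measurableI => //; rewrite -[X in measurable X]setTI; exact: argmin_measurable.
have := mass_balance mZK; rewrite ZKO null_set_integral//; last 2 first.
  - apply/measurable_EFinP; apply: measurable_funS mef => //.
    by move=> _ [y _ <-]; exact: argmin_cost_in.
  - exact: mu_ac.
move=> /esym i0; have [M M0 hM] := within_compact_bounded Om_compact psi_cont.
apply/eqP; rewrite eq_le measure_ge0 andbT -(@pmule_rle0 _ (expR (- M))%:E) ?lte_fin ?expR_gt0//.
rewrite -i0 -integral_cst//; apply: (@le_trans _ _ (\int[nu]_(y in K) (expR (- psi y))%:E)%E).
  apply: ge0_le_integral => //.
  - by move=> x _; rewrite lee_fin expR_ge0.
  - by apply/measurable_EFinP; exact: measurable_funS mep.
  - move=> x Kx; rewrite lee_fin ler_expR lerN2.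
    by rewrite (le_trans (ler_norm _))// hM//; exact: KO.
apply: ge0_subset_integral => //.
- by apply/measurable_EFinP; apply: measurable_funS mep => // x [].
- by move=> x Kx; split; [exact: KO|exists x].
Qed.

Let offset (y : E) (i : 'I_d) : R := (y - T0 Om f (Z y)) ord0 i.

Let offset_continuous i : continuous (fun y => offset y i).
Proof.
move=> y; have h : (t - T0 Om f (Z t) : E) @[t --> y] --> (y - T0 Om f (Z y) : E).
  exact: (cvgB cvg_id (@T0_argmin_continuous y)).
exact: (cvg_comp _ _ h (@coord_continuous R 1 d ord0 i _)).
Qed.

(** If two minimizers differ only along axis [i], [argmin_foc] at each says that the other is not on
    the side to which its offset points. Offsets of equal sign then force equality. *)
Let offset_argmin_inj (s : R) i y y' : Om y -> Om y' ->
  0 < s * offset y i -> 0 < s * offset y' i ->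
  (forall j, j != i -> (Z y) ord0 j = (Z y') ord0 j) -> Z y = Z y'.
Proof.
move=> Oy Oy' sy sy' ZZ.
have foc u u' : 0 < s * offset u i -> (forall j, j != i -> (Z u) ord0 j = (Z u') ord0 j) ->
    s * ((Z u') ord0 i - (Z u) ord0 i) <= 0.
  move=> su uu'.
  have := argmin_foc Om_compact Om_convex Om_neq0 kappa01 f_hess f_cont u (argmin_cost_in u').
  rewrite (@dotv_coord _ _ _ _ i); last by move=> j /uu' e; rewrite !mxE e subrr.
  have -> : (T0 Om f (Z u) - u) ord0 i = - offset u i by rewrite /offset !mxE opprB.
  rewrite !mxE => h.
  have : 0 <= (s * offset u i) * - (s * ((Z u') ord0 i - (Z u) ord0 i)).
    by rewrite mulrN mulrACA -mulrN -mulNr mulr_ge0// -expr2 sqr_ge0.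
  by rewrite pmulr_rge0// oppr_ge0.
have h1 := foc _ _ sy ZZ.
have h2 := foc y' y sy' (fun j ji => esym (ZZ j ji)).
have s0 : s != 0 by apply: contraTneq sy => ->; rewrite mul0r ltxx.
have : s * ((Z y') ord0 i - (Z y) ord0 i) = 0 
  by apply/eqP; rewrite eq_le h1/= -oppr_le0 -mulrN opprB.
move=> /eqP; rewrite mulf_eq0 (negPf s0)/= subr_eq0 => /eqP e.
by apply/rowP => j; have [->|/ZZ//] := eqVneq j i.
Qed.

(* If y - T0 (Z y) has a nonzero i-th coordinate, then first-order optimality
   of Z y allows at most one such point Z y on each line parallel to the i-th
   axis.  These points form a null set, which mass_balance pulls back to nu. *)
Lemma T0_argmin_ae : nu.-negligible [set y | Om y /\ T0 Om f (Z y) <> y].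
Proof.
(* Countably many compact pieces: an axis, a sign of the offset, and a threshold [q.2.+1%:R^-1] that
   makes the condition closed. *)
pose K (q : 'I_d * bool * nat) := Om `&`
  [set y | q.2.+1%:R^-1 <= (-1) ^+ q.1.2 * offset y q.1.1].
have K0 q : nu.-negligible (K q).
  have cK : compact (K q).
    apply: compact_closedI => //.
    rewrite (_ : [set _ | _] = (fun y => (-1) ^+ q.1.2 * offset y q.1.1) @^-1`
      [set r | q.2.+1%:R^-1 <= r])//.
    apply: closed_comp => [y _|]; last exact: closed_ge.
    exact: (cvgM (cvg_cst ((-1) ^+ q.1.2 : R)) (@offset_continuous q.1.1 y)).
  have KO : K q `<=` Om by move=> y [].
  apply/negligibleP; first exact: compact_mx_measurable.
  apply: argmin_image_null => //.
  apply: (lebesgue_rV_section_null (i := q.1.1)).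
    apply: compact_mx_measurable; apply: continuous_compact => //.
    exact/continuous_subspaceT/argmin_continuous.
  move=> _ _ [y [Oy yq] <-] [y' [Oy' yq'] <-].
  have q0 : 0 < q.2.+1%:R^-1 :> R by rewrite invr_gt0.
  exact: (offset_argmin_inj Oy Oy' (lt_le_trans q0 yq) (lt_le_trans q0 yq')).
have : nu.-negligible (\bigcup_n (if unpickle n is Some q then K q else set0)).
  by apply: negligible_bigcup => n; case: unpickle => [q|]; [exact: K0|exact: negligible_set0].
apply: negligibleS => y [Oy yT].
have [i yi] : exists i, offset y i != 0.
  apply: contrapT => h; apply: yT; apply/esym/eqP; rewrite -subr_eq0; apply/eqP/rowP => i.
  by rewrite [RHS]mxE; apply/eqP; apply: contrapT => /negP yi; apply: h; exists i.
pose b := offset y i < 0.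
have yb : 0 < (-1) ^+ b * offset y i.
  rewrite /b; case: (ltP (offset y i) 0) => y0.
    by rewrite expr1 mulN1r oppr_gt0.
  by rewrite expr0 mul1r lt_def yi.
have [k hk] := ltr_add_invr yb; rewrite add0r in hk.
exists (pickle (i, b, k)) => //; rewrite pickleK /K; split => //=.
exact: ltW.
Qed.

End mass_balance.

(** * The optimality gap and multiscale matching *)

Section kl_bounds.
Context (R : realType).

(** The right-hand side is a Fenchel-Young gap, equal to the KL divergence of [a] from [expR (- p)].
    The bound by the squared Hellinger distance follows from [ln (q / s) <= q / s - 1] with
    [s = Num.sqrt a] and [q = expR (- p / 2)]. *)
Lemma kl_entropy_lower (a p : R) : 0 <= a ->
  (Num.sqrt a - expR (- p / 2)) ^+ 2 <= kl_entropy a + p * a - 1 + expR (- p).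
Proof.
have e2 : expR (- p) = expR (- p / 2) ^+ 2.
  by rewrite -expRM_natl; congr expR; field.
rewrite le_eqVlt => /orP[/eqP <-|a0].
  by rewrite /kl_entropy sqrtr0 mul0r mulr0 sub0r sqrrN e2; lra.
set q := expR (- p / 2) in e2 *; have q0 : 0 < q by exact: expR_gt0.
pose s := Num.sqrt a; have s0 : 0 < s by rewrite sqrtr_gt0.
have as2 : a = s ^+ 2 by rewrite sqr_sqrtr// ltW.
have lq : ln q = - p / 2 by rewrite /q expRK.
have las : ln a = 2 * ln s by rewrite as2 lnXn// mulr_natl.
have h : ln (q / s) <= q / s - 1.
  rewrite -[X in ln X](subrKC 1) le_ln1Dx// ltrBrDl subrr divr_gt0//.
rewrite ln_div ?posrE// lq in h.
rewrite /kl_entropy las e2 -/s as2.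
have : s ^+ 2 * (- p / 2 - ln s) <= s ^+ 2 * (q / s - 1) by rewrite ler_pM2l// exprn_gt0.
rewrite [X in _ <= X -> _](_ : _ = s * q - s ^+ 2); last by field; rewrite gt_eqF.
lra.
Qed.

(** The gap minus the missing mass is [a * (ln a + p)], nonpositive below [expR (- p)]. Hence the
    gap is linear in the missing mass for competitors with sub-marginals. *)
Lemma kl_entropy_upper (a p : R) : 0 <= a -> a <= expR (- p) ->
  kl_entropy a + p * a - 1 + expR (- p) <= expR (- p) - a.
Proof.
move=> a0 ap; suff : a * (ln a + p) <= 0 by rewrite /kl_entropy; lra.
move: a0; rewrite le_eqVlt => /orP[/eqP <-|a0]; first by rewrite mul0r.
rewrite pmulr_rle0//; have : ln a <= - p by rewrite -[leRHS]expRK ler_ln// posrE expR_gt0.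
lra.
Qed.

End kl_bounds.

(** * Duality gap of the empirical problem *)

Section gap.
Context (R : realType) (d n m : nat).
Local Notation E := 'rV[R]_d.
Variables (X : 'I_n -> E) (Y : 'I_m -> E) (Mx My : R) (f : 'I_n -> R) (g : 'I_m -> R).
Hypotheses (n0 : (0 < n)%N) (m0 : (0 < m)%N) (Mx0 : 0 < Mx) (My0 : 0 < My).

Local Notation a := (Mx / n%:R).
Local Notation b := (My / m%:R).

Let a0 : 0 < a. Proof. by rewrite divr_gt0// ltr0n. Qed.
Let b0 : 0 < b. Proof. by rewrite divr_gt0// ltr0n. Qed.

(** The duality gap of [G] against the potentials [f] and [g]: the integrated slack plus the
    Fenchel-Young gaps of the two entropies. *)
Definition transport_gap (G : 'M[R]_(n, m)) : R :=
  \sum_i \sum_j (cost (X i) (Y j) - f i - g j) * G i j +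
  \sum_i a * (kl_entropy (row_mass G i / a) + f i * (row_mass G i / a) - 1 + expR (- f i)) +
  \sum_j b * (kl_entropy (col_mass G j / b) + g j * (col_mass G j / b) - 1 + expR (- g j)).

(** The last two sums are the dual value at [f] and [g]. They do not depend on [G], so minimizing
    the objective is minimizing the gap. *)
Lemma empirical_uotE (G : 'M[R]_(n, m)) :
  empirical_uot X Y Mx My G =
  (transport_gap G + (\sum_i a * (1 - expR (- f i)) + \sum_j b * (1 - expR (- g j))))%:E.
Proof.
rewrite /empirical_uot /kl_vec /kl_term (gt_eqF a0) (gt_eqF b0) !sumEFin -!EFinD; congr EFin.
rewrite /transport_gap.
have -> : \sum_i \sum_j (cost (X i) (Y j) - f i - g j) * G i j =
   \sum_i \sum_j cost (X i) (Y j) * G i j - \sum_i f i * row_mass G i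
   - \sum_j g j * col_mass G j.
  have -> : \sum_j g j * col_mass G j = \sum_i \sum_j g j * G i j.
    by rewrite exchange_big; apply: eq_bigr => j _; rewrite mulr_sumr.
  rewrite -!sumrB; apply: eq_bigr => i _; rewrite /row_mass mulr_sumr -!sumrB.
  by apply: eq_bigr => j _; ring.
have -> : \sum_i a * (kl_entropy (row_mass G i / a) + f i * (row_mass G i / a) - 1 + expR (- f i))
  = \sum_i a * kl_entropy (row_mass G i / a) + \sum_i f i * row_mass G i
    - \sum_i a * (1 - expR (- f i)).
  rewrite -big_split -sumrB; apply: eq_bigr => i _ /=.
  by field; rewrite ?gt_eqF ?ltr0n//.
have -> : \sum_j b * (kl_entropy (col_mass G j / b) + g j * (col_mass G j / b) - 1 + expR (- g j))
  = \sum_j b * kl_entropy (col_mass G j / b) + \sum_j g j * col_mass G j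
    - \sum_j b * (1 - expR (- g j)).
  rewrite -big_split -sumrB; apply: eq_bigr => i _ /=.
  by field; rewrite ?gt_eqF ?ltr0n//.
by ring.
Qed.

(** The gap of [G] is bounded below by its slack and the Hellinger term of its rows, its column gap
    being nonnegative; the gap of [G'] is bounded above by its slack and the mass missing on each
    side. *)
Lemma optimal_gap_le (G G' : 'M[R]_(n, m)) :
  optimal_plan X Y Mx My G -> (forall i j, 0 <= G' i j) ->
  (forall i, row_mass G' i <= a * expR (- f i)) ->
  (forall j, col_mass G' j <= b * expR (- g j)) ->
  \sum_i \sum_j (cost (X i) (Y j) - f i - g j) * G i j +
  \sum_i a * (ahat Mx G i - expR (- f i / 2)) ^+ 2 <=
  \sum_i \sum_j (cost (X i) (Y j) - f i - g j) * G' i j +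
  (\sum_i a * expR (- f i) - \sum_i \sum_j G' i j) +
  (\sum_j b * expR (- g j) - \sum_i \sum_j G' i j).
Proof.
move=> [G0 Gopt] G'0 hr hc; have := Gopt _ G'0.
rewrite !empirical_uotE lee_fin lerD2r => h.
have r0 (H : 'M[R]_(n, m)) i : (forall i j, 0 <= H i j) -> 0 <= row_mass H i / a.
  by move=> H0; rewrite divr_ge0 ?(ltW a0)// sumr_ge0.
have c0 (H : 'M[R]_(n, m)) j : (forall i j, 0 <= H i j) -> 0 <= col_mass H j / b.
  by move=> H0; rewrite divr_ge0 ?(ltW b0)// sumr_ge0.
apply: (@le_trans _ _ (transport_gap G)).
  rewrite /transport_gap -addrA lerD2l -[leLHS]addr0 lerD//.
    apply: ler_sum => i _; rewrite ler_pM2l//; exact/kl_entropy_lower/r0.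
  apply: sumr_ge0 => j _; apply: mulr_ge0; first exact: ltW.
  by apply: le_trans (kl_entropy_lower _ (c0 _ _ G0)); exact: sqr_ge0.
apply: (le_trans h); rewrite /transport_gap; apply: lerD; first apply: lerD => //.
  rewrite -sumrB; apply: ler_sum => i _.
  have -> : a * expR (- f i) - \sum_j G' i j = a * (expR (- f i) - row_mass G' i / a).
    by rewrite mulrBr mulrCA divff ?mulr1 ?gt_eqF.
  rewrite ler_pM2l//; apply: kl_entropy_upper; first exact: r0.
  by rewrite ler_pdivrMr// mulrC.
rewrite [X in _ - X]exchange_big -sumrB; apply: ler_sum => j _.
have -> : b * expR (- g j) - \sum_i G' i j = b * (expR (- g j) - col_mass G' j / b).
  by rewrite mulrBr mulrCA divff ?mulr1 ?gt_eqF.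
rewrite ler_pM2l//; apply: kl_entropy_upper; first exact: c0.
by rewrite ler_pdivrMr// mulrC.
Qed.

End gap.

(** * Greedy matching of two weighted families *)

Section matching.
Context (R : realFieldType) (I J : finType).
Implicit Types (a b : I -> R).

(** Inside each cell, the product coupling divided by the larger of the two cell masses: neither
    marginal is exceeded and the smaller mass is used up. In a cell without mass the division by
    zero returns [0]. *)
Lemma block_matching (Q : finType) (cx : I -> Q) (cy : J -> Q) (a : I -> R) (b : J -> R) :
  (forall i, 0 <= a i) -> (forall j, 0 <= b j) ->
  exists g : I -> J -> R,
    [/\ forall i j, 0 <= g i j,
        forall i j, cx i != cy j -> g i j = 0,
        forall i, \sum_j g i j <= a i,
        forall j, \sum_i g i j <= b j &
        forall q, \sum_(i | cx i == q) \sum_j g i j =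
          Num.min (\sum_(i | cx i == q) a i) (\sum_(j | cy j == q) b j)].
Proof.
move=> a0 b0.
pose A q := \sum_(i | cx i == q) a i; pose B q := \sum_(j | cy j == q) b j.
have A0 q : 0 <= A q by exact: sumr_ge0.
have B0 q : 0 <= B q by exact: sumr_ge0.
pose M q := Num.max (A q) (B q).
have M0 q : 0 <= M q by rewrite le_max A0.
have BM q : B q / M q <= 1.
  have [->|M1] := eqVneq (M q) 0; first by rewrite invr0 mulr0.
  by rewrite ler_pdivrMr ?lt_def ?M1 ?M0// mul1r le_max lexx orbT.
have AM q : A q / M q <= 1.
  have [->|M1] := eqVneq (M q) 0; first by rewrite invr0 mulr0.
  by rewrite ler_pdivrMr ?lt_def ?M1 ?M0// mul1r le_max lexx.
pose g i j := if cx i == cy j then a i * b j / M (cx i) else 0.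
have rowg i : \sum_j g i j = a i * (B (cx i) / M (cx i)).
  rewrite /g -big_mkcond/= mulrA /B mulr_sumr mulr_suml.
  by apply: eq_bigl => j; rewrite eq_sym.
exists g; split.
- by move=> i j; rewrite /g; case: ifP => // _; rewrite divr_ge0// mulr_ge0.
- by move=> i j; rewrite /g => /negPf ->.
- by move=> i; rewrite rowg ler_piMr.
- move=> j; rewrite (eq_bigr (fun i => if cx i == cy j then a i * (b j / M (cy j)) else 0)).
    by rewrite -big_mkcond/= -mulr_suml -/(A _) mulrCA ler_piMr.
  by move=> i _; rewrite /g; case: eqP => // ->; rewrite mulrA.
- move=> q; rewrite (eq_bigr (fun i => a i * (B q / M q))); last first.
    by move=> i /eqP <-; rewrite rowg.
  rewrite -mulr_suml -/(A q) -/(B q).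
  have [M1|M1] := eqVneq (M q) 0.
    have /eqP Aq : A q == 0 by rewrite eq_le A0 -M1 le_max lexx.
    have /eqP Bq : B q == 0 by rewrite eq_le B0 -M1 le_max lexx orbT.
    by rewrite Aq Bq mul0r minxx.
  have : M q * Num.min (A q) (B q) = A q * B q.
    by rewrite /M maxEle minEle; case: ifP => _ //; rewrite mulrC.
  by move=> h; rewrite mulrA -h mulrC mulKf.
Qed.

Variables (s : I -> J -> R) (a : I -> R) (b : J -> R).
Hypotheses (a0 : forall i, 0 <= a i) (b0 : forall j, 0 <= b j).

Definition block_discrepancy (Q : finType) (cx : I -> Q) (cy : J -> Q) : R :=
  \sum_q `|\sum_(i | cx i == q) a i - \sum_(j | cy j == q) b j|.

Lemma block_mass_eq (Q : finType) (cx : I -> Q) (cy : J -> Q) (g : I -> J -> R) q :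
  (forall i j, cx i != cy j -> g i j = 0) ->
  \sum_(i | cx i == q) \sum_j g i j = \sum_(j | cy j == q) \sum_i g i j.
Proof.
move=> g0; rewrite [RHS]exchange_big/= [in RHS](bigID (fun i => cx i == q))/=.
rewrite [X in _ = _ + X]big1 ?addr0; last first.
  move=> i iq; rewrite big1// => j /eqP jq; apply: g0; by rewrite jq.
apply: eq_bigr => i /eqP iq; rewrite [LHS](bigID (fun j => cy j == q))/=.
by rewrite [X in _ + X]big1 ?addr0// => j jq; apply: g0; rewrite iq eq_sym.
Qed.

(* Match as much mass as possible inside the finest cells, then match the
   leftovers inside the next coarser cells, and so on up to level 0. *)
Lemma multiscale_matching (K : nat) (Q : nat -> finType)
  (cx : forall k, I -> Q k) (cy : forall k, J -> Q k) (del : nat -> R) :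
  (forall k, 0 <= del k) ->
  (forall k i j, cx k.+1 i = cy k.+1 j -> cx k i = cy k j) ->
  (forall k i j, cx k i = cy k j -> s i j <= del k) ->
  exists g : I -> J -> R,
    [/\ [/\ forall i j, 0 <= g i j,
        forall i j, cx 0%N i != cy 0%N j -> g i j = 0,
        forall i, \sum_j g i j <= a i &
        forall j, \sum_i g i j <= b j],
        forall q, \sum_(i | cx 0%N i == q) (a i - \sum_j g i j) <=
          `|\sum_(i | cx 0%N i == q) a i - \sum_(j | cy 0%N j == q) b j| &
        \sum_i \sum_j s i j * g i j <=
        del K * \sum_i a i + \sum_(k < K) del k * block_discrepancy (cx k.+1) (cy k.+1)].
Proof.
elim: K Q cx cy del => [|K IH] Q cx cy del del0 nest sdel.
  have [g [g0 gsupp gr gc gmin]] := block_matching (cx 0%N) (cy 0%N) a0 b0.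
  exists g; split=> // [q|].
    rewrite sumrB gmin; move: (\sum_(_ | _) _) (\sum_(_ | _) _) => A B.
    by rewrite minElt; case: ltP => h; rewrite ?subrr// ler_norm.
  rewrite big_ord0 addr0 mulr_sumr; apply: ler_sum => i _.
  apply: (@le_trans _ _ (\sum_j del 0%N * g i j)); last by rewrite -mulr_sumr ler_wpM2l.
  apply: ler_sum => j _; have [e|/gsupp ->] := eqVneq (cx 0%N i) (cy 0%N j).
    by rewrite ler_wpM2r// sdel.
  by rewrite !mulr0.
(* Levels shifted by one: [g] treats the finer levels, and its leftovers are then matched inside the
   level-0 cells. *)
have [g [[g0 gsupp gr gc] gleft gcost]] := IH (fun k => Q k.+1) (fun k => cx k.+1)
  (fun k => cy k.+1) (fun k => del k.+1) (fun k => del0 k.+1) (fun k => @nest k.+1)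
  (fun k => @sdel k.+1).
have gsupp0 i j : cx 0%N i != cy 0%N j -> g i j = 0.
  by move=> h; apply: gsupp; apply: contraNneq h => /nest ->.
pose a' i := a i - \sum_j g i j; pose b' j := b j - \sum_i g i j.
have a'0 i : 0 <= a' i by rewrite subr_ge0.
have b'0 j : 0 <= b' j by rewrite subr_ge0.
have [h [h0 hsupp hr hc hmin]] := block_matching (cx 0%N) (cy 0%N) a'0 b'0.
exists (fun i j => g i j + h i j); split; first split.
- by move=> i j; rewrite addr_ge0.
- by move=> i j ij; rewrite gsupp0// hsupp// addr0.
- by move=> i; rewrite big_split/= -lerBrDl.
- by move=> j; rewrite big_split/= -lerBrDl.
- move=> q; rewrite (eq_bigr (fun i => a' i - \sum_j h i j)); last first.
    by move=> i _; rewrite big_split/= opprD addrA.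
  rewrite sumrB hmin.
  (* [g] removes the same mass from both sides of a level-0 cell, so the leftovers have the
     discrepancy of the original weights. *)
  have -> : \sum_(i | cx 0%N i == q) a i - \sum_(j | cy 0%N j == q) b j =
      \sum_(i | cx 0%N i == q) a' i - \sum_(j | cy 0%N j == q) b' j.
    by rewrite /a' /b' !sumrB (block_mass_eq q gsupp0) opprB addrA subrK.
  move: (\sum_(_ | _) _) (\sum_(_ | _) _) => A B.
  by rewrite minElt; case: ltP => hAB; rewrite ?subrr// ler_norm.
- rewrite (eq_bigr (fun i => \sum_j s i j * g i j + \sum_j s i j * h i j)); last first.
    by move=> i _; rewrite -big_split; apply: eq_bigr => j _; rewrite mulrDr.
  rewrite big_split/= big_ord_recl addrCA [leRHS]addrC lerD//.
  apply: (@le_trans _ _ (del 0%N * \sum_i a' i)).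
    rewrite mulr_sumr; apply: ler_sum => i _.
    apply: (@le_trans _ _ (\sum_j del 0%N * h i j)); last by rewrite -mulr_sumr ler_wpM2l.
    apply: ler_sum => j _; have [e|/hsupp ->] := eqVneq (cx 0%N i) (cy 0%N j).
      by rewrite ler_wpM2r// sdel.
    by rewrite !mulr0.
  (* By [gleft], the mass left for level 0 is at most the level-1 discrepancy; hence the shift
     between [del k] and the level [k.+1]. *)
  rewrite ler_wpM2l// (partition_big (cx 1%N) xpredT)//=.
  by apply: ler_sum => q _; exact: gleft.
Qed.

End matching.

(** * Dyadic cells *)

Section cells.
Context (R : realType) (d : nat) (B : R).
Hypothesis B0 : 0 < B.
Local Notation E := 'rV[R]_d.

(** For [|r| <= B] the truncated number is at most [2 ^ k], so [inord] is exact; other reals may get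
    a dummy index, hence the box hypotheses below. The cells have side [4 * B / 2 ^+ k]. *)
Definition cell_coord (k : nat) (r : R) : 'I_(2 ^ k).+1 :=
  inord (Num.truncn (2 ^+ k * ((r + B) / (4 * B)))).

Definition cell (k : nat) (x : E) : {ffun 'I_d -> 'I_(2 ^ k).+1} :=
  [ffun i => cell_coord k (x ord0 i)].

Lemma cell_coord_val k r : `|r| <= B ->
  (cell_coord k r)%:R <= 2 ^+ k * ((r + B) / (4 * B)) < (cell_coord k r).+1%:R.
Proof.
rewrite ler_norml => /andP[r1 r2].
have t0 : 0 <= (r + B) / (4 * B) by rewrite divr_ge0 ?mulr_ge0 ?(ltW B0)//; lra.
have t1 : (r + B) / (4 * B) <= 1.
  by rewrite ler_pdivrMr ?mulr_gt0// mul1r; lra.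
have p0 : 0 <= 2 ^+ k * ((r + B) / (4 * B)) by rewrite mulr_ge0// exprn_ge0.
have /andP[h1 h2] := Num.Theory.truncn_itv p0.
suff -> : (cell_coord k r : nat) = Num.truncn (2 ^+ k * ((r + B) / (4 * B))) by rewrite h1.
rewrite inordK// ltnS -(ler_nat R) (le_trans h1)// natrX.
by rewrite ler_piMr// exprn_ge0.
Qed.

Lemma cell_coord_le k r r' : `|r| <= B -> `|r'| <= B ->
  cell_coord k r = cell_coord k r' -> `|r - r'| <= 4 * B / 2 ^+ k.
Proof.
move=> hr hr' e; have /andP[a1 a2] := cell_coord_val k hr.
have /andP[b1 b2] := cell_coord_val k hr'; rewrite e in a1 a2.
have p0 : 0 < 2 ^+ k :> R by rewrite exprn_gt0.
have B4 : 0 < 4 * B by rewrite mulr_gt0.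
have : `|2 ^+ k * ((r + B) / (4 * B)) - 2 ^+ k * ((r' + B) / (4 * B))| <= 1.
  by rewrite -natr1 in a2 b2; rewrite ler_norml; apply/andP; split; lra.
rewrite -mulrBr -mulrBl opprD addrACA subrr addr0 mulrA normrM normfV (gtr0_norm B4).
rewrite ler_pdivrMr// mul1r normrM (gtr0_norm p0) => h.
by rewrite ler_pdivlMr// mulrC.
Qed.

(** The integer part of [u] is half, rounded down, of the integer part of [2 * u]: the finer index
    determines the coarser one. *)
Lemma cell_coord_nest k r r' : `|r| <= B -> `|r'| <= B ->
  cell_coord k.+1 r = cell_coord k.+1 r' -> cell_coord k r = cell_coord k r'.
Proof.
move=> hr hr' e; have /andP[a1 a2] := cell_coord_val k.+1 hr.
have /andP[b1 b2] := cell_coord_val k.+1 hr'; rewrite e in a1 a2.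
have /andP[c1 c2] := cell_coord_val k hr; have /andP[d1 d2] := cell_coord_val k hr'.
move: a1 a2 b1 b2; rewrite exprS -!mulrA.
move: (2 ^+ k * ((r + B) / (4 * B))) (2 ^+ k * ((r' + B) / (4 * B))) c1 c2 d1 d2 => t t'.
set q := nat_of_ord (cell_coord k.+1 r'); set p := nat_of_ord (cell_coord k r).
set p' := nat_of_ord (cell_coord k r') => c1 c2 d1 d2 a1 a2 b1 b2.
have key (u : R) (v : nat) : v%:R <= u -> u < v.+1%:R -> q%:R <= 2 * u -> 2 * u < q.+1%:R ->
    (v = q./2).
  move=> h1 h2 h3 h4.
  have i1 : (v.*2 <= q)%N.
    by rewrite -ltnS -(ltr_nat R) (le_lt_trans _ h4)// -mul2n natrM ler_pM2l.
  have i2 : (q < v.+1.*2)%N.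
    by rewrite -(ltr_nat R) (le_lt_trans h3)// -mul2n natrM ltr_pM2l.
  apply/eqP; rewrite eqn_leq; apply/andP; split.
    by rewrite -[v]doubleK half_leq.
  by move: i2; rewrite doubleS ltnS => /half_leq; rewrite /= uphalf_double.
apply/val_inj; exact: etrans (key t p c1 c2 a1 a2) (esym (key t' p' d1 d2 b1 b2)).
Qed.

Definition in_box (x : E) := forall i, `|x ord0 i| <= B.

Lemma cell_nest k x y : in_box x -> in_box y -> cell k.+1 x = cell k.+1 y -> cell k x = cell k y.
Proof.
move=> hx hy /ffunP e; apply/ffunP => i; have := e i; rewrite !ffunE.
exact: cell_coord_nest.
Qed.

Lemma cell_coord_dist k x y i : in_box x -> in_box y -> cell k x = cell k y ->
  `|(x - y) ord0 i| <= 4 * B / 2 ^+ k.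
Proof.
move=> hx hy /ffunP/(_ i); rewrite !ffunE !mxE; exact: cell_coord_le.
Qed.

Lemma cell_sqnorm k x y : in_box x -> in_box y -> cell k x = cell k y ->
  sqnorm (x - y) <= d%:R * (4 * B) ^+ 2 * 4^-1 ^+ k.
Proof.
move=> hx hy e; apply: (le_trans (sqnorm_coord_le (fun i => cell_coord_dist i hx hy e))).
rewrite -[leRHS]mulrA ler_wpM2l// expr_div_n -exprM mulnC exprM (_ : 2 ^+ 2 = 4 :> R) ?exprVn//.
by rewrite expr2; lra.
Qed.

Lemma cell_enorm k x y : in_box x -> in_box y -> cell k x = cell k y ->
  enorm (x - y) <= d%:R * (4 * B / 2 ^+ k).
Proof.
move=> hx hy e; apply: enorm_coord_le => [|i]; last exact: cell_coord_dist.
by rewrite divr_ge0 ?exprn_ge0// mulr_ge0// ltW.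
Qed.

Lemma card_cell k : (#|{: {ffun 'I_d -> 'I_(2 ^ k).+1}}| <= 2 ^ d * (2 ^ k) ^ d)%N.
Proof.
rewrite card_ffun !card_ord -expnMn; case: (posnP d) => [->//|d0].
rewrite leq_exp2r//.
by rewrite mul2n -addnn -addn1 leq_add2l expn_gt0.
Qed.

(** [Num.truncn] is [0] on negative reals, so the fibre of [0] is a half-line and not a bounded
    interval. *)
Lemma measurable_truncn_eq (N : nat) : measurable [set r : R | Num.truncn r = N].
Proof.
case: N => [|N].
  rewrite (_ : [set _ | _] = `]-oo, (1 : R)[%classic); first exact: measurable_itv.
  apply/seteqP; split => r /=; rewrite in_itv/= ltNge => /Num.Theory.truncn0Pn//.
rewrite (_ : [set _ | _] = `[N.+1%:R, (N.+2%:R : R)[%classic); first exact: measurable_itv.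
apply/seteqP; split => r /=; rewrite in_itv/=.
  move=> e; have := Num.Theory.truncn_gt_nat r N; have := Num.Theory.truncn_gt_nat r N.+1.
  by rewrite e ltnn ltnSn => e1 <-; rewrite ltNge -e1.
by move=> /Num.Theory.truncn_def.
Qed.

Lemma measurable_cell k q : measurable [set x : E | cell k x = q].
Proof.
pose h (i : 'I_d) (x : E) := 2 ^+ k * ((x ord0 i + B) / (4 * B)).
have mh i : measurable_fun [set: E] (h i).
  apply: measurable_funM => //; apply: measurable_funM => //.
  by apply: measurable_funD => //; exact: measurable_mx_coord.
rewrite (_ : [set _ | _] = \bigcap_(i in [set: 'I_d]) \bigcup_(N in [set N | inord N = q i])
    (h i @^-1` [set r | Num.truncn r = N])).
  apply: fin_bigcap_measurable => [|i _]; first exact: finite_finset.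
  apply: bigcup_measurable => N _; rewrite -[X in measurable X]setTI.
  by apply: mh => //; exact: measurable_truncn_eq.
apply/seteqP; split => x /=.
  by move=> <- i _; exists (Num.truncn (h i x)) => //=; rewrite ffunE.
by move=> H; apply/ffunP => i; have [N /= <- <-] := H i I; rewrite ffunE.
Qed.

End cells.

Section clip.
Context (R : realType).

Lemma clip_bounds (lo hi t : R) : lo <= hi -> lo <= clip lo hi t <= hi.
Proof.
by move=> lohi; rewrite /clip le_min lohi le_max lexx/= ge_min lexx.
Qed.

(** Squaring is not Lipschitz on unbounded weights. After clipping, both square roots are at most
    [h = Num.sqrt hi], which gives the Lipschitz constant [2 * h]; clipping moves no closer point
    away because [q ^+ 2] is in the interval. *)
Lemma clip_sqr_dist (lo hi a q : R) : 0 < lo -> 0 <= a -> 0 <= q -> lo <= q ^+ 2 <= hi ->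
  (clip lo hi (a ^+ 2) - q ^+ 2) ^+ 2 <= 4 * hi * (a - q) ^+ 2.
Proof.
move=> lo0 a0 q0 /andP[loq qhi].
have hi0 : 0 <= hi by apply: le_trans qhi; exact: sqr_ge0.
pose h := Num.sqrt hi; have h0 : 0 <= h by exact: sqrtr_ge0.
have h2 : hi = h ^+ 2 by rewrite sqr_sqrtr.
have qh : q <= h by rewrite -ler_sqr ?nnegrE// -h2.
have sq (x y : R) : `|x| <= `|y| -> x ^+ 2 <= y ^+ 2.
  by move=> xy; rewrite -[leLHS]real_normK ?num_real// -[leRHS]real_normK ?num_real// ler_sqr ?nnegrE.
rewrite (_ : 4 * hi * (a - q) ^+ 2 = (2 * h * (a - q)) ^+ 2); last by rewrite h2; ring.
apply: sq; rewrite normrM (ger0_norm (_ : 0 <= 2 * h)) ?mulr_ge0//.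
have [ah|ah] := leP (a ^+ 2) hi.
  apply: (@le_trans _ _ `|a ^+ 2 - q ^+ 2|).
    rewrite /clip; have [l|l] := leP lo (a ^+ 2).
      by rewrite min_r.
    rewrite min_r; last exact: le_trans loq qhi.
    by rewrite !ler0_norm; lra.
  have ah' : a <= h by rewrite -ler_sqr ?nnegrE// -h2.
  rewrite subr_sqr normrM mulrC ler_wpM2r// ger0_norm; last by rewrite addr_ge0.
  by lra.
have ah' : h < a by rewrite -ltr_sqr ?nnegrE// -h2.
rewrite /clip min_l; last by rewrite le_max (ltW ah) orbT.
rewrite !ger0_norm ?subr_ge0//; last by lra.
rewrite h2 subr_sqr mulrC ler_pM ?subr_ge0 ?addr_ge0//; lra.
Qed.

Lemma expR_lip (M u v : R) : u <= M -> v <= M -> `|expR u - expR v| <= expR M * `|u - v|.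
Proof.
wlog vu : u v / v <= u => [H uM vM|uM vM].
  have [vu|/ltW uv] := leP v u; first exact: H.
  by rewrite distrC (distrC u); exact: H.
rewrite !ger0_norm ?subr_ge0 ?ler_expR//.
have h : 1 + (v - u) <= expR (v - u) by exact: expR_ge1Dx.
have -> : expR u - expR v = expR u * (1 - expR (v - u)).
  by rewrite mulrBr mulr1 -expRD subrKC.
have e0 := expR_gt0 u.
apply: (@le_trans _ _ (expR u * (u - v))); first by rewrite ler_pM2l//; lra.
by rewrite ler_wpM2r ?subr_ge0// ler_expR.
Qed.

End clip.

(** * Errors at the sample points *)

(** [e1] and [e2] are the slack cost and the mass of the competitor, [e3] and [e4] the total weights
    of the two samples. The first sample loses at most [w], the second at most [2 * w], whence the
    constant [3]. *)
Lemma gap_arith (R : realFieldType) (u v w c e1 e2 e3 e4 e5 e6 e7 : R) :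
  e6 <= e5 -> e5 + e7 <= e1 + (e3 - e2) + (e4 - e2) -> e3 - e2 <= w -> e4 - e3 <= w ->
  0 <= u -> 0 <= v -> e1 <= c * u + c * v -> 0 <= w -> 0 <= c ->
  e6 + e7 <= (c + 3) * (u + v + w).
Proof.
move=> h1 h2 h3 h4 u0 v0 h5 w0 c0; have cw : 0 <= c * w by rewrite mulr_ge0.
by rewrite !mulrDr !mulrDl; lra.
Qed.

Section sample_bounds.
Context (R : realType) (d : nat).
Local Notation E := 'rV[R]_d.
Variables (Om : set E) (f : E -> R) (kappa : R).
Hypothesis Om_compact : compact Om.
Hypothesis Om_convex : convex_set Om.
Hypothesis Om_neq0 : Om !=set0.
Hypothesis kappa01 : 0 < kappa < 1.
Hypothesis f_hess : forall x, Om x -> (exists g, is_gradient Om f x g) /\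
    exists H, [/\ is_hessian Om f x H,
      loewner_le ((1 - kappa^-1)%:M) H & loewner_le H ((1 - kappa)%:M)].
Hypothesis f_cont : {within Om, continuous f}.
Variable L : R.
Hypotheses (L0 : 0 <= L)
  (T0L : forall x z, Om x -> Om z -> enorm (T0 Om f x - T0 Om f z) <= L * enorm (x - z)).
Variables (wlo whi : R).
Hypotheses (wlo0 : 0 < wlo) (wlohi : wlo < whi)
  (w_range : forall x, Om x -> wlo <= expR (- f x) <= whi).
Variable Dm : R.
Hypotheses (Dm0 : 0 <= Dm)
  (DmP : forall x y, Om x -> Om y -> sqnorm (y - x) <= Dm /\ sqnorm (y - T0 Om f x) <= Dm).
Variable B : R.
Hypotheses (B0 : 0 < B) (OmB : forall x, Om x -> in_box B x).

Local Notation Z := (argmin_cost Om f).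
Local Notation psi y := (fine (c_transform Om f y)).

Let k0 : 0 < kappa. Proof. by case/andP: kappa01. Qed.

Let whi0 : 0 < whi. Proof. exact: lt_trans wlohi. Qed.

Section plan.
Variables (n m : nat) (X : 'I_n -> E) (Y : 'I_m -> E) (Mx My : R) (G : 'M[R]_(n, m)).
Hypotheses (n0 : (0 < n)%N) (m0 : (0 < m)%N) (Mx0 : 0 < Mx) (My0 : 0 < My).
Hypotheses (XOm : forall i, Om (X i)) (YOm : forall j, Om (Y j))
  (YT0 : forall j, T0 Om f (Z (Y j)) = Y j).
Hypothesis Gopt : optimal_plan X Y Mx My G.

Local Notation a := (Mx / n%:R).
Local Notation b := (My / m%:R).
Local Notation al := (fun i => a * expR (- f (X i))).
Local Notation be := (fun j => b * expR (- psi (Y j))).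

Let a0 : 0 < a. Proof. by rewrite divr_gt0// ltr0n. Qed.
Let b0 : 0 < b. Proof. by rewrite divr_gt0// ltr0n. Qed.

Let G0 i j : 0 <= G i j. Proof. by case: Gopt. Qed.

Let ZOm y : Om (Z y).
Proof. by have [] := argmin_costP Om_compact Om_neq0 f_cont y. Qed.

Definition cell_discrepancy (k : nat) : R :=
  block_discrepancy al be (fun i => cell B k (X i)) (fun j => cell B k (Z (Y j))).

(** The first term pays for mass matched at the finest scale, the sum for mass matched only at a
    coarser level [k], and the last one for unmatched mass. *)
Definition discrepancy_sum (K : nat) : R :=
  4^-1 ^+ K * \sum_i al i + \sum_(k < K) 4^-1 ^+ k * cell_discrepancy k.+1 +
  cell_discrepancy 0.

(** The constant of [slack_upper] times that of the squared cell diameters, plus [3] for the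
    unmatched mass. *)
Definition gap_const : R := (2 * kappa)^-1 * (d%:R * (4 * B) ^+ 2) + 3.

Lemma plan_gap_le K :
  kappa / 2 * (\sum_i \sum_j sqnorm (X i - Z (Y j)) * G i j) +
  \sum_i a * (ahat Mx G i - expR (- f (X i) / 2)) ^+ 2 <=
  gap_const * discrepancy_sum K.
Proof.
pose s i j := cost (X i) (Y j) - f (X i) - psi (Y j).
pose C0 : R := (2 * kappa)^-1 * (d%:R * (4 * B) ^+ 2).
have C00 : 0 <= C0.
  apply: mulr_ge0; first by rewrite invr_ge0 mulr_ge0// ltW.
  by apply: mulr_ge0; [exact: ler0n|exact: sqr_ge0].
have al0 i : 0 <= al i by rewrite mulr_ge0 ?expR_ge0// ltW.
have be0 j : 0 <= be j by rewrite mulr_ge0 ?expR_ge0// ltW.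
have [] := @multiscale_matching R _ _ s al be al0 be0 K _
  (fun k i => cell B k (X i)) (fun k j => cell B k (Z (Y j))) (fun k => C0 * 4^-1 ^+ k).
- by move=> k; rewrite mulr_ge0// exprn_ge0.
- by move=> k i j; apply: cell_nest => //; exact: OmB.
- move=> k i j e.
  have h := slack_upper Om_compact Om_convex Om_neq0 kappa01 f_hess f_cont (XOm i) (YT0 j).
  apply: (le_trans h); rewrite /C0 -[leRHS]mulrA ler_wpM2l//.
    by rewrite invr_ge0 mulr_ge0// ltW.
  by apply: cell_sqnorm => //; exact: OmB.
move=> g [[g0 _ gr gc] gleft gcost].
pose G' : 'M[R]_(n, m) := \matrix_(i, j) g i j.
have rE i : row_mass G' i = \sum_j g i j by apply: eq_bigr => j _; rewrite mxE.
have cE j : col_mass G' j = \sum_i g i j by apply: eq_bigr => i _; rewrite mxE.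
have GE : \sum_i \sum_j G' i j = \sum_i \sum_j g i j.
  by apply: eq_bigr => i _; exact: rE.
have sE : \sum_i \sum_j (cost (X i) (Y j) - f (X i) - psi (Y j)) * G' i j =
    \sum_i \sum_j s i j * g i j.
  by apply: eq_bigr => i _; apply: eq_bigr => j _; rewrite mxE.
have G'0 i j : 0 <= G' i j by rewrite mxE.
have hr i : row_mass G' i <= a * expR (- f (X i)) by rewrite rE.
have hc j : col_mass G' j <= b * expR (- psi (Y j)) by rewrite cE.
have H := optimal_gap_le n0 m0 Mx0 My0 Gopt G'0 hr hc; rewrite GE sE in H.
have lower : kappa / 2 * (\sum_i \sum_j sqnorm (X i - Z (Y j)) * G i j) <=
    \sum_i \sum_j s i j * G i j.
  rewrite mulr_sumr; apply: ler_sum => i _; rewrite mulr_sumr; apply: ler_sum => j _.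
  by rewrite mulrA ler_wpM2r//; exact: slack_lower.
have D00 : 0 <= cell_discrepancy 0 by apply: sumr_ge0 => q _.
have lossX : \sum_i al i - \sum_i \sum_j g i j <= cell_discrepancy 0.
  rewrite -sumrB (partition_big (fun i => cell B 0 (X i)) xpredT)//=.
  by apply: ler_sum => q _; exact: gleft.
have lossXY : \sum_j be j - \sum_i al i <= cell_discrepancy 0.
  rewrite (partition_big (fun i => cell B 0 (X i)) xpredT (F := al))//=.
  rewrite (partition_big (fun j => cell B 0 (Z (Y j))) xpredT (F := be))//= -sumrB.
  by apply: ler_sum => q _; rewrite distrC ler_norm.
have S0 : 0 <= 4^-1 ^+ K * \sum_i al i by rewrite mulr_ge0 ?exprn_ge0 ?sumr_ge0.
have S1 : 0 <= \sum_(k < K) 4^-1 ^+ k * cell_discrepancy k.+1.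
  by apply: sumr_ge0 => k _; rewrite mulr_ge0 ?exprn_ge0//; apply: sumr_ge0 => q _.
have gc2 : \sum_i \sum_j s i j * g i j <=
    C0 * (4^-1 ^+ K * \sum_i al i) + C0 * \sum_(k < K) 4^-1 ^+ k * cell_discrepancy k.+1.
  apply: (le_trans gcost); rewrite mulrA lerD2l mulr_sumr.
  by apply: ler_sum => k _; rewrite mulrA.
rewrite /gap_const /discrepancy_sum -/C0.
move: lower H lossX lossXY S0 S1 gc2 D00 C00.
move: (4^-1 ^+ K * _) (\sum_(k < K) _) (cell_discrepancy 0) (C0) => u v w c.
move: (\sum_i \sum_j _ * g i j) (\sum_i \sum_j g i j) (\sum_i al i) (\sum_j be j) => e1 e2 e3 e4.
move: (\sum_i \sum_j s i j * _) (kappa / 2 * _) (\sum_i a * _) => e5 e6 e7.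
exact: gap_arith.
Qed.

Local Notation q i := (expR (- f (X i) / 2)).

Let q2 i : q i ^+ 2 = expR (- f (X i)).
Proof. by rewrite -expRM_natl; congr expR; field. Qed.

Let row0 i : 0 <= row_mass G i. Proof. by apply: sumr_ge0 => j _. Qed.

(** Jensen for a nonempty row; the hypothesis on [X i] serves the default value of [That] on an
    empty row. *)
Lemma That_sqnorm_le i z M : 0 <= M ->
  (forall j, sqnorm (Y j - z) <= M) -> sqnorm (X i - z) <= M -> sqnorm (That X Y G i - z) <= M.
Proof.
move=> M0 YM XM; rewrite /That; case: ifP => // r0.
have := @sqnorm_mean_le R d 'I_m (G i) Y z (G0 i) r0 => h; apply: (le_trans h).
rewrite ler_pdivrMl// mulr_suml; apply: ler_sum => j _.
by rewrite ler_wpM2l.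
Qed.

(** If [ahat] is at least half of its target [q i], the row mass is comparable with [a] and Jensen
    applies. Otherwise the squared error of [ahat] is at least [wlo / 4] and pays for the trivial
    bound [Dm]. Both cases produce [4 / wlo]. *)
Lemma That_T0_le i : a * sqnorm (That X Y G i - T0 Om f (X i)) <=
  4 / wlo * (\sum_j sqnorm (Y j - T0 Om f (X i)) * G i j + Dm * (a * (ahat Mx G i - q i) ^+ 2)).
Proof.
have [w1 w2] := andP (w_range (XOm i)).
have S0 : 0 <= \sum_j sqnorm (Y j - T0 Om f (X i)) * G i j.
  by apply: sumr_ge0 => j _; rewrite mulr_ge0// sqnorm_ge0.
have q0 : 0 < q i by exact: expR_gt0.
have ah0 : 0 <= ahat Mx G i by exact: sqrtr_ge0.
have ah2 : a * ahat Mx G i ^+ 2 = row_mass G i.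
  rewrite /ahat sqr_sqrtr; last by rewrite divr_ge0 ?row0// ltW.
  by rewrite mulrCA divff ?mulr1// gt_eqF.
have TM : sqnorm (That X Y G i - T0 Om f (X i)) <= Dm.
  by apply: That_sqnorm_le => // [j|]; [have [] := DmP (XOm i) (YOm j)|have [] := DmP (XOm i) (XOm i)].
rewrite [leRHS]mulrAC ler_pdivlMr//.
have [hq|hq] := leP (q i / 2) (ahat Mx G i).
  have rlo : a * wlo <= 4 * row_mass G i.
    rewrite -ah2 mulrCA ler_pM2l//; apply: (le_trans w1); rewrite -q2.
    have : (q i / 2) ^+ 2 <= ahat Mx G i ^+ 2 by rewrite ler_sqr ?nnegrE// divr_ge0// ltW.
    by rewrite expr_div_n; lra.
  have r0 : 0 < row_mass G i.
    by rewrite -(pmulr_rgt0 _ (ltr0n R 4)); apply: lt_le_trans rlo; rewrite mulr_gt0.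
  have hT : row_mass G i * sqnorm (That X Y G i - T0 Om f (X i)) <=
      \sum_j sqnorm (Y j - T0 Om f (X i)) * G i j.
    have h := @sqnorm_mean_le R d 'I_m (G i) Y (T0 Om f (X i)) (G0 i) r0.
    rewrite /That r0 -ler_pdivlMl//; apply: (le_trans h); rewrite ler_pM2l ?invr_gt0//.
    by apply: ler_sum => j _; rewrite mulrC.
  rewrite mulrAC; apply: (@le_trans _ _ (4 * row_mass G i * sqnorm (That X Y G i - T0 Om f (X i)))).
    by rewrite ler_wpM2r// sqnorm_ge0.
  rewrite -mulrA ler_pM2l//; apply: (le_trans hT).
  by rewrite lerDl mulr_ge0// mulr_ge0 ?sqr_ge0// ltW.
have hsq : wlo <= 4 * (ahat Mx G i - q i) ^+ 2.
  apply: (le_trans w1); rewrite -q2.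
  have : (q i / 2) ^+ 2 <= (q i - ahat Mx G i) ^+ 2.
    by rewrite ler_sqr ?nnegrE ?divr_ge0 ?(ltW q0)//; lra.
  by rewrite expr_div_n -(opprB _ (q i)) sqrrN; lra.
apply: (@le_trans _ _ (a * Dm * (4 * (ahat Mx G i - q i) ^+ 2))).
  apply: ler_pM => //; [by rewrite mulr_ge0 ?sqnorm_ge0// ltW|exact: ltW|].
  by rewrite ler_pM2l.
rewrite [leLHS](_ : _ = 4 * (Dm * (a * (ahat Mx G i - q i) ^+ 2))); last by ring.
by rewrite ler_pM2l// lerDr.
Qed.

(** Both quantities are a weight times [expR] of a quarter of a squared displacement. The weights
    are compared by [clip_sqr_dist]; the exponents by polarization, a difference of squared norms
    being the pairing of the difference with the sum of two displacements bounded through [Dm]. *)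
Lemma lambdahat_lambda0_le i :
  (lambdahat X Y Mx wlo whi G i - lambda0 Om f (X i)) ^+ 2 <=
  8 * whi * expR (Dm / 4) ^+ 2 * (ahat Mx G i - q i) ^+ 2 +
  whi ^+ 2 * expR (Dm / 4) ^+ 2 * Dm * sqnorm (That X Y G i - T0 Om f (X i)).
Proof.
have [w1 w2] := andP (w_range (XOm i)).
have q0 : 0 < q i by exact: expR_gt0.
have ah0 : 0 <= ahat Mx G i by exact: sqrtr_ge0.
have hc : (clip wlo whi (ahat Mx G i ^+ 2) - q i ^+ 2) ^+ 2 <= 4 * whi * (ahat Mx G i - q i) ^+ 2.
  by apply: clip_sqr_dist => //; rewrite q2 w1.
pose u := sqnorm (X i - That X Y G i) / 4; pose v := sqnorm (X i - T0 Om f (X i)) / 4.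
have uM : sqnorm (X i - That X Y G i) <= Dm.
  rewrite sqnormBC; apply: That_sqnorm_le => // [j|].
    by have [] := DmP (XOm i) (YOm j).
  by rewrite subrr /sqnorm dotv0l.
have vM : sqnorm (X i - T0 Om f (X i)) <= Dm by have [] := DmP (XOm i) (XOm i).
have huv : (u - v) ^+ 2 <= Dm / 4 * sqnorm (That X Y G i - T0 Om f (X i)).
  pose p := X i - That X Y G i; pose r := X i - T0 Om f (X i).
  have -> : That X Y G i - T0 Om f (X i) = r - p.
    by rewrite /p /r; apply/rowP => j; rewrite !mxE; ring.
  have e : u - v = dotv (r - p) (- (p + r)) / 4.
    have E2 (p' r' : E) : sqnorm p' / 4 - sqnorm r' / 4 = dotv (r' - p') (- (p' + r')) / 4.
      by rewrite /sqnorm !dotvE (dotvC r' p'); lra.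
    exact: E2.
  have := dotv_norm_le (r - p) (- (p + r)); rewrite enormN => cs.
  rewrite e expr_div_n -[dotv _ _ ^+ 2]real_normK ?num_real//.
  apply: (@le_trans _ _ ((enorm (r - p) * enorm (p + r)) ^+ 2 / 4 ^+ 2)).
    rewrite ler_pM2r ?invr_gt0 ?exprn_gt0// ler_sqr ?nnegrE// mulr_ge0//; exact: enorm_ge0.
  rewrite exprMn !enorm_sqr.
  have := sqnormD_le p r; rewrite -/p in uM; rewrite -/r in vM => h.
  have h4 : sqnorm (p + r) <= 4 * Dm by lra.
  have := ler_wpM2l (sqnorm_ge0 (r - p)) h4; lra.
have he : (expR u - expR v) ^+ 2 <= expR (Dm / 4) ^+ 2 * (Dm / 4 * sqnorm (That X Y G i - T0 Om f (X i))).
  have := @expR_lip R (Dm / 4) u v; rewrite /u /v !ler_pM2r ?invr_gt0// -/u -/v => /(_ uM vM) h.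
  rewrite -[leLHS]real_normK ?num_real//.
  apply: (@le_trans _ _ ((expR (Dm / 4) * `|u - v|) ^+ 2)).
    by rewrite ler_sqr ?nnegrE// mulr_ge0// expR_ge0.
  by rewrite exprMn real_normK ?num_real// ler_pM2l// exprn_gt0// expR_gt0.
have -> : lambda0 Om f (X i) = q i ^+ 2 * expR v.
  rewrite /lambda0 expRD -q2 /v (_ : X i - T0 Om f (X i) = gradient Om f (X i))//.
  by rewrite /T0 opprB addrC subrK.
rewrite /lambdahat -/u.
have eu : expR u ^+ 2 <= expR (Dm / 4) ^+ 2.
  by rewrite ler_sqr ?nnegrE ?expR_ge0// ler_expR ler_pM2r ?invr_gt0.
rewrite -q2 in w1 w2.
move: (clip _ _ _) (q i ^+ 2) (ahat Mx G i - q i) hc w1 w2 => c r e hc w1 w2.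
move: (sqnorm (That X Y G i - _)) he => t he.
have r2 : r ^+ 2 <= whi ^+ 2 by rewrite ler_sqr ?nnegrE ?(ltW whi0)// (le_trans _ w1)// ltW.
rewrite (_ : c * expR u - r * expR v = (c - r) * expR u + r * (expR u - expR v)); last by ring.
apply: (@le_trans _ _ (2 * ((c - r) ^+ 2 * expR u ^+ 2) + 2 * (r ^+ 2 * (expR u - expR v) ^+ 2))).
  have := sqr_ge0 ((c - r) * expR u - r * (expR u - expR v)).
  by rewrite -!exprMn; move: ((c - r) * _) (r * _) => A A'; rewrite sqrrB sqrrD; lra.
have h1 := ler_pM (sqr_ge0 (c - r)) (sqr_ge0 (expR u)) hc eu.
have h2 := ler_pM (sqr_ge0 r) (sqr_ge0 (expR u - expR v)) r2 he.
have t0 : 0 <= whi ^+ 2 * (expR (Dm / 4) ^+ 2 * (Dm / 4 * t)).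
  by apply: le_trans h2; rewrite mulr_ge0 ?sqr_ge0.
by rewrite (mulrA (whi ^+ 2)) in h2 t0; lra.
Qed.

Definition That_const : R := 4 / wlo * ((2 * L ^+ 2 / kappa) + Dm) * gap_const.

Lemma sum_That_T0_le K :
  \sum_i a * sqnorm (That X Y G i - T0 Om f (X i)) <= That_const * discrepancy_sum K.
Proof.
have gap := plan_gap_le K.
set S := \sum_i \sum_j sqnorm (X i - Z (Y j)) * G i j in gap.
set V := \sum_i a * _ in gap.
have S0 : 0 <= S.
  by apply: sumr_ge0 => i _; apply: sumr_ge0 => j _; rewrite mulr_ge0// sqnorm_ge0.
have V0 : 0 <= V by apply: sumr_ge0 => i _; rewrite mulr_ge0 ?sqr_ge0// ltW.
apply: (@le_trans _ _ (4 / wlo * (L ^+ 2 * S + Dm * V))).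
  rewrite mulrDr !mulr_sumr -big_split/=; apply: ler_sum => i _.
  apply: (le_trans (That_T0_le i)); rewrite mulrDr lerD// ler_wpM2l ?divr_ge0 ?(ltW wlo0)//.
  rewrite mulr_sumr; apply: ler_sum => j _; rewrite mulrA ler_wpM2r//.
  (* Since [Y j] is [T0] at [Z (Y j)], the Lipschitz bound turns its distance to [T0 (X i)] into the
     distance from [Z (Y j)] to [X i], which the gap controls. *)
  have := T0L (ZOm (Y j)) (XOm i); rewrite YT0 => h.
  rewrite -!enorm_sqr -exprMn ler_sqr ?nnegrE ?mulr_ge0 ?enorm_ge0//.
  by rewrite (enormBC (X i)).
rewrite /That_const -[leRHS]mulrA -[leRHS]mulrA ler_pM2l ?divr_gt0//.
set g := _ * discrepancy_sum K in gap *.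
have k2 : 0 < kappa / 2 by rewrite divr_gt0.
have Sg : S <= 2 / kappa * g.
  rewrite -(ler_pM2l k2) mulrA (_ : kappa / 2 * (2 / kappa) = 1) ?mul1r; first lra.
  by field; rewrite gt_eqF.
have Vg : V <= g by have := mulr_ge0 (ltW k2) S0; lra.
rewrite mulrDl lerD//; last by rewrite ler_wpM2l.
rewrite [leRHS](_ : _ = L ^+ 2 * (2 / kappa * g)); last by ring.
by rewrite ler_wpM2l// sqr_ge0.
Qed.

Definition lambda_const : R := 8 * whi * expR (Dm / 4) ^+ 2 * gap_const +
  whi ^+ 2 * expR (Dm / 4) ^+ 2 * Dm * That_const.

Lemma sum_lambdahat_lambda0_le K :
  \sum_i a * (lambdahat X Y Mx wlo whi G i - lambda0 Om f (X i)) ^+ 2 <=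
  lambda_const * discrepancy_sum K.
Proof.
have gap := plan_gap_le K; have hT := sum_That_T0_le K.
set S := \sum_i \sum_j sqnorm (X i - Z (Y j)) * G i j in gap.
have S0 : 0 <= kappa / 2 * S.
  apply: mulr_ge0; first by rewrite divr_ge0// ltW.
  by apply: sumr_ge0 => i _; apply: sumr_ge0 => j _; rewrite mulr_ge0// sqnorm_ge0.
set V := \sum_i a * _ in gap.
pose c1 := 8 * whi * expR (Dm / 4) ^+ 2.
pose c2 := whi ^+ 2 * expR (Dm / 4) ^+ 2 * Dm.
have c10 : 0 <= c1 by rewrite /c1 mulr_ge0 ?sqr_ge0// mulr_ge0// ltW.
have c20 : 0 <= c2 by rewrite /c2 mulr_ge0// mulr_ge0 ?sqr_ge0.
apply: (@le_trans _ _ (c1 * V + c2 * \sum_i a * sqnorm (That X Y G i - T0 Om f (X i)))).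
  rewrite !mulr_sumr -big_split/=; apply: ler_sum => i _.
  rewrite (mulrCA c1) (mulrCA c2) -mulrDr ler_pM2l//; exact: lambdahat_lambda0_le.
rewrite /lambda_const -/c1 -/c2 mulrDl -[c1 * _ * _]mulrA -[c2 * _ * _]mulrA.
by rewrite lerD// ler_wpM2l//; lra.
Qed.

End plan.
End sample_bounds.

(** * Empirical means *)

Section integral_comparison.
Local Open Scope ereal_scope.
Context d (T : measurableType d) (R : realType) (mu : {measure set T -> \bar R}).

(* The integral of a nonnegative function is a supremum over simple functions,
   so monotonicity needs no measurability. *)
Lemma ge0_le_integral_gen (D : set T) (f g : T -> \bar R) :
  (forall x, D x -> 0 <= f x) -> (forall x, D x -> f x <= g x) ->
  \int[mu]_(x in D) f x <= \int[mu]_(x in D) g x.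
Proof.
move=> f0 fg; rewrite !ge0_integralE//; last by move=> x Dx; exact: le_trans (f0 x Dx) (fg x Dx).
apply: le_ereal_sup => _ [h hf <-]; exists h => // x.
apply: (le_trans (hf x)); rewrite !patchE; case: ifPn => //.
by rewrite inE; exact: fg.
Qed.

(** Only the upper function is assumed measurable, as the risk will be the lower one. Raising [g] to
    infinity on the null set keeps its integral and makes the comparison hold everywhere. *)
Lemma ge0_le_integral_negligible (D N : set T) (f g : T -> \bar R) :
  measurable D -> mu.-negligible N -> (forall x, D x -> 0 <= f x) ->
  (forall x, D x -> 0 <= g x) -> measurable_fun D g ->
  (forall x, D x -> ~ N x -> f x <= g x) ->
  \int[mu]_(x in D) f x <= \int[mu]_(x in D) g x.
Proof.
move=> mD [N' [mN' N'0 NN']] f0 g0 mg fg.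
pose g' x := if x \in N' then +oo else g x.
have -> : \int[mu]_(x in D) g x = \int[mu]_(x in D) g' x.
  apply: ge0_ae_eq_integral => //.
  - apply: measurable_fun_if => //.
    + apply: (@measurable_fun_bool _ _ _ _ true).
      rewrite (_ : _ @^-1` _ = N'); first exact: measurableI.
      by apply/seteqP; split => x /= h; [exact: set_mem h|exact: mem_set].
    + by apply: measurable_funS mg => // x [].
  - by move=> x Dx; rewrite /g'; case: ifP => // _; exact: g0.
  - exists N'; split => // x /= /not_implyP[Dx gx].
    apply: contrapT => N'x; apply: gx; rewrite /g' ifF//.
    by apply/negbTE; rewrite notin_setE.
apply: ge0_le_integral_gen => // x Dx; rewrite /g'; case: ifPn => [_|]; first exact: leey.
by rewrite notin_setE => N'x; apply: fg => // /NN'.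
Qed.

End integral_comparison.

Section bounded_sums.
Context (R : realType) d (T : measurableType d).
Variables (m : {finite_measure set T -> \bar R}) (A : set T).
Hypothesis mA : measurable A.

Lemma bounded_mfun_sum (I : Type) (r : seq I) (F : I -> T -> R) :
  (forall i, bounded_mfun A (F i)) -> bounded_mfun A (fun x => \sum_(i <- r) F i x).
Proof.
move=> bF; elim: r => [|i r IH].
  by under eq_fun do rewrite big_nil; exact: bounded_mfun_cst.
by under eq_fun do rewrite big_cons; exact: bounded_mfunD.
Qed.

Lemma Rintegral_sum (I : Type) (r : seq I) (F : I -> T -> R) :
  (forall i, bounded_mfun A (F i)) ->
  \int[m]_(x in A) (\sum_(i <- r) F i x) = \sum_(i <- r) \int[m]_(x in A) F i x.
Proof.
move=> bF; elim: r => [|i r IH].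
  rewrite big_nil -[RHS](@mul0r _ (fine (m A))) -Rintegral_cst//.
  by apply: eq_Rintegral => x _; rewrite big_nil.
rewrite big_cons -IH -RintegralD//; try exact: bounded_mfun_integrable.
  by apply: eq_Rintegral => x _; rewrite big_cons.
by apply: bounded_mfun_integrable => //; exact: bounded_mfun_sum.
Qed.

End bounded_sums.

(** * Variance of empirical means under pairwise independence *)

Section independence.
Context (R : realType) dW (W : measurableType dW) (P : probability W R).
Context dT (T : measurableType dT).

Definition indep_pair (U V : {RV P >-> T}) := forall A B, measurable A -> measurable B ->
  P (U @^-1` A `&` V @^-1` B) = (P (U @^-1` A) * P (V @^-1` B))%E.

Section pair.
Variables (U V : {RV P >-> T}).
Hypothesis UV : indep_pair U V.

Let pairUV (w : W) : T * T := (U w, V w).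

Let mpair : measurable_fun setT pairUV.
Proof. by apply/measurable_fun_pairP; split; exact: measurable_funPT. Qed.

Let pairRV : {RV P >-> (T * T)%type} := HB.pack pairUV (isMeasurableFun.Build _ _ _ _ _ mpair).

Lemma indep_pair_law (C : set (T * T)) : measurable C ->
  P [set w | C (U w, V w)] = (distribution P U \x distribution P V)%E C.
Proof.
by move=> mC; rewrite (@product_measure_unique _ _ _ _ _ _ _ (distribution P pairRV)).
Qed.

Lemma indep_expectation (f g : T -> R) :
  measurable_fun setT f -> measurable_fun setT g ->
  (forall x, 0 <= f x) -> (forall x, 0 <= g x) ->
  (\int[P]_w (f (U w) * g (V w))%:E =
   (\int[P]_w (f (U w))%:E) * (\int[P]_w (g (V w))%:E))%E.
Proof.
move=> mf mg f0 g0; pose h (z : T * T) := (f z.1 * g z.2)%:E.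
have mh : measurable_fun setT h.
  apply/measurable_EFinP; apply: measurable_funM.
    by apply: measurableT_comp => //; exact: measurable_fst.
  by apply: measurableT_comp => //; exact: measurable_snd.
have h0 z : (0 <= h z)%E by rewrite lee_fin mulr_ge0.
have push (Q : {RV P >-> T}) (k : T -> R) :
    measurable_fun setT k -> (forall x, 0 <= k x) ->
    (\int[P]_w (k (Q w))%:E = \int[distribution P Q]_x (k x)%:E)%E.
  move=> mk k0; rewrite ge0_integral_pushforward//=.
  - by apply/measurable_EFinP.
  - by move=> x _; rewrite lee_fin.
transitivity (\int[distribution P pairRV]_z h z)%E.
  by rewrite ge0_integral_pushforward.
transitivity (\int[distribution P U \x distribution P V]_z h z)%E.
  apply: eq_measure_integral => C mC _; exact: indep_pair_law.
rewrite fubini_tonelli1// /fubini_F /h/=.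
rewrite !push//.
have inner x : (\int[distribution P V]_y (f x * g y)%:E =
    (f x)%:E * \int[distribution P V]_y (g y)%:E)%E.
  under eq_integral do rewrite EFinM.
  rewrite ge0_integralZl ?lee_fin//; first exact/measurable_EFinP.
  by move=> y _; rewrite lee_fin.
under eq_integral do rewrite inner.
rewrite ge0_integralZr//.
- exact/measurable_EFinP.
- by move=> x _; rewrite lee_fin.
- by apply: integral_ge0 => x _; rewrite lee_fin.
Qed.

End pair.

Lemma bounded_mfun_RV (U : {RV P >-> T}) (f : T -> R) (M : R) :
  measurable_fun setT f -> (forall x, 0 <= f x <= M) ->
  bounded_mfun setT (fun w => f (U w)).
Proof.
move=> mf fM; split; first exact: measurableT_comp.
exists M => [|w _]; first by have /andP[h1 h2] := fM point; exact: le_trans h2.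
by have /andP[h1 h2] := fM (U w); rewrite ger0_norm.
Qed.

Local Notation Ex g := (Rintegral P setT g).

Section empirical_mean.
Variables (n : nat) (X : nat -> {RV P >-> T}).
Hypothesis n0 : (0 < n)%N.
Hypothesis X_indep : forall i k, i != k -> indep_pair (X i) (X k).
Hypothesis X_law : forall i k A, measurable A -> P (X i @^-1` A) = P (X k @^-1` A).

Definition empirical_mean (f : T -> R) (w : W) : R := n%:R^-1 * \sum_(i < n) f (X i w).

Section one_function.
Variables (f : T -> R) (M : R).
Hypotheses (mf : measurable_fun setT f) (fM : forall x, 0 <= f x <= M).

Let bf i : bounded_mfun setT (fun w => f (X i w)).
Proof. exact: bounded_mfun_RV. Qed.

Lemma Rintegral_same_law i k (g : T -> R) : measurable_fun setT g -> (forall x, 0 <= g x) ->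
  Ex (fun w => g (X i w)) = Ex (fun w => g (X k w)).
Proof.
move=> mg g0; rewrite /Rintegral; congr fine.
have push (Q : {RV P >-> T}) :
    (\int[P]_w (g (Q w))%:E = \int[distribution P Q]_x (g x)%:E)%E.
  rewrite ge0_integral_pushforward//=.
  - by apply/measurable_EFinP.
  - by move=> x _; rewrite lee_fin.
rewrite !push; apply: eq_measure_integral => A mA _; exact: X_law.
Qed.

Let e := Ex (fun w => f (X 0 w)).

Let EX i : Ex (fun w => f (X i w)) = e.
Proof. by apply: Rintegral_same_law => // x; case/andP: (fM x). Qed.

(** The off-diagonal covariances vanish by pairwise independence, and each diagonal variance is at
    most the second moment. *)
Lemma empirical_mean_variance :
  Ex (fun w => (empirical_mean f w - e) ^+ 2) <= n%:R^-1 * Ex (fun w => f (X 0 w) ^+ 2).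
Proof.
pose xi i w := f (X i w) - e.
have bxi i : bounded_mfun setT (xi i).
  by apply: bounded_mfunD; [exact: bf|exact: bounded_mfun_cst].
have bP g : bounded_mfun setT g -> P.-integrable setT (EFin \o g).
  by move=> bg; exact: bounded_mfun_integrable.
have P1 : fine (P [set: W]) = 1 by rewrite probability_setT.
have EB g c : bounded_mfun setT g -> Ex (fun w => g w + c) = Ex g + c.
  move=> bg; rewrite RintegralD//; [|exact: bP|exact/bP/bounded_mfun_cst].
  by rewrite (Rintegral_cst _ measurableT) P1 mulr1.
have Exi i : Ex (xi i) = 0 by rewrite EB// EX subrr.
have Exk i k : i != k -> Ex (fun w => xi i w * xi k w) = 0.
  move=> ik.
  (* Written this way, the only product of two samples is one of nonnegative functions, as
     [indep_expectation] requires. *)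
  have -> : (fun w => xi i w * xi k w) =
      (fun w => (f (X i w) * f (X k w) + - e * f (X i w)) + - e * xi k w).
    by apply/funext => w; rewrite /xi; ring.
  have f0 x : 0 <= f x by case/andP: (fM x).
  have b1 := bounded_mfunM (bf i) (bf k).
  have b2 := bounded_mfunM (bounded_mfun_cst setT (- e)) (bf i).
  have b3 := bounded_mfunM (bounded_mfun_cst setT (- e)) (bxi k).
  rewrite RintegralD//; [|exact/bP/bounded_mfunD|exact/bP].
  rewrite RintegralD//; [|exact/bP|exact/bP].
  rewrite !RintegralZl//; [|exact/bP|exact/bP]; rewrite Exi mulr0 addr0 EX.
  rewrite [X in X + _](_ : _ = e * e); first by rewrite mulNr subrr.
  rewrite -{1}(EX i) -(EX k) /Rintegral -fineM; last 2 first.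
  - by have := integrable_fin_num measurableT (bP _ (bf i)).
  - by have := integrable_fin_num measurableT (bP _ (bf k)).
  by congr fine; apply: indep_expectation => //; exact: X_indep.
have E2 i : Ex (fun w => xi i w * xi i w) <= Ex (fun w => f (X 0 w) ^+ 2).
  have -> : Ex (fun w => f (X 0 w) ^+ 2) = Ex (fun w => f (X i w) ^+ 2).
    apply: (Rintegral_same_law _ _ (g := fun x => f x ^+ 2)) => [|x]; last exact: sqr_ge0.
    exact: measurable_funX.
  have b1 := bounded_mfunM (bf i) (bf i).
  have b2 := bounded_mfunM (bounded_mfun_cst setT (- e)) (bf i).
  have b3 := bounded_mfunM (bounded_mfun_cst setT (- e)) (bxi i).
  have -> : (fun w => xi i w * xi i w) =
      (fun w => (f (X i w) * f (X i w) + - e * f (X i w)) + - e * xi i w).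
    by apply/funext => w; rewrite /xi; ring.
  rewrite RintegralD//; [|exact/bP/bounded_mfunD|exact/bP].
  rewrite RintegralD//; [|exact/bP|exact/bP].
  rewrite !RintegralZl//; [|exact/bP|exact/bP]; rewrite Exi mulr0 addr0 EX.
  by rewrite mulNr gerDl oppr_le0 -expr2 sqr_ge0.
have -> : (fun w => (empirical_mean f w - e) ^+ 2) =
    (fun w => n%:R^-1 ^+ 2 * \sum_(i < n) \sum_(k < n) xi i w * xi k w).
  apply/funext => w.
  have -> : empirical_mean f w - e = n%:R^-1 * \sum_(i < n) xi i w.
    rewrite /xi sumrB sumr_const card_ord -[X in _ = _ * (_ - X)]mulr_natl mulrBr.
    by rewrite mulKf// pnatr_eq0 -lt0n.
  rewrite exprMn; congr (_ * _); rewrite expr2 mulr_suml; apply: eq_bigr => i _.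
  by rewrite mulr_sumr.
have bxx i k : bounded_mfun setT (fun w => xi i w * xi k w) by exact: bounded_mfunM.
rewrite RintegralZl//; last first.
  by apply: bP; apply: bounded_mfun_sum => i; exact: bounded_mfun_sum.
rewrite Rintegral_sum//; last by move=> i; exact: bounded_mfun_sum.
rewrite expr2 -mulrA ler_pM2l ?invr_gt0 ?ltr0n// mulrC ler_pdivrMr ?ltr0n//.
apply: (@le_trans _ _ (\sum_(i < n) Ex (fun w => f (X 0 w) ^+ 2))); last first.
  by rewrite sumr_const card_ord mulr_natr.
apply: ler_sum => i _; rewrite Rintegral_sum// (bigD1 i)//= big1 ?addr0//.
by move=> k ki; apply: Exk; rewrite eq_sym.
Qed.

End one_function.

Lemma bounded_mfun_empirical_mean (f : T -> R) (M : R) :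
  measurable_fun setT f -> (forall x, 0 <= f x <= M) ->
  bounded_mfun setT (empirical_mean f).
Proof.
move=> mf fM; apply: bounded_mfunM; first exact: bounded_mfun_cst.
by apply: bounded_mfun_sum => i; exact: bounded_mfun_RV.
Qed.

(** The bound on the sum of the squares [f q x ^+ 2] makes the summed variance at most [M ^+ 2 / n],
    independently of the number of functions; that number enters only through the passage from
    squares to absolute values. *)
Lemma sum_empirical_deviation (Q : finType) (f : Q -> T -> R) (M : R) (N : nat) :
  (forall q, measurable_fun setT (f q)) -> (forall q x, 0 <= f q x <= M) ->
  (forall x, \sum_q f q x ^+ 2 <= M ^+ 2) -> (0 < N)%N -> (#|Q| <= N)%N ->
  \sum_q Ex (fun w => `|empirical_mean (f q) w - Ex (fun w => f q (X 0 w))|) <=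
  (M ^+ 2 + 1) / 2 * Num.sqrt (N%:R / n%:R).
Proof.
move=> mf fM fsq N0 QN.
have bP g : bounded_mfun setT g -> P.-integrable setT (EFin \o g).
  by move=> bg; exact: bounded_mfun_integrable.
have n0' : 0 < n%:R :> R by rewrite ltr0n.
have N0' : 0 < N%:R :> R by rewrite ltr0n.
have P1 : fine (P [set: W]) = 1 by rewrite probability_setT.
pose r : R := Num.sqrt (N%:R / n%:R).
have r0 : 0 < r by rewrite sqrtr_gt0 divr_gt0.
have r2 : r ^+ 2 = N%:R / n%:R by rewrite sqr_sqrtr// divr_ge0// ltW.
pose e q := Ex (fun w => f q (X 0 w)).
pose S q w := empirical_mean (f q) w - e q.
have bS q : bounded_mfun setT (S q).
  apply: bounded_mfunD; last exact: bounded_mfun_cst.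
  exact: (bounded_mfun_empirical_mean (mf q) (fM q)).
have babs q : bounded_mfun setT (fun w => `|S q w|).
  have [mS [C C0 SC]] := bS q; split; first exact: measurableT_comp.
  by exists C => // x xT; rewrite normr_id SC.
(* This [t] balances the two AM-GM terms: [N * t] and the reciprocal of [n * t] are both [r]. *)
pose t := r / N%:R; have t0 : 0 < t by rewrite divr_gt0.
have key q : Ex (fun w => `|S q w|) <= (t^-1 * (n%:R^-1 * Ex (fun w => f q (X 0 w) ^+ 2)) + t) / 2.
  have bsq := bounded_mfunM (bS q) (bS q).
  have h := empirical_mean_variance (mf q) (fM q).
  apply: (@le_trans _ _ (Ex (fun w => (2 * t)^-1 * (S q w * S q w) + t / 2))).
    apply: le_Rintegral => //; [exact/bP| |].
      apply/bP/bounded_mfunD; last exact: bounded_mfun_cst.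
      by apply: bounded_mfunM => //; exact: bounded_mfun_cst.
    (* AM-GM: [2 t |S| <= S^2 + t^2] *)
    move=> w _; have := sqr_ge0 (`|S q w| - t); rewrite sqrrB real_normK ?num_real//.
    move=> hh; have t20 : 0 < 2 * t by rewrite pmulr_rgt0.
    rewrite -(ler_pM2l t20).
    rewrite (_ : 2 * t * ((2 * t)^-1 * (S q w * S q w) + t / 2) = S q w ^+ 2 + t ^+ 2); last first.
      by field; rewrite gt_eqF.
    move: hh; rewrite -[_ *+ 2]mulr_natl; set z := `|_|; set y := _ ^+ 2; set v := t ^+ 2.
    by move: y v => y v; rewrite mulrAC -[2 * _ * _]mulrA; lra.
  rewrite RintegralD//; [|apply/bP/bounded_mfunM => //; exact: bounded_mfun_cst|exact/bP/bounded_mfun_cst].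
  rewrite (Rintegral_cst _ measurableT) P1 mulr1 RintegralZl//; last exact/bP.
  rewrite [leRHS]mulrDl lerD2r [leRHS]mulrC [in leLHS]invfM -[leLHS]mulrA.
  by rewrite !ler_pM2l ?invr_gt0.
apply: (le_trans (ler_sum _ (fun q _ => key q))).
rewrite -mulr_suml mulrAC ler_pM2r ?invr_gt0// big_split/= sumr_const.
rewrite -mulr_sumr -mulr_sumr mulrDl mul1r lerD//.
  have -> : M ^+ 2 * Num.sqrt (N%:R / n%:R) = t^-1 * (n%:R^-1 * M ^+ 2).
    rewrite -/r /t invfM invrK; apply: (mulfI (lt0r_neq0 r0)).
    rewrite mulrCA -expr2 r2; field.
    by rewrite !gt_eqF.
  rewrite ler_pM2l ?invr_gt0// ler_pM2l ?invr_gt0//.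
  rewrite -Rintegral_sum//; last first.
    move=> q; apply: (@bounded_mfun_RV (X 0) (fun x => f q x ^+ 2) (M ^+ 2)).
      exact: measurable_funX.
    by move=> x; rewrite sqr_ge0/=; have /andP[a b] := fM q x; rewrite ler_sqr ?nnegrE// (le_trans a).
  apply: (@le_trans _ _ (Ex (fun=> M ^+ 2))); last first.
    by rewrite (Rintegral_cst _ measurableT) P1 mulr1.
  apply: le_Rintegral => //.
    apply: bP; apply: bounded_mfun_sum => q.
    apply: (@bounded_mfun_RV (X 0) (fun x => f q x ^+ 2) (M ^+ 2)).
      exact: measurable_funX.
    by move=> x; rewrite sqr_ge0/=; have /andP[a b] := fM q x; rewrite ler_sqr ?nnegrE// (le_trans a).
  exact/bP/bounded_mfun_cst.
rewrite -/r -[t *+ _]mulr_natr [t * _]mulrAC ler_pdivrMr//.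
by rewrite ler_pM2l// ler_nat.
Qed.

End empirical_mean.
End independence.

Section mutual_independence.
Context (R : realType) dW (W : measurableType dW) (P : probability W R).
Context dT (T : measurableType dT).

Lemma mutually_independentl (X Y : nat -> {RV P >-> T}) :
  mutually_independent (joint_samples X Y) -> mutually_independent X.
Proof.
move=> H J A uJ mA.
have := H [seq inl i | i <- J] (fun i => if i is inl k then A k else setT).
rewrite map_inj_uniq//; last by move=> i k [].
move=> /(_ uJ) /(_ _)/wrap[|]; first by case.
rewrite big_map/= => <-; congr (P _).
apply/seteqP; split => w /= h i iJ.
  by move/mapP : iJ => [k kJ ->]; exact: h.
by have := h (inl i); apply => /=; exact: map_f.
Qed.

Lemma mutually_independentr (X Y : nat -> {RV P >-> T}) :
  mutually_independent (joint_samples X Y) -> mutually_independent Y.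
Proof.
move=> H J A uJ mA.
have := H [seq inr i | i <- J] (fun i => if i is inr k then A k else setT).
rewrite map_inj_uniq//; last by move=> i k [].
move=> /(_ uJ) /(_ _)/wrap[|]; first by case.
rewrite big_map/= => <-; congr (P _).
apply/seteqP; split => w /= h i iJ.
  by move/mapP : iJ => [k kJ ->]; exact: h.
by have := h (inr i); apply => /=; exact: map_f.
Qed.

Variable X : nat -> {RV P >-> T}.
Hypothesis X_ind : mutually_independent X.

Lemma mutually_independent_pair i k : i != k -> indep_pair (X i) (X k).
Proof.
move=> ik A B mA mB.
have := X_ind (J := [:: i; k]) (A := fun l => if l == i then A else B).
rewrite /= inE ik => /(_ isT) /(_ _)/wrap[l|]; first by case: ifP.
rewrite !big_cons big_nil eqxx eq_sym (negbTE ik) mule1 => <-; congr (P _).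
apply/seteqP; split => w /=.
  by move=> [hi hk] l /=; rewrite !inE => /orP[/eqP->|/eqP->]; rewrite ?eqxx// eq_sym (negbTE ik).
move=> h; split; first by have := h i; rewrite /= !inE eqxx; apply.
by have := h k; rewrite /= !inE eqxx orbT eq_sym (negbTE ik); apply.
Qed.

Lemma independent_avoid n (A : set T) (p : R) : measurable A ->
  (forall i, P (X i @^-1` A) = p%:E) ->
  P [set w | forall i, (i < n)%N -> ~ A (X i w)] = ((1 - p) ^+ n)%:E.
Proof.
move=> mA pA.
have := X_ind (J := iota 0 n) (A := fun=> ~` A) (iota_uniq 0 n) (fun=> measurableC mA).
have -> : \bigcap_(i in [set` iota 0 n]) X i @^-1` (~` A) =
    [set w | forall i, (i < n)%N -> ~ A (X i w)].
  apply/seteqP; split => w /= h i; first by move=> hi; apply: h => /=; rewrite mem_iota.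
  by rewrite /= mem_iota => hi; exact: h.
move=> ->; rewrite (eq_bigr (fun=> (1 - p)%:E)) => [|i _].
  rewrite prodEFin -[in RHS](size_iota 0 n); congr EFin.
  by elim: (iota 0 n) => [|i s IH]; rewrite ?big_nil// big_cons IH exprS.
rewrite preimage_setC probability_setC ?pA//.
by have := measurable_funPT (X i) measurableT _ mA; rewrite setTI.
Qed.

End mutual_independence.

(** * Null sets and null events of one sample *)

Section sample.
Context (R : realType) (d : nat) (d0 : (0 < d)%N).
Context dW (W : measurableType dW) (P : probability W R).
Local Notation E := 'rV[R]_d.
Local Notation leb := (lebesgue_rV R d).

Lemma point_null (x : E) : leb [set x] = 0%E.
Proof.
pose w : E := \row_j (j == Ordinal d0)%:R.
have w0 : w != 0.
  apply/eqP => /rowP/(_ (Ordinal d0)); rewrite !mxE eqxx => /eqP.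
  by rewrite oner_eq0.
apply/eqP; rewrite -measure_le0 -(hyperplane_null (dotv x w) w0).
apply: le_measure; rewrite ?inE.
- exact: closed_mx_measurable (@accessible_closed_set1 E (hausdorff_accessible (@norm_hausdorff R E)) x).
- rewrite (_ : [set _ | _] = (fun x : E => dotv x w) @^-1` [set dotv x w])//.
  rewrite -[X in measurable X]setTI.
  have: measurable_fun [set: E] (fun x : E => dotv x w); last by apply.
  have := within_continuous_measurable (@measurableT _ E); apply.
  exact/continuous_subspaceT/continuous_dotvl.
- by move=> y /= ->.
Qed.

Variables (Om : set E) (mu : {finite_measure set E -> \bar R}) (X : nat -> {RV P >-> E}).
Hypotheses (mOm : measurable Om) (mu_Om : mu (~` Om) = 0%E) (M0 : 0 < mass Om mu).
Hypothesis X_law : forall i A, measurable A -> distribution P (X i) A = normalized Om mu A.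
Hypothesis X_ind : mutually_independent X.
Hypothesis mu_ac : forall A, measurable A -> leb A = 0%E -> mu A = 0%E.

Lemma preimage_RV_measurable i A : measurable A -> measurable (X i @^-1` A).
Proof. by move=> mA; have := measurable_funPT (X i) measurableT _ mA; rewrite setTI. Qed.

Lemma law_measure i A : measurable A ->
  mu A = ((mass Om mu)%:E * P (X i @^-1` A))%E.
Proof.
move=> mA; have := X_law i mA; rewrite /distribution/= /pushforward => ->.
by rewrite /normalized muleA -EFinM divff ?gt_eqF// mul1e.
Qed.

Lemma law_negligible i N : mu.-negligible N -> P.-negligible [set w | N (X i w)].
Proof.
move=> [A [mA A0 NA]]; exists (X i @^-1` A); split.
- exact: preimage_RV_measurable.
- have := X_law i mA; rewrite /distribution/= /pushforward => ->.
  by rewrite /normalized A0 mule0.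
- by move=> w /= Nw; exact: NA.
Qed.

Lemma sample_in i : P.-negligible [set w | ~ Om (X i w)].
Proof. by apply: (law_negligible i (N := ~` Om)); exists (~` Om); split => //; exact: measurableC. Qed.

Lemma law_integral i (g : E -> R) : measurable_fun setT g -> (forall x, 0 <= g x) ->
  (\int[mu]_x (g x)%:E = (mass Om mu)%:E * \int[P]_w (g (X i w))%:E)%E.
Proof.
move=> mg g0.
have push : (\int[P]_w (g (X i w))%:E = \int[distribution P (X i)]_x (g x)%:E)%E.
  rewrite ge0_integral_pushforward//=.
  - by apply/measurable_EFinP.
  - by move=> x _; rewrite lee_fin.
rewrite push -(@ge0_integral_mscale _ _ _ _ _ measurableT (NngNum (ltW M0)))//; first last.
- by move=> x _; rewrite lee_fin.
- exact/measurable_EFinP.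
apply: eq_measure_integral => A mA _.
by rewrite /mscale/= (law_measure i).
Qed.

Lemma diagonal_measurable : measurable [set z : E * E | z.1 = z.2].
Proof.
rewrite (_ : [set _ | _] = \bigcap_(i in [set: 'I_d])
    ((fun z : E * E => z.1 ord0 i - z.2 ord0 i) @^-1` [set 0])).
  apply: fin_bigcap_measurable => [|i _]; first exact: finite_finset.
  rewrite -[X in measurable X]setTI.
  have : measurable_fun setT (fun z : E * E => z.1 ord0 i - z.2 ord0 i); last by apply.
  apply: measurable_funB.
    by apply: (measurableT_comp (measurable_mx_coord ord0 i)); exact: measurable_fst.
  by apply: (measurableT_comp (measurable_mx_coord ord0 i)); exact: measurable_snd.
apply/seteqP; split => [[x y] /= -> i _ /=|[x y] h]; first by rewrite subrr.
by apply/rowP => i; have /eqP := h i I; rewrite subr_eq0 => /eqP.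
Qed.

(** The joint law is a product, and its mass on the diagonal integrates the masses of single points,
    which vanish. *)
Lemma sample_distinct i k : i != k -> P.-negligible [set w | X i w = X k w].
Proof.
move=> ik; have mD := diagonal_measurable.
have h := indep_pair_law (mutually_independent_pair X_ind ik) mD.
exists [set w | X i w = X k w]; split => //.
  have : measurable_fun setT (fun w => (X i w, X k w)).
    by apply/measurable_fun_pairP; split; exact: measurable_funPT.
  by move=> /(_ measurableT _ mD); rewrite setTI.
rewrite [LHS]h /product_measure1; apply: integral0_eq => x _ /=.
rewrite (_ : xsection _ _ = [set x]).
  have m1 : measurable [set x].
    exact: closed_mx_measurable (@accessible_closed_set1 E (hausdorff_accessible (@norm_hausdorff R E)) x).
  have := X_law k m1; rewrite /distribution/= /pushforward => ->.
  by rewrite /normalized mu_ac ?point_null// mule0.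
by apply/seteqP; split => y; rewrite /xsection/= inE/=; [move=> ->|move=> ->].
Qed.

(** Equal distances to [x] and [y] describe a hyperplane with normal [y - x]. *)
Lemma bisector_null (x y : E) : x <> y -> leb [set z | enorm (z - x) = enorm (z - y)] = 0%E.
Proof.
move=> xy; have w0 : y - x != 0 by rewrite subr_eq0; apply/eqP => e; apply: xy.
rewrite -(hyperplane_null ((sqnorm y - sqnorm x) / 2) w0); congr (leb _).
apply/seteqP; split => z /=.
  move=> /(congr1 (fun r => r ^+ 2)); rewrite !enorm_sqr !sqnormB => h.
  by rewrite dotvBr; lra.
rewrite dotvBr /enorm => h; congr Num.sqrt; rewrite !sqnormB; lra.
Qed.

End sample.

(** * Weighted cell masses of a sample *)

Section labelled_sample.
Context (R : realType) (d : nat).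
Context dW (W : measurableType dW) (P : probability W R).
Local Notation E := 'rV[R]_d.
Local Notation Ex g := (Rintegral P setT g).
Variables (Om : set E) (mu : {finite_measure set E -> \bar R}) (X : nat -> {RV P >-> E}).
Hypotheses (mOm : measurable Om) (M0 : 0 < mass Om mu).
Hypothesis X_law : forall i A, measurable A -> distribution P (X i) A = normalized Om mu A.
Hypothesis X_ind : mutually_independent X.
Variables (u : E -> R) (H : R).
Hypotheses (mu_meas : measurable_fun Om u) (uH : forall x, Om x -> 0 <= u x <= H) (H0 : 0 <= H).
Variables (Q : finType) (c : E -> Q).
Hypothesis mc : forall q, measurable [set x | c x = q].

(** Labels are abstract because they will be the cell of a point for the first sample and the cell
    of its image under the minimizing map for the second. *)
Definition label_part (q : Q) : E -> R := u \_ (Om `&` [set x | c x = q]).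

Lemma label_partE q x : Om x -> label_part q x = if c x == q then u x else 0.
Proof.
move=> Ox; rewrite /label_part patchE; case: eqP => h; first by rewrite mem_set.
by rewrite memNset//= => -[].
Qed.

Lemma label_part_out q x : ~ Om x -> label_part q x = 0.
Proof. by move=> Ox; rewrite /label_part patchE memNset//= => -[]. Qed.

Lemma label_part_measurable q : measurable_fun setT (label_part q).
Proof.
have mD : measurable (Om `&` [set x | c x = q]) by exact: measurableI.
apply/(measurable_restrictT _ mD).
by apply: measurable_funS mu_meas => // x [].
Qed.

Lemma label_part_bounds q x : 0 <= label_part q x <= H.
Proof.
have [Ox|Ox] := pselect (Om x); last by rewrite label_part_out// lexx.
by rewrite label_partE//; case: ifP => _; [exact: uH|rewrite lexx].
Qed.

(** Each point carries exactly one label. This is the disjointness that keeps the number of cells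
    out of the variance. *)
Lemma sum_label_part_sqr x : \sum_q label_part q x ^+ 2 <= H ^+ 2.
Proof.
have [Ox|Ox] := pselect (Om x); last first.
  by rewrite big1 ?sqr_ge0// => q _; rewrite label_part_out// expr0n.
have /andP[u0 u1] := uH Ox.
rewrite (bigD1 (c x))//= big1 => [|q qx]; last first.
  by rewrite label_partE// eq_sym (negbTE qx) expr0n.
by rewrite label_partE// eqxx addr0 ler_sqr ?nnegrE.
Qed.

Lemma label_part_expectation q :
  (mass Om mu * Ex (fun w => label_part q (X 0 w)))%:E =
  (\int[mu]_(x in Om `&` [set x | c x = q]) (u x)%:E)%E.
Proof.
have g0 x : 0 <= label_part q x by case/andP: (label_part_bounds q x).
have bX : bounded_mfun setT (fun w => label_part q (X 0 w)).
  exact: (bounded_mfun_RV (X 0) (label_part_measurable q) (label_part_bounds q)).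
rewrite EFinM -(bounded_mfun_EFin P measurableT bX).
rewrite -(law_integral M0 X_law 0 (label_part_measurable q) g0) [RHS]integral_mkcond.
apply: eq_integral => x _; rewrite /label_part !patchE; case: ifP => //.
Qed.

Variable n : nat.
Hypothesis n0 : (0 < n)%N.

Lemma sum_label_empirical_mean (Mx : R) w q : (forall i, (i < n)%N -> Om (X i w)) ->
  \sum_(i < n | c (X i w) == q) Mx / n%:R * u (X i w) = Mx * empirical_mean n X (label_part q) w.
Proof.
move=> XOm; rewrite /empirical_mean mulrA mulr_sumr big_mkcond/=.
apply: eq_bigr => i _; have Ox := XOm i (ltn_ord i).
by rewrite label_partE//; case: ifP => // _; rewrite mulr0.
Qed.

Lemma sum_empirical_mean_label w : (forall i, (i < n)%N -> Om (X i w)) ->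
  \sum_q empirical_mean n X (label_part q) w <= H.
Proof.
move=> XOm; rewrite -mulr_sumr exchange_big/= ler_pdivrMl ?ltr0n//.
have -> : n%:R * H = \sum_(i < n) H by rewrite sumr_const card_ord mulr_natl.
apply: ler_sum => i _; have Ox := XOm i (ltn_ord i).
rewrite (bigD1 (c (X i w)))//= big1 => [|q qx]; last first.
  by rewrite label_partE// eq_sym (negbTE qx).
by rewrite label_partE// eqxx addr0; have /andP[] := uH Ox.
Qed.

Definition label_deviation w : R :=
  \sum_q `|empirical_mean n X (label_part q) w - Ex (fun w => label_part q (X 0 w))|.

Lemma bounded_mfun_label_deviation : bounded_mfun setT label_deviation.
Proof.
apply: bounded_mfun_sum => q.
have [mS [C C0 SC]] : bounded_mfun setT (fun w => empirical_mean n X (label_part q) w -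
    Ex (fun w => label_part q (X 0 w))).
  apply: bounded_mfunD; last exact: bounded_mfun_cst.
  exact: (bounded_mfun_empirical_mean _ _ (label_part_measurable q) (label_part_bounds q)).
split; first exact: measurableT_comp.
by exists C => // x xT; rewrite normr_id SC.
Qed.

Lemma label_deviation_expectation (N : nat) : (0 < N)%N -> (#|Q| <= N)%N ->
  Ex label_deviation <= (H ^+ 2 + 1) / 2 * Num.sqrt (N%:R / n%:R).
Proof.
move=> N0 QN; rewrite /label_deviation Rintegral_sum//; last first.
  move=> q; have [mS [C C0 SC]] : bounded_mfun setT (fun w => empirical_mean n X (label_part q) w -
      Ex (fun w => label_part q (X 0 w))).
    apply: bounded_mfunD; last exact: bounded_mfun_cst.
    exact: (bounded_mfun_empirical_mean _ _ (label_part_measurable q) (label_part_bounds q)).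
  split; first exact: measurableT_comp.
  by exists C => // x xT; rewrite normr_id SC.
apply: sum_empirical_deviation => //.
- by move=> i k ik; exact: mutually_independent_pair.
- by move=> i k A mA; have := X_law i mA; have := X_law k mA;
    rewrite /distribution/= /pushforward => -> ->.
- exact: label_part_measurable.
- exact: label_part_bounds.
- exact: sum_label_part_sqr.
Qed.

End labelled_sample.

(** Separates mass-estimation errors from sampling errors; the exact cell masses [M * e] and
    [M' * e'] cancel. *)
Lemma discrepancy_term_le (R : realFieldType) (Mx My M M' A B e e' : R) :
  M * e = M' * e' -> 0 <= M -> 0 <= M' -> 0 <= A -> 0 <= B ->
  `|Mx * A - My * B| <= `|Mx - M| * A + `|My - M'| * B + (M * `|A - e| + M' * `|B - e'|).
Proof.
move=> Me M0 M'0 A0 B0.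
rewrite (_ : Mx * A - My * B = (Mx - M) * A - (My - M') * B + (M * (A - e) - M' * (B - e'))); last first.
  by rewrite !mulrBr Me; ring.
apply: (le_trans (ler_normD _ _)); apply: lerD.
  by apply: (le_trans (ler_normB _ _)); rewrite !normrM (ger0_norm A0) (ger0_norm B0).
by apply: (le_trans (ler_normB _ _)); rewrite !normrM (ger0_norm M0) (ger0_norm M'0).
Qed.

(** * Nearest-neighbour extensions *)

Lemma negligible_bigcup_count d (T : measurableType d) (R : realType)
    (m : {measure set T -> \bar R}) (I : countType) (F : I -> set T) :
  (forall i, m.-negligible (F i)) -> m.-negligible (\bigcup_i F i).
Proof.
move=> F0; have : m.-negligible (\bigcup_n (if unpickle n is Some i then F i else set0)).
  by apply: negligible_bigcup => n; case: unpickle => [i|]; [exact: F0|exact: negligible_set0].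
by apply: negligibleS => x [i _ Fx]; exists (pickle i) => //; rewrite pickleK.
Qed.

Section nearest_neighbour.
Context (R : realType) (d : nat).
Local Notation E := 'rV[R]_d.
Local Notation leb := (lebesgue_rV R d).
Variables (Om : set E) (mu : {finite_measure set E -> \bar R}).
Hypothesis mOm : measurable Om.
Hypothesis mu_ac : forall A, measurable A -> leb A = 0%E -> mu A = 0%E.
Variables (n : nat) (X : 'I_n -> E).
Hypotheses (n0 : (0 < n)%N) (Xinj : forall i k, i != k -> X i <> X k).

Lemma continuous_enormB (y : E) : continuous (fun x : E => enorm (x - y) : R).
Proof.
move=> x; have cB : (x0 - y) @[x0 --> x] --> (x - y : E) by exact: (cvgB cvg_id (cvg_cst y)).
exact: (@cvg_enorm R d E (nbhs x) (nbhs_filter x) _ _ cB).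
Qed.

Lemma measurable_enormB (y : E) : measurable_fun setT (fun x : E => enorm (x - y) : R).
Proof.
apply: within_continuous_measurable => //.
exact/continuous_subspaceT/continuous_enormB.
Qed.

Lemma voronoi_measurable i : measurable (voronoi X Om i).
Proof.
rewrite (_ : voronoi X Om i = Om `&` \bigcap_(k in [set k : 'I_n | k != i])
    [set x | enorm (x - X i) <= enorm (x - X k)]); last first.
  by apply/seteqP; split => [x [Ox h]|x [Ox h]]; split => // k ki; exact: h.
apply: measurableI => //; apply: fin_bigcap_measurable => [|k _]; first exact: finite_finset.
rewrite -[X in measurable X]setTI; apply: measurable_fun_le => //; exact: measurable_enormB.
Qed.

Lemma voronoi_exists x : Om x -> exists i, voronoi X Om i x.
Proof.
move=> Ox; have i0 : 'I_n by exact: Ordinal n0.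
have [i _ hi] := @arg_minP _ _ _ i0 xpredT (fun i => enorm (x - X i)) isT.
by exists i; split => // k _; exact: hi.
Qed.

Lemma nn_extensionE (V : nmodType) (F : 'I_n -> V) i x : voronoi X Om i x ->
  (forall k, k != i -> enorm (x - X i) <> enorm (x - X k)) -> nn_extension X Om F x = F i.
Proof.
move=> Vi ties; rewrite /nn_extension (big_pred1 i)// => k /=; apply/idP/eqP => [|->].
  move=> /set_mem[Ox hk]; apply/eqP; apply: contrapT => /negP ki.
  apply: (ties k ki); apply/eqP; rewrite eq_le (Vi.2 _ ki)/= hk//.
  by rewrite eq_sym.
exact: mem_set.
Qed.

(** Contains every point where Voronoi cells overlap, that is where [nn_extension] adds several
    values. *)
Definition tie_set := \bigcup_(ik : 'I_n * 'I_n)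
  [set x | ik.1 != ik.2 /\ enorm (x - X ik.1) = enorm (x - X ik.2)].

Lemma tie_set_negligible : mu.-negligible tie_set.
Proof.
have mT ik : measurable [set x | enorm (x - X ik.1) = enorm (x - X ik.2)].
  rewrite (_ : [set _ | _] = (fun x : E => enorm (x - X ik.1) - enorm (x - X ik.2)) @^-1` [set 0]).
    rewrite -[X in measurable X]setTI.
    have : measurable_fun setT (fun x : E => enorm (x - X ik.1) - enorm (x - X ik.2)); last by apply.
    by apply: measurable_funB; exact: measurable_enormB.
  by apply/seteqP; split => x /=; [move=> ->; rewrite subrr|move/eqP; rewrite subr_eq0 => /eqP].
apply: negligible_bigcup_count => ik; have [e|ik12] := eqVneq ik.1 ik.2.
  by apply: negligibleS (negligible_set0 _) => x /= [].
exists [set x | enorm (x - X ik.1) = enorm (x - X ik.2)]; split => //; last by move=> x [].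
by apply: mu_ac => //; apply: bisector_null; exact: Xinj.
Qed.

(** Off the ties the loss at [x] is that of the one cell containing [x], so a step function plus the
    constant [c] dominates it almost everywhere. *)
Lemma nn_integral_le (V : nmodType) (F : 'I_n -> V) (loss : V -> E -> R) (t : 'I_n -> R) (v c : R) :
  (forall z x, Om x -> 0 <= loss z x) -> (forall i, 0 <= t i) -> 0 <= c ->
  (forall i, (mu (voronoi X Om i) <= v%:E)%E) ->
  (forall i x, voronoi X Om i x -> loss (F i) x <= t i + c) ->
  (\int[mu]_(x in Om) (loss (nn_extension X Om F x) x)%:E <=
   (v * (\sum_i t i) + c * mass Om mu)%:E)%E.
Proof.
move=> loss0 t0 c0 muv lossle.
pose g x : R := \sum_i t i * \1_(voronoi X Om i) x + c.
have mg1 i : measurable_fun Om (fun x => t i * \1_(voronoi X Om i) x).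
  by apply: measurable_funM => //; apply: measurable_indic; exact: voronoi_measurable.
have mg2 : measurable_fun Om (fun x => \sum_i t i * \1_(voronoi X Om i) x).
  by apply: measurable_sum.
have g10 i x : 0 <= t i * \1_(voronoi X Om i) x by rewrite mulr_ge0.
have mg1E i : measurable_fun Om (fun x => (t i * \1_(voronoi X Om i) x)%:E).
  exact/measurable_EFinP.
have mg2E : measurable_fun Om (fun x => (\sum_i t i * \1_(voronoi X Om i) x)%:E).
  exact/measurable_EFinP.
have g20 x : 0 <= \sum_i t i * \1_(voronoi X Om i) x by apply: sumr_ge0.
apply: (@le_trans _ _ (\int[mu]_(x in Om) (g x)%:E)%E).
  apply: (ge0_le_integral_negligible mOm tie_set_negligible).
  - by move=> x Ox; rewrite lee_fin loss0.
  - by move=> x Ox; rewrite lee_fin addr_ge0.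
  - by apply/measurable_EFinP; exact: measurable_funD.
  move=> x Ox ntie; rewrite lee_fin; have [i Vi] := voronoi_exists Ox.
  rewrite (@nn_extensionE _ _ i)//; last first.
    by move=> k ki e; apply: ntie; exists (i, k) => //=; rewrite eq_sym; split.
  apply: (le_trans (lossle i x Vi)); rewrite /g lerD2r (bigD1 i)//= indicE mem_set// mulr1.
  by rewrite lerDl; apply: sumr_ge0.
rewrite /g; under eq_integral do rewrite EFinD.
have p1 i x : Om x -> (0 <= (t i * \1_(voronoi X Om i) x)%:E)%E by rewrite lee_fin.
have p2 x : Om x -> (0 <= (\sum_i t i * \1_(voronoi X Om i) x)%:E)%E by rewrite lee_fin.
have p3 x : Om x -> (0 <= c%:E)%E by rewrite lee_fin.
rewrite ge0_integralD//.
rewrite integral_cst// [(_%:E)%E in leRHS]EFinD leeD//; last first.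
  by rewrite EFinM /mass fineK// fin_num_measure.
under eq_integral do rewrite -sumEFin.
rewrite ge0_integral_sum//.
rewrite mulr_sumr -sumEFin; apply: lee_sum => i _.
under eq_integral do rewrite EFinM.
have m4 : measurable_fun Om (fun x => (\1_(voronoi X Om i) x)%:E : \bar R).
  by apply/measurable_EFinP; apply: measurable_indic; exact: voronoi_measurable.
have p4 x : Om x -> (0 <= (\1_(voronoi X Om i) x)%:E :> \bar R)%E by rewrite lee_fin.
rewrite ge0_integralZl ?lee_fin//.
rewrite mulrC EFinM lee_wpmul2l ?lee_fin// integral_indic//; last exact: voronoi_measurable.
apply: le_trans (muv i); apply: le_measure; rewrite ?inE //; last first.
- exact: voronoi_measurable.
- by apply: measurableI => //; exact: voronoi_measurable.
Qed.

End nearest_neighbour.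

Lemma sqnorm_dist (R : realType) (d : nat) (p q : 'rV[R]_d) :
  `|sqnorm p - sqnorm q| <= (enorm p + enorm q) * enorm (p - q).
Proof.
rewrite -!enorm_sqr subr_sqr normrM mulrC (ger0_norm (addr_ge0 (enorm_ge0 p) (enorm_ge0 q))).
rewrite ler_wpM2l ?addr_ge0 ?enorm_ge0// ler_norml lerNl opprB !lerBlDr; apply/andP; split.
  by have := enormD (q - p) p; rewrite subrK enormBC.
by have := enormD (p - q) q; rewrite subrK.
Qed.

(** * Lipschitz regularity of the growth factor *)

Section lambda_lipschitz.
Context (R : realType) (d : nat).
Local Notation E := 'rV[R]_d.
Variables (Om : set E) (f : E -> R) (kappa : R).
Hypothesis Om_convex : convex_set Om.
Hypothesis kappa01 : 0 < kappa < 1.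
Hypothesis f_hess : forall x, Om x -> (exists g, is_gradient Om f x g) /\
    exists H, [/\ is_hessian Om f x H,
      loewner_le ((1 - kappa^-1)%:M) H & loewner_le H ((1 - kappa)%:M)].
Variable L : R.
Hypotheses (L0 : 0 <= L)
  (T0L : forall x z, Om x -> Om z -> enorm (T0 Om f x - T0 Om f z) <= L * enorm (x - z)).
Variables (whi Dm : R).
Hypotheses (whi0 : 0 < whi) (whiP : forall x, Om x -> expR (- f x) <= whi).
Hypotheses (Dm0 : 0 <= Dm)
  (DmP : forall x y, Om x -> Om y -> sqnorm (y - x) <= Dm /\ sqnorm (y - T0 Om f x) <= Dm).

Let r := Num.sqrt Dm.

Let gradE x : gradient Om f x = x - T0 Om f x.
Proof. by rewrite /T0 opprB addrC subrK. Qed.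

(** Nonnegativity of the Bregman divergence bounds [f a - f b] by half the squared distance plus the
    gradient pairing; the distance and the gradient are both at most [r], giving [r / 2 + r]. *)
Lemma potential_lip x z : Om x -> Om z -> `|f x - f z| <= 3 / 2 * r * enorm (x - z).
Proof.
have one a b : Om a -> Om b -> f a - f b <= 3 / 2 * r * enorm (a - b).
  move=> Oa Ob; have /andP[h _] := bregman_bounds Om_convex kappa01 f_hess Oa Ob.
  have k0 : 0 <= kappa / 2 * sqnorm (a - b).
    by have [k0 _] := andP kappa01; rewrite mulr_ge0 ?sqnorm_ge0// divr_ge0// ltW.
  have := le_trans k0 h; rewrite /bregman gradE => {}h.
  have [h1 _] := DmP Ob Oa; have [_ h2] := DmP Ob Ob.
  have e1 : enorm (a - b) <= r by rewrite enorm_le ?sqrtr_ge0// sqr_sqrtr.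
  have e2 : enorm (b - T0 Om f b) <= r by rewrite enorm_le ?sqrtr_ge0// sqr_sqrtr.
  have := dotv_le (b - T0 Om f b) (a - b); rewrite -enorm_sqr in h.
  have := ler_wpM2r (enorm_ge0 (a - b)) e1; have := ler_wpM2r (enorm_ge0 (a - b)) e2.
  move: h; rewrite -expr2; move: (dotv _ _) (enorm (a - b)) (enorm (b - _)) (f a) (f b) => q e e' u u'.
  lra.
move=> Ox Oz; rewrite ler_norml lerNl opprB one// andbT.
by have := one _ _ Oz Ox; rewrite enormBC.
Qed.

Lemma lambda0_le x : Om x -> lambda0 Om f x <= whi * expR (Dm / 4).
Proof.
move=> Ox; have [_ h] := DmP Ox Ox; have w := whiP Ox; rewrite /lambda0 gradE expRD.
move: (sqnorm _) h (- f x) w => s h u w.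
by apply: ler_pM; rewrite ?expR_ge0// ler_expR ler_pM2r ?invr_gt0.
Qed.

(** An upper bound of [lambda0] times the Lipschitz constant of its exponent: [3 / 2 * r] from the
    potential, and a quarter of [2 * r * (1 + L)] from the squared gradient. *)
Definition lambda_lip : R := whi * expR (Dm / 4) * (2 * r + r * L / 2).

Lemma lambda0_lip x z : Om x -> Om z ->
  `|lambda0 Om f x - lambda0 Om f z| <= lambda_lip * enorm (x - z).
Proof.
move=> Ox Oz; have eM : whi * expR (Dm / 4) = expR (ln whi + Dm / 4) by rewrite expRD lnK.
rewrite /lambda_lip eM -mulrA; apply: (le_trans (expR_lip (M := ln whi + Dm / 4) _ _)).
- by rewrite -ler_expR -eM; exact: lambda0_le.
- by rewrite -ler_expR -eM; exact: lambda0_le.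
rewrite ler_pM2l ?expR_gt0//.
have e1 y : Om y -> enorm (y - T0 Om f y) <= r.
  by move=> Oy; rewrite enorm_le ?sqrtr_ge0// sqr_sqrtr//; have [] := DmP Oy Oy.
have h1 := potential_lip Ox Oz.
have h2 : `|sqnorm (x - T0 Om f x) - sqnorm (z - T0 Om f z)| <= 2 * r * ((1 + L) * enorm (x - z)).
  apply: (le_trans (sqnorm_dist _ _)).
  have e2 : enorm (x - T0 Om f x - (z - T0 Om f z)) <= (1 + L) * enorm (x - z).
    have -> : x - T0 Om f x - (z - T0 Om f z) = (x - z) - (T0 Om f x - T0 Om f z).
      by move: (T0 Om f x) (T0 Om f z) => p q; apply/rowP => j; rewrite !mxE; ring.
    rewrite mulrDl mul1r; apply: (le_trans (enormD _ _)); rewrite enormN lerD2l.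
    exact: T0L.
  have e3 : enorm (x - T0 Om f x) + enorm (z - T0 Om f z) <= 2 * r.
    rewrite [2 * r]mulr_natl mulr2n; exact: (lerD (e1 x Ox) (e1 z Oz)).
  exact: (ler_pM (addr_ge0 (enorm_ge0 _) (enorm_ge0 _)) (enorm_ge0 _) e3 e2).
rewrite -(gradE x) -(gradE z) in h2.
move: (sqnorm (gradient Om f x)) (sqnorm (gradient Om f z)) h2 => s s' h2.
rewrite (_ : - f x + s / 4 - (- f z + s' / 4) = - (f x - f z) + (s - s') / 4); last by ring.
apply: (le_trans (ler_normD _ _)); rewrite normrN normrM (ger0_norm (_ : 0 <= 4^-1))//.
move: h1 h2; move: `|f x - f z| `|s - s'| (enorm (x - z)) => A A' e.
lra.
Qed.

End lambda_lipschitz.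

(** * Covering by the sample *)

Section covering.
Context (R : realType) (d : nat) (d0 : (0 < d)%N).
Context dW (W : measurableType dW) (P : probability W R).
Local Notation E := 'rV[R]_d.
Local Notation leb := (lebesgue_rV R d).
Variables (Om : set E) (mu : {finite_measure set E -> \bar R}) (X : nat -> {RV P >-> E}).
Hypotheses (mOm : measurable Om) (M0 : 0 < mass Om mu).
Hypothesis X_law : forall i A, measurable A -> distribution P (X i) A = normalized Om mu A.
Hypothesis X_ind : mutually_independent X.
Variables (bmin bmax : R).
Hypotheses (bmin0 : 0 < bmin) (bmax0 : 0 < bmax).
Hypothesis dens_ge : forall A, measurable A -> (bmin%:E * leb (A `&` Om) <= normalized Om mu A)%E.
Hypothesis dens_le : forall A, measurable A -> (normalized Om mu A <= bmax%:E * leb (A `&` Om))%E.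
Variables (eps0 del0 : R).
Hypotheses (eps00 : 0 < eps0) (del00 : 0 < del0).
Hypothesis Om_reg : forall x (eps : R), Om x -> 0 < eps < eps0 ->
  (del0%:E * leb (eball x eps) <= leb (eball x eps `&` Om))%E.
Variable B : R.
Hypotheses (B0 : 0 < B) (OmB : forall x, Om x -> in_box B x).

Section scale.
Variables (K n : nat).

Let h := 4 * B / 2 ^+ K.

Let h0 : 0 < h. Proof. by rewrite divr_gt0 ?mulr_gt0 ?exprn_gt0. Qed.

Let label := {ffun 'I_d -> 'I_(2 ^ K).+1}.

(** Covering is tested on balls around points of [Om], since (A2) bounds their volume from below,
    whereas a cell may meet [Om] in an arbitrarily small set. *)
Definition cell_point (q : label) : E := xget 0 [set x | Om x /\ cell B K x = q].

Definition missed (q : label) : set W :=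
  [set w | (exists x, Om x /\ cell B K x = q) /\
           forall i, (i < n)%N -> ~ eball (cell_point q) h (X i w)].

Definition uncovered : set W := \bigcup_(q : label) missed q.

Let cell_pointP q : (exists x, Om x /\ cell B K x = q) ->
  Om (cell_point q) /\ cell B K (cell_point q) = q.
Proof. by rewrite /cell_point; case: xgetP => // + [x Hx] => /(_ x). Qed.

Lemma missed_measurable q : measurable (missed q).
Proof.
have [ex|nex] := pselect (exists x, Om x /\ cell B K x = q); last first.
  by rewrite (_ : missed q = set0)//; apply/seteqP; split => // w [].
rewrite (_ : missed q = \bigcap_(i in [set i : 'I_n | True])
    ~` (X i @^-1` eball (cell_point q) h)).
  apply: fin_bigcap_measurable => [|i _]; first exact: finite_finset.
  by apply: measurableC; apply: preimage_RV_measurable; exact: measurable_eball.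
apply/seteqP; split => [w [_ hw] i _ /=|w hw]; first exact: hw.
by split => // i iN; exact: (hw (Ordinal iN) I).
Qed.

Lemma uncovered_measurable : measurable uncovered.
Proof. by apply: fin_bigcup_measurable => [|q _]; [exact: finite_finset|exact: missed_measurable]. Qed.

(** Lower bound for the law of a ball of radius [h] centred in [Om]: density, then (A2), then the
    inscribed cube. *)
Let p := bmin * del0 * (h / d%:R) ^+ d.

Lemma missed_prob q : h < eps0 -> (P (missed q) <= (expR (- (p * n%:R)))%:E)%E.
Proof.
move=> heps.
have [ex|nex] := pselect (exists x, Om x /\ cell B K x = q); last first.
  rewrite (_ : missed q = set0) ?measure0 ?lee_fin ?expR_ge0//.
  by apply/seteqP; split => // w [].
have [Oq _] := cell_pointP ex.
have mb := measurable_eball (cell_point q) h.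
pose pq := fine (normalized Om mu (eball (cell_point q) h)).
have pqE i : P (X i @^-1` eball (cell_point q) h) = pq%:E.
  have := X_law i mb; rewrite /distribution/= /pushforward /pq => <-.
  by rewrite fineK// fin_num_measure//; exact: preimage_RV_measurable.
have pq1 : pq <= 1.
  by rewrite -lee_fin -(pqE 0%N); apply: probability_le1; exact: preimage_RV_measurable.
have ppq : p <= pq.
  rewrite -lee_fin -(pqE 0%N); have := X_law 0 mb; rewrite /distribution/= /pushforward => ->.
  apply: le_trans (dens_ge mb).
  rewrite /p -mulrA EFinM lee_wpmul2l ?lee_fin ?(ltW bmin0)//.
  apply: le_trans (Om_reg Oq _); last by rewrite h0.
  by rewrite EFinM lee_wpmul2l ?lee_fin ?(ltW del00)//; exact: eball_volume_ge.
have -> : missed q = [set w | forall i, (i < n)%N -> ~ eball (cell_point q) h (X i w)].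
  by apply/seteqP; split => [w []//|w hw]; split.
rewrite (independent_avoid X_ind n mb pqE) lee_fin.
rewrite -mulNr expRM_natr; apply: lerXn2r; rewrite ?nnegrE ?expR_ge0 ?subr_ge0//.
apply: le_trans (expR_ge1Dx _); lra.
Qed.

Lemma uncovered_prob : h < eps0 ->
  (P uncovered <= ((2 ^ d * (2 ^ K) ^ d)%N%:R * expR (- (p * n%:R)))%:E)%E.
Proof.
move=> heps.
apply: (@le_trans _ _ (\sum_(q : label) P (missed q))%E).
  rewrite [leRHS](_ : _ = \sum_(q <- enum label) P (missed q))%E; last by rewrite big_enum.
  rewrite fsbig_seq ?enum_uniq//; apply: content_sub_fsum => //.
  - by move=> q _; exact: missed_measurable.
  - exact: uncovered_measurable.
  - by move=> w [q _ hw]; exists q => //=; rewrite mem_enum.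
apply: (@le_trans _ _ (\sum_(q : label) (expR (- (p * n%:R)))%:E)%E).
  by apply: lee_sum => q _; exact: missed_prob.
rewrite sumEFin lee_fin sumr_const -[_ *+ #|_|]mulr_natl ler_wpM2r ?expR_ge0// ler_nat.
exact: card_cell.
Qed.

Lemma covered_near w x : ~ uncovered w -> Om x ->
  exists2 i, (i < n)%N & enorm (x - X i w) <= (d%:R + 1) * h.
Proof.
move=> cov Ox; have ex : exists x', Om x' /\ cell B K x' = cell B K x by exists x.
have [Oq cq] := cell_pointP ex.
have [i iN hi] : exists2 i, (i < n)%N & eball (cell_point (cell B K x)) h (X i w).
  apply: contrapT => hN; apply: cov; exists (cell B K x) => //; split => // i iN hi.
  by apply: hN; exists i.
exists i => //; apply: (le_trans (enormB_trans (cell_point (cell B K x)) _ _)).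
rewrite mulrDl mul1r; apply: lerD; last by rewrite enormBC; exact: ltW.
by apply: cell_enorm => //; exact: OmB.
Qed.

Lemma covered_voronoi_mass w (i : 'I_n) : ~ uncovered w -> Om (X i w) ->
  (mu (voronoi (fun k : 'I_n => X k w) Om i) <=
   (mass Om mu * (bmax * (2 * ((d%:R + 2) * h)) ^+ d))%:E)%E.
Proof.
(* [eball] is open, so the radius must exceed the covering distance [(d%:R + 1) * h]. *)
move=> cov Oi; pose r := (d%:R + 2) * h.
have r0 : 0 < r by rewrite mulr_gt0// ltr_wpDl.
have mb := measurable_eball (X i w) r.
apply: (@le_trans _ _ (mu (eball (X i w) r))).
  apply: le_measure; rewrite ?inE//; first exact: voronoi_measurable.
  move=> x [Ox hx]; rewrite /eball/= -/(enorm _).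
  have [k kN hk] := covered_near cov Ox.
  have hik : enorm (x - X i w) <= enorm (x - X k w).
    have [<-//|ki] := eqVneq (Ordinal kN) i.
    exact: (hx (Ordinal kN) ki).
  apply: (le_lt_trans (le_trans hik hk)); rewrite ltr_pM2r// ltrD2l.
  by rewrite (ltr_nat R 1 2).
rewrite (_ : mu (eball (X i w) r) = ((mass Om mu)%:E * normalized Om mu (eball (X i w) r))%E); last first.
  by rewrite /normalized muleA -EFinM divff ?gt_eqF// mul1e.
rewrite EFinM lee_wpmul2l ?lee_fin ?(ltW M0)//; apply: (le_trans (dens_le mb)).
rewrite EFinM lee_wpmul2l ?lee_fin ?(ltW bmax0)//.
apply: le_trans (eball_volume_le (X i w) r0).
by apply: le_measure; rewrite ?inE//; apply: measurableI.
Qed.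

End scale.
End covering.

(** * Rates *)

Section scales.
Context (R : realType).

Lemma exists_pow_between (b : nat) (y : R) : (1 < b)%N -> 1 <= y ->
  exists K : nat, b%:R ^+ K <= y < b%:R ^+ K.+1.
Proof.
move=> b1 y1; have y0 : 0 <= y by exact: le_trans y1.
exists (trunc_log b (Num.truncn y)).
have t0 : (0 < Num.truncn y)%N by rewrite truncn_gt0.
have /andP[h1 h2] := truncn_itv y0.
have /andP[h3 h4] := trunc_log_bounds b1 t0.
rewrite -!natrX; apply/andP; split; first by apply: le_trans h1; rewrite ler_nat.
by apply: (lt_le_trans h2); rewrite ler_nat.
Qed.

Lemma ln_le_sqrt (x : R) : 0 < x -> ln x <= 2 * Num.sqrt x.
Proof.
move=> x0; have s0 : 0 < Num.sqrt x by rewrite sqrtr_gt0.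
have e : ln x = 2 * ln (Num.sqrt x).
  by rewrite -{1}(sqr_sqrtr (ltW x0)) lnXn// mulr_natl.
rewrite e ler_pM2l//; have := @le_ln1Dx R (Num.sqrt x - 1).
rewrite [1 + _]addrC subrK => h; apply: (le_trans (h _)); first by rewrite ltrBrDl subrr.
by rewrite gerBl.
Qed.

Lemma ln_ratio_small (e : R) : 0 < e -> exists N : nat, forall n, (N <= n)%N ->
  ln n%:R <= e * n%:R.
Proof.
move=> e0; pose c := (2 / e) ^+ 2.
have c0 : 0 <= c by exact: sqr_ge0.
exists (Num.truncn c).+1 => n hn.
have cn : c < n%:R by apply: (lt_le_trans (truncnS_gt c)); rewrite ler_nat.
have n0 : 0 < n%:R :> R by exact: le_lt_trans cn.
apply: (le_trans (ln_le_sqrt n0)).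
have s2 : 2 / e <= Num.sqrt n%:R.
  by rewrite -(ler_sqr (_ : 2 / e \is Num.nneg)) ?nnegrE ?sqrtr_ge0 ?divr_ge0 ?(ltW e0)// sqr_sqrtr ?ltW.
rewrite -[X in e * X](sqr_sqrtr (ltW n0)) expr2 mulrA ler_wpM2r ?sqrtr_ge0//.
by rewrite mulrC -ler_pdivrMr.
Qed.

Lemma ln_ge1_eventually : exists N : nat, forall n, (N <= n)%N -> 1 <= ln n%:R :> R.
Proof.
exists (Num.truncn (expR (1 : R))).+1 => n hn.
have en : expR 1 < n%:R :> R by apply: (lt_le_trans (truncnS_gt _)); rewrite ler_nat.
by rewrite -[leLHS](@expRK R) ler_ln ?posrE ?expR_gt0 ?(ltW en)// (lt_trans _ en)// expR_gt0.
Qed.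

Lemma ln_ge1_gt1 (x : R) : 1 <= ln x -> 1 < x.
Proof.
by move=> h; rewrite ltNge; apply/negP => x1; have := le_trans h (ln_le0 x1); rewrite ler10.
Qed.

Section rates.
Variable d : nat.
Hypothesis d0 : (0 < d)%N.
Local Notation rate := (emp_rate R d).

Let dR0 : 0 < d%:R :> R. Proof. by rewrite ltr0n. Qed.

Lemma powR_expd (h : R) : 0 <= h -> (h ^+ d) `^ (2 / d%:R) = h ^+ 2.
Proof. by move=> h0; rewrite -!powR_mulrn// -powRrM mulrC divfK// gt_eqF. Qed.

Section large.
Variable n : nat.
Hypothesis n1 : 1 <= ln n%:R :> R.

Let nn : 1 < n%:R :> R. Proof. exact: ln_ge1_gt1. Qed.

Let n0 : 0 < n%:R :> R. Proof. exact: lt_trans nn. Qed.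

Let s0 : 0 < Num.sqrt n%:R :> R. Proof. by rewrite sqrtr_gt0. Qed.

Lemma emp_rate_gt0 : 0 < rate n.
Proof.
rewrite /emp_rate; case: ifP => _; first by rewrite invr_gt0.
case: ifP => _; last exact: powR_gt0.
by rewrite divr_gt0// (lt_le_trans ltr01).
Qed.

Lemma inv_le_inv_sqrt : n%:R^-1 <= (Num.sqrt n%:R)^-1 :> R.
Proof.
rewrite lef_pV2 ?posrE// -[leRHS](sqr_sqrtr (ltW n0)) expr2 ler_peMl ?ltW//.
by rewrite -[X in X < _]sqrtr1 ltr_sqrt.
Qed.

Lemma powR_le_exponent (x y : R) : x <= y -> n%:R `^ x <= n%:R `^ y.
Proof. by move=> xy; apply: ler_powR => //; exact: ltW. Qed.

Lemma powR_inv_sqrt : n%:R `^ (- 2^-1) = (Num.sqrt n%:R)^-1 :> R.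
Proof. by rewrite powRN powR12_sqrt// ltW. Qed.

Lemma inv_sqrt_le_emp_rate : (Num.sqrt n%:R)^-1 <= rate n.
Proof.
rewrite /emp_rate; case: ifP => [//|d3]; case: ifP => [_|d4].
  by rewrite ler_peMl ?invr_ge0 ?(ltW s0).
rewrite -powR_inv_sqrt; apply: powR_le_exponent.
rewrite mulNr lerN2 ler_pdivrMr// mulrC ler_pdivlMr// -natrM ler_nat.
by case: d d3 d4 => [|[|[|[|[|]]]]].
Qed.

Lemma inv_le_emp_rate : n%:R^-1 <= rate n.
Proof. exact: le_trans inv_le_inv_sqrt inv_sqrt_le_emp_rate. Qed.

(** This absorbs the squared mesh size. For [d <= 4] the exponent is at least one half and the base
    at most [1], so a square root bounds the power; for larger [d] only [ln n] raised to a power at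
    most [1] has to be compared. *)
Lemma ln_ratio_powR_le : (ln n%:R / n%:R) `^ (2 / d%:R) <= ln n%:R * rate n.
Proof.
have l0 : 0 < ln n%:R :> R by exact: lt_le_trans n1.
have t0 : 0 < ln n%:R / n%:R :> R by rewrite divr_gt0.
rewrite /emp_rate; have [d4|d5] := leqP d 4.
  have -> : ln n%:R * (if (d <= 3)%N then (Num.sqrt n%:R)^-1 else
      if d == 4%N then ln n%:R / Num.sqrt n%:R else n%:R `^ (- 2 / d%:R)) =
      (if (d <= 3)%N then 1 else ln n%:R) * (ln n%:R / Num.sqrt n%:R) :> R.
    by case: (d) d4 => [|[|[|[|[|]]]]]//= _; rewrite ?mul1r.
  apply: (@le_trans _ _ (ln n%:R / Num.sqrt n%:R)); last first.
    rewrite ler_peMl ?(divr_ge0 (ltW l0) (ltW s0))//; case: ifP => //.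
  apply: (@le_trans _ _ ((ln n%:R / n%:R) `^ 2^-1)).
    have tle1 : ln n%:R / n%:R <= 1 :> R.
      rewrite ler_pdivrMr// mul1r; have := @le_ln1Dx R (n%:R - 1).
      rewrite [1 + _]addrC subrK => h; apply: (le_trans (h _)); first by rewrite ltrBrDl subrr.
      by rewrite gerBl.
    apply: ger_powR; first by rewrite t0.
    by rewrite ler_pdivlMr// mulrC ler_pdivrMr// -natrM ler_nat.
  rewrite powR12_sqrt ?(ltW t0)// sqrtrM ?(ltW l0)// sqrtrV ?(ltW n0)//.
  rewrite ler_pM2r ?invr_gt0// -[leRHS](sqr_sqrtr (ltW l0)) expr2.
  rewrite ler_peMl ?sqrtr_ge0// -[leLHS]sqrtr1 ler_wsqrtr//.
rewrite ifF; last by rewrite leqNgt (ltnW d5).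
rewrite ifF; last by apply/negbTE; rewrite gtn_eqF.
rewrite powRM ?(ltW l0) ?invr_ge0 ?(ltW n0)//.
rewrite -[n%:R^-1]powR_inv1 ?(ltW n0)// -powRrM mulN1r -mulNr ler_wpM2r ?powR_ge0//.
rewrite -[leRHS](powRr1 (ltW l0)); apply: ler_powR => //.
by rewrite ler_pdivrMr// mul1r ler_nat (leq_trans _ d5).
Qed.

Lemma bandwidth_sqr_le (h C : R) : 0 < h -> 0 <= C -> h ^+ d <= C * (ln n%:R / n%:R) ->
  h ^+ 2 <= C `^ (2 / d%:R) * (ln n%:R * rate n).
Proof.
move=> h0 C0 hC; have l0 : 0 < ln n%:R :> R by exact: lt_le_trans n1.
have t0 : 0 < ln n%:R / n%:R :> R by rewrite divr_gt0.
rewrite -powR_expd ?(ltW h0)//.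
apply: (@le_trans _ _ ((C * (ln n%:R / n%:R)) `^ (2 / d%:R))).
  apply: ge0_ler_powR => //; rewrite ?nnegrE ?exprn_ge0 ?(ltW h0)//.
  by rewrite mulr_ge0// ltW.
rewrite powRM// ?(ltW t0)// ler_wpM2l ?powR_ge0//; exact: ln_ratio_powR_le.
Qed.

End large.

Let r : R := Num.sqrt (2 ^+ d).

Let r0 : 0 < r. Proof. by rewrite sqrtr_gt0 exprn_gt0. Qed.

Let r2 : r ^+ 2 = 2 ^+ d. Proof. by rewrite sqr_sqrtr// exprn_ge0. Qed.

(** Level [k] has at most [r ^+ (2 * k.+1)] cells, hence an expected deviation of order [r ^+ k.+1]
    over the square root of the sample size. Weighted by the squared scale, the levels form a
    geometric series of ratio [r / 4], which crosses [1] exactly at [d = 4]. *)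
Definition scale_sum (K : nat) : R := r + r ^+ 2 * \sum_(k < K) (r / 4) ^+ k.

(** The series converges, its ratio being at most [3 / 4] because [2 ^+ 3] is below [9]. The depth
    may then be as large as [l] itself. *)
Lemma multiscale_rate_low : (d <= 3)%N -> forall l, 1 <= ln l%:R :> R ->
  4^-1 ^+ l + (Num.sqrt l%:R)^-1 * scale_sum l <= (1 + r + r ^+ 2 * 4) * rate l.
Proof.
move=> d3 l l1; have ln0 : 0 < l%:R :> R by apply: lt_trans (ln_ge1_gt1 l1).
have s0 : 0 < Num.sqrt l%:R :> R by rewrite sqrtr_gt0.
have -> : rate l = (Num.sqrt l%:R)^-1 by rewrite /emp_rate d3.
rewrite -addrA mulrDl mul1r [X in _ + X]mulrC; apply: lerD.
  apply: le_trans (inv_le_inv_sqrt l1).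
  rewrite exprVn lef_pV2 ?posrE ?exprn_gt0// -natrX ler_nat.
  by rewrite ltnW// ltn_expl.
rewrite ler_wpM2r ?invr_ge0 ?(ltW s0)// lerD2l ler_wpM2l ?sqr_ge0//.
have q1 : r / 4 <= 3 / 4.
  rewrite ler_pM2r ?invr_gt0// -(ler_sqr (_ : r \is Num.nneg)) ?nnegrE ?(ltW r0)// r2.
  apply: (@le_trans _ _ (2 ^+ 3)); last by rewrite -!natrX ler_nat.
  by rewrite ler_eXn2l// (ltr_nat R 1 2).
apply: (@le_trans _ _ (\sum_(k < l) (3 / 4) ^+ k)).
  by apply: ler_sum => k _; rewrite lerXn2r ?nnegrE ?divr_ge0 ?(ltW r0).
have : (3 / 4 - 1) * \sum_(k < l) (3 / 4) ^+ k = (3 / 4) ^+ l - 1 :> R.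
  by rewrite -subrX1.
have : 0 <= (3 / 4) ^+ l :> R by rewrite exprn_ge0.
lra.
Qed.

(** At ratio [1] every level contributes equally, and a depth logarithmic in [l] produces the extra
    logarithm of the rate. *)
Lemma multiscale_rate_critical : d = 4%N -> forall l, 1 <= ln l%:R :> R ->
  exists K, 4^-1 ^+ K + (Num.sqrt l%:R)^-1 * scale_sum K <=
    (8 + r + r ^+ 2 / ln 2) * rate l.
Proof.
move=> d4 l l1; have lgt1 := ln_ge1_gt1 l1.
have ln0 : 0 < l%:R :> R by exact: lt_trans lgt1.
have s0 : 0 < Num.sqrt l%:R :> R by rewrite sqrtr_gt0.
have [K /andP[K1 K2]] := @exists_pow_between 2 l%:R isT (ltW lgt1).
have ln20 : 0 < ln 2 :> R by rewrite ln_gt0// (ltr_nat R 1 2).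
have -> : rate l = (Num.sqrt l%:R)^-1 * ln l%:R by rewrite /emp_rate d4/= mulrC.
have r4 : r / 4 = 1.
  by rewrite /r d4 (_ : 2 ^+ 4 = 4 ^+ 2) ?sqrtr_sqr ?ger0_norm ?divff//; ring.
exists K.
have Kln : K%:R * ln 2 <= ln l%:R :> R.
  by rewrite mulr_natl -lnXn// ler_ln ?posrE ?exprn_gt0.
have h4 : 4^-1 ^+ K <= 8 * (Num.sqrt l%:R)^-1 :> R.
  rewrite exprVn ler_pdivlMr// mulrC ler_pdivrMr ?exprn_gt0//.
  have s1 : 1 <= Num.sqrt l%:R :> R by rewrite -[leLHS]sqrtr1 ler_wsqrtr// ltW.
  have sl : Num.sqrt l%:R <= l%:R :> R.
    by rewrite -[leRHS](sqr_sqrtr (ltW ln0)) expr2 ler_peMl// ltW.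
  have h24 : 2 ^+ K <= 4 ^+ K :> R by rewrite lerXn2r ?nnegrE// (ler_nat R 2 4).
  have p2 : 0 <= 2 ^+ K :> R by rewrite exprn_ge0.
  by rewrite exprS in K2; lra.
rewrite /scale_sum r4 (eq_bigr (fun=> 1)) => [|k _]; last by rewrite expr1n.
rewrite sumr_const card_ord.
have hK : K%:R <= ln l%:R / ln 2 :> R by rewrite ler_pdivlMr.
set v := (Num.sqrt l%:R)^-1 in h4 *; have v0 : 0 < v by rewrite invr_gt0.
have h5 : r ^+ 2 * K%:R <= r ^+ 2 / ln 2 * ln l%:R.
  by rewrite -mulrA [_^-1 * _]mulrC ler_wpM2l ?sqr_ge0.
have h6 : v * (r + r ^+ 2 * K%:R) <= v * (r * ln l%:R + r ^+ 2 / ln 2 * ln l%:R).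
  by rewrite ler_pM2l// lerD// ler_peMr// ltW.
have h7 : 8 * v <= 8 * v * ln l%:R by rewrite ler_peMr// mulr_ge0// ltW.
apply: (le_trans (lerD (le_trans h4 h7) h6)).
rewrite [leRHS](_ : _ = 8 * v * ln l%:R + v * (r * ln l%:R + r ^+ 2 / ln 2 * ln l%:R))//.
by ring.
Qed.

(** The finest level has about [l] cells. The ratio is at least [4 / 3], so the last term dominates
    the series, and divided by the square root of [l] it is at most the squared finest scale, of
    order [l] to the power [-2/d]. *)
Lemma multiscale_rate_high : (4 < d)%N -> forall l, 1 <= ln l%:R :> R ->
  exists K, 4^-1 ^+ K + (Num.sqrt l%:R)^-1 * scale_sum K <= (4 + r + r ^+ 2 * 12) * rate l.
Proof.
move=> d5 l l1; have lgt1 := ln_ge1_gt1 l1.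
have ln0 : 0 < l%:R :> R by exact: lt_trans lgt1.
have s0 : 0 < Num.sqrt l%:R :> R by rewrite sqrtr_gt0.
have b1 : (1 < 2 ^ d)%N by rewrite -(expn0 2) ltn_exp2l.
have [K /andP[K1 K2]] := @exists_pow_between (2 ^ d) l%:R b1 (ltW lgt1).
rewrite natrX in K1 K2.
have rateE : rate l = (l%:R `^ (2 / d%:R))^-1.
  rewrite /emp_rate leqNgt (ltnW d5)/= ifF; last by apply/negbTE; rewrite gtn_eqF.
  by rewrite mulNr powRN.
have h4 : 4^-1 ^+ K <= 4 * rate l :> R.
  rewrite rateE exprVn ler_pdivlMr ?powR_gt0// mulrC ler_pdivrMr ?exprn_gt0// -exprS.
  have -> : 4 ^+ K.+1 = ((2 ^+ K.+1) ^+ d) `^ (2 / d%:R) :> R.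
    by rewrite powR_expd ?exprn_ge0// exprAC; congr (_ ^+ _); ring.
  apply: ge0_ler_powR; rewrite ?nnegrE ?exprn_ge0 ?(ltW ln0) ?divr_ge0//.
  by rewrite exprAC ltW.
have q0 : 0 < r / 4 by rewrite divr_gt0.
have q43 : 4 / 3 <= r / 4.
  rewrite -(ler_sqr (_ : 4 / 3 \is Num.nneg)) ?nnegrE ?(ltW q0)// [(r / 4) ^+ 2]expr_div_n r2.
  have : 2 ^+ 5 <= 2 ^+ d :> R by rewrite ler_eXn2l// (ltr_nat R 1 2).
  lra.
have geo : \sum_(k < K) (r / 4) ^+ k <= 3 * (r / 4) ^+ K.
  have : (r / 4 - 1) * \sum_(k < K) (r / 4) ^+ k = (r / 4) ^+ K - 1 by rewrite -subrX1.
  have : 0 <= \sum_(k < K) (r / 4) ^+ k by apply: sumr_ge0 => k _; rewrite exprn_ge0// ltW.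
  move: q43 (\sum_(k < K) _) ((r / 4) ^+ K) => q43 S p S0 e.
  have : 1 / 3 * S <= (r / 4 - 1) * S by rewrite ler_wpM2r//; lra.
  lra.
have rK : r ^+ K <= Num.sqrt l%:R.
  rewrite -(ler_sqr (_ : r ^+ K \is Num.nneg)) ?nnegrE ?sqrtr_ge0 ?exprn_ge0 ?(ltW r0)//.
  by rewrite exprAC r2 sqr_sqrtr// ltW.
have hq : (Num.sqrt l%:R)^-1 * (r / 4) ^+ K <= 4^-1 ^+ K.
  rewrite exprMn mulrA ler_piMl ?exprn_ge0// mulrC ler_pdivrMr// mul1r//.
exists K; rewrite /scale_sum mulrDr addrCA addrC.
have h1 := ler_wpM2l (ltW r0) (inv_sqrt_le_emp_rate l1).
have h2 : (Num.sqrt l%:R)^-1 * (r ^+ 2 * \sum_(k < K) (r / 4) ^+ k) <= r ^+ 2 * (12 * rate l).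
  rewrite mulrCA ler_wpM2l ?sqr_ge0//.
  apply: (@le_trans _ _ ((Num.sqrt l%:R)^-1 * (3 * (r / 4) ^+ K))).
    by rewrite ler_wpM2l// invr_ge0 ltW.
  by rewrite mulrCA; lra.
rewrite [leRHS](_ : _ = 4 * rate l + r ^+ 2 * (12 * rate l) + r * rate l); last by ring.
by rewrite lerD ?lerD// mulrC.
Qed.

Lemma multiscale_rate : exists2 C : R, 0 < C & forall l, 1 <= ln l%:R :> R ->
  exists K, 4^-1 ^+ K + (Num.sqrt l%:R)^-1 * scale_sum K <= C * rate l.
Proof.
have [d3|d4] := leqP d 3.
  exists (1 + r + r ^+ 2 * 4) => [|l l1].
    by rewrite addr_gt0 ?addr_gt0 ?mulr_gt0 ?exprn_gt0.
  by exists l; exact: multiscale_rate_low.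
rewrite leq_eqVlt in d4; case/orP: d4 => [/eqP/esym d4|d5].
  exists (8 + r + r ^+ 2 / ln 2) => [|l l1]; last exact: multiscale_rate_critical.
  by rewrite addr_gt0 ?addr_gt0 ?divr_gt0 ?exprn_gt0// ln_gt0// (ltr_nat R 1 2).
exists (4 + r + r ^+ 2 * 12) => [|l l1]; last exact: multiscale_rate_high.
by rewrite addr_gt0 ?addr_gt0 ?mulr_gt0 ?exprn_gt0.
Qed.

End rates.
End scales.

(** [K] makes [(2 ^+ K) ^+ d] comparable with [n / (A * ln n)]. The factor [c] is left free because
    the covering argument uses the side of the cells divided by [d]. *)
Lemma cell_scale (R : realType) (d : nat) (A B : R) (n : nat) : (0 < d)%N -> 0 < A -> 0 < B ->
  1 <= ln n%:R :> R -> ln n%:R <= A^-1 * n%:R ->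
  exists K : nat, [/\ (2 ^+ K) ^+ d * A <= n%:R :> R,
    (4 * B / 2 ^+ K) ^+ d <= (8 * B) ^+ d * A * (ln n%:R / n%:R) &
    forall c, 0 < c -> (c * B) ^+ d * A * (ln n%:R / n%:R) <= (c * B / 2 ^+ K) ^+ d].
Proof.
move=> d0 A0 B0 n1 nA; have nn := ln_ge1_gt1 n1.
have n0 : 0 < n%:R :> R by exact: lt_trans nn.
have l0 : 0 < ln n%:R :> R by exact: lt_le_trans n1.
have b1 : (1 < 2 ^ d)%N by rewrite -(expn0 2) ltn_exp2l.
have y1 : 1 <= n%:R / (A * ln n%:R) by rewrite ler_pdivlMr ?mulr_gt0// mul1r mulrC -ler_pdivlMr// mulrC.
have [K /andP[K1 K2]] := @exists_pow_between R (2 ^ d) _ b1 y1.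
rewrite natrX in K1 K2; exists K.
have p0 : 0 < (2 ^+ K) ^+ d :> R by rewrite !exprn_gt0.
rewrite exprAC ler_pdivlMr ?mulr_gt0// in K1.
rewrite exprS exprAC ltr_pdivrMr ?mulr_gt0// in K2.
split.
- by apply: le_trans K1; rewrite mulrA ler_peMr// mulr_ge0// ltW.
- rewrite expr_div_n ler_pdivrMr// mulrA mulrAC ler_pdivlMr//.
  rewrite (_ : 8 * B = 2 * (4 * B)); last by ring.
  rewrite (exprMn d 2) -!mulrA [2 ^+ d * _]mulrCA ler_pM2l ?exprn_gt0 ?mulr_gt0//.
  by apply: (le_trans (ltW K2)); rewrite !mulrA; lra.
- move=> c c0; rewrite expr_div_n ler_pdivlMr// mulrA mulrAC ler_pdivrMr//.
  rewrite -!mulrA ler_pM2l ?exprn_gt0 ?mulr_gt0//.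
  by apply: le_trans K1; rewrite !mulrA; lra.
Qed.

Section covering_scale.
Context (R : realType) (d : nat) (d0 : (0 < d)%N).
Context dW (W : measurableType dW) (P : probability W R).
Local Notation E := 'rV[R]_d.
Local Notation leb := (lebesgue_rV R d).
Variables (Om : set E) (mu : {finite_measure set E -> \bar R}) (X : nat -> {RV P >-> E}).
Hypotheses (mOm : measurable Om) (M0 : 0 < mass Om mu).
Hypothesis X_law : forall i A, measurable A -> distribution P (X i) A = normalized Om mu A.
Hypothesis X_ind : mutually_independent X.
Variables (bmin bmax : R).
Hypotheses (bmin0 : 0 < bmin) (bmax0 : 0 < bmax).
Hypothesis dens_ge : forall A, measurable A -> (bmin%:E * leb (A `&` Om) <= normalized Om mu A)%E.
Hypothesis dens_le : forall A, measurable A -> (normalized Om mu A <= bmax%:E * leb (A `&` Om))%E.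
Variables (eps0 del0 : R).
Hypotheses (eps00 : 0 < eps0) (del00 : 0 < del0).
Hypothesis Om_reg : forall x (eps : R), Om x -> 0 < eps < eps0 ->
  (del0%:E * leb (eball x eps) <= leb (eball x eps `&` Om))%E.
Variable B : R.
Hypotheses (B0 : 0 < B) (OmB : forall x, Om x -> in_box B x).

(* The cells have side of order (ln n / n)^(1/d): each then contains a sample
   point with probability 1 - O(n^-2). *)
Lemma covering_scale : exists2 C : R, 0 < C & exists N : nat, forall n : nat, (N <= n)%N ->
  exists (U : set W) (h : R), [/\ measurable U, (P U <= (C / n%:R)%:E)%E,
    h ^+ 2 <= C * (ln n%:R * emp_rate R d n) &
    forall w, ~ U w ->
      (forall x, Om x -> exists2 i, (i < n)%N & enorm (x - X i w) <= h) /\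
      (forall i : 'I_n, Om (X i w) ->
        mu (voronoi (fun k : 'I_n => X k w) Om i) <= (C * (ln n%:R / n%:R))%:E)%E].
Proof.
have dR0 : 0 < d%:R :> R by rewrite ltr0n.
(* Chosen so that the exponent in [uncovered_prob] is at least [2 * ln n]: each cell then fails with
   probability at most [n ^ -2], and there are O(n) of them. *)
pose A := 2 / (bmin * del0 * (4 * B / d%:R) ^+ d).
have A'0 : 0 < bmin * del0 * (4 * B / d%:R) ^+ d.
  by rewrite mulr_gt0 ?mulr_gt0// exprn_gt0// divr_gt0// mulr_gt0.
have A0 : 0 < A by rewrite divr_gt0.
pose C1 := (8 * B) ^+ d * A.
have C10 : 0 < C1 by rewrite mulr_gt0// exprn_gt0// mulr_gt0.
pose C2 := ((d%:R + 1) ^+ d * C1) `^ (2 / d%:R).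
pose C3 := mass Om mu * (bmax * ((2 * (d%:R + 2)) ^+ d * C1)).
pose C4 := 2 ^+ d / A.
have C20 : 0 <= C2 by exact: powR_ge0.
have d2 : 0 < 2 * (d%:R + 2) :> R by rewrite mulr_gt0// addr_gt0.
have C30 : 0 < C3 by rewrite mulr_gt0// mulr_gt0// mulr_gt0// exprn_gt0.
have C40 : 0 < C4 by rewrite divr_gt0// exprn_gt0.
have C0 : 0 < C2 + C3 + C4 by rewrite addr_gt0// ltr_wpDl.
(* Once [ln n / n] is below this number, [h ^+ d] is at most half of [eps0 ^+ d], so (A2) applies at
   scale [h]. *)
have eps1 : 0 < eps0 ^+ d / (2 * C1) by rewrite divr_gt0 ?exprn_gt0// mulr_gt0.
exists (C2 + C3 + C4) => //.
have [N1 hN1] := ln_ge1_eventually R.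
have iA0 : 0 < A^-1 by rewrite invr_gt0.
have [N2 hN2] := ln_ratio_small iA0.
have [N3 hN3] := ln_ratio_small eps1.
exists (maxn N1 (maxn N2 N3)) => n; rewrite !geq_max => /and3P[/hN1 n1 /hN2 n2 /hN3 n3].
have nn := ln_ge1_gt1 n1.
have n0 : 0 < n%:R :> R by exact: lt_trans nn.
have l0 : 0 < ln n%:R :> R by exact: lt_le_trans n1.
have [K [K1 K2 K3]] := cell_scale d0 A0 B0 n1 n2.
set h := 4 * B / 2 ^+ K in K2.
have h0 : 0 < h by rewrite divr_gt0 ?mulr_gt0 ?exprn_gt0.
have heps : h < eps0.
  rewrite ltNge; apply/negP => hle.
  have := lerXn2r d (_ : eps0 \is Num.nneg) (_ : h \is Num.nneg) hle.
  rewrite !nnegrE => /(_ (ltW eps00) (ltW h0)) hd.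
  have e0 : 0 < eps0 ^+ d by rewrite exprn_gt0.
  have : C1 * (ln n%:R / n%:R) <= eps0 ^+ d / 2.
    rewrite mulrA ler_pdivrMr// mulrC -ler_pdivlMr//.
    by apply: (le_trans n3); rewrite invfM; lra.
  move: (le_trans hd K2); rewrite -/C1; move: (C1 * _) => u; lra.
exists (uncovered Om X B K n), ((d%:R + 1) * h); split.
- exact: uncovered_measurable.
- apply: (le_trans (uncovered_prob d0 X_law X_ind bmin0 dens_ge del00 Om_reg B0 n heps)).
  rewrite lee_fin.
  have pn : 2 * ln n%:R <= bmin * del0 * (h / d%:R) ^+ d * n%:R.
    have := K3 (4 / d%:R) (divr_gt0 (ltr0n R 4) dR0).
    rewrite (_ : 4 / d%:R * B = 4 * B / d%:R); last by ring.
    rewrite (_ : 4 * B / d%:R / 2 ^+ K = h / d%:R); last by rewrite /h; ring.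
    rewrite mulrA ler_pdivrMr// => K4.
    have := ler_wpM2l (ltW (mulr_gt0 bmin0 del00)) K4; rewrite !mulrA; apply: le_trans.
    by rewrite -[X in _ <= X * _]mulrAC divff ?mul1r// gt_eqF.
  have e2 : expR (- (bmin * del0 * (h / d%:R) ^+ d * n%:R)) <= (n%:R ^+ 2)^-1.
    apply: (@le_trans _ _ (expR (- (2 * ln n%:R)))); first by rewrite ler_expR lerN2.
    by rewrite expRN mulr_natl -lnXn// lnK// posrE exprn_gt0.
  apply: (@le_trans _ _ (C4 / n%:R)); last by rewrite ler_pM2r ?invr_gt0// lerDr addr_ge0// ltW.
  apply: (@le_trans _ _ ((2 ^+ d * (n%:R / A)) * (n%:R ^+ 2)^-1)).
    apply: ler_pM => //.
    rewrite natrM !natrX ler_wpM2l ?exprn_ge0// ler_pdivlMr//.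
  by rewrite /C4 le_eqVlt; apply/orP; left; apply/eqP; field; rewrite !gt_eqF.
- have hd : ((d%:R + 1) * h) ^+ d <= (d%:R + 1) ^+ d * C1 * (ln n%:R / n%:R).
    by rewrite exprMn -mulrA ler_wpM2l// exprn_ge0// addr_ge0// ltW.
  have hh : 0 < (d%:R + 1) * h by rewrite mulr_gt0// addr_gt0.
  have CC : 0 <= (d%:R + 1) ^+ d * C1 by rewrite mulr_ge0 ?(ltW C10)// exprn_ge0// addr_ge0// ltW.
  apply: (le_trans (bandwidth_sqr_le d0 n1 hh CC hd)).
  rewrite ler_wpM2r// ?mulr_ge0 ?(ltW l0) ?(ltW (emp_rate_gt0 _ n1))//.
  by rewrite -addrA lerDl addr_ge0// ltW.
- move=> w cov; split => [x Ox|i Oi]; first exact: (covered_near B0 OmB cov Ox).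
  apply: (le_trans (covered_voronoi_mass mOm M0 bmax0 dens_le B0 OmB cov Oi)).
  rewrite lee_fin -/h; apply: (@le_trans _ _ (C3 * (ln n%:R / n%:R))); last first.
    by rewrite ler_pM2r ?divr_gt0// addrAC lerDr addr_ge0// ltW.
  rewrite (_ : C3 * _ = mass Om mu * (bmax * ((2 * (d%:R + 2)) ^+ d * (C1 * (ln n%:R / n%:R))))); last first.
    by rewrite /C3; ring.
  rewrite ler_pM2l// ler_pM2l// mulrA exprMn ler_pM2l ?exprn_gt0//; exact: K2.
Qed.

End covering_scale.

(** * The expected risk *)

Section multiscale_deviation.
Context (R : realType) (d : nat) (d0 : (0 < d)%N).
Context dW (W : measurableType dW) (P : probability W R).
Local Notation E := 'rV[R]_d.
Local Notation Ex g := (Rintegral P setT g).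
Variables (Om : set E) (mu : {finite_measure set E -> \bar R}) (X : nat -> {RV P >-> E}).
Hypotheses (mOm : measurable Om).
Hypothesis X_law : forall i A, measurable A -> distribution P (X i) A = normalized Om mu A.
Hypothesis X_ind : mutually_independent X.
Variables (u : E -> R) (H : R).
Hypotheses (mu_meas : measurable_fun Om u) (uH : forall x, Om x -> 0 <= u x <= H) (H0 : 0 <= H).
Variable c : forall k, E -> {ffun 'I_d -> 'I_(2 ^ k).+1}.
Hypothesis mc : forall k q, measurable [set x | c k x = q].
Variables (n : nat) (n0 : (0 < n)%N).

Local Notation dev k := (label_deviation Om X u (c k) n).

Definition multiscale_deviation (K : nat) (w : W) : R :=
  \sum_(k < K) 4^-1 ^+ k * dev k.+1 w + dev 0 w.

Let bdev k : bounded_mfun setT (dev k).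
Proof. exact: (bounded_mfun_label_deviation X mOm mu_meas uH H0 (@mc k)). Qed.

Lemma bounded_mfun_multiscale_deviation K : bounded_mfun setT (multiscale_deviation K).
Proof.
apply: bounded_mfunD => //; apply: bounded_mfun_sum => k.
by apply: bounded_mfunM => //; exact: bounded_mfun_cst.
Qed.

Lemma multiscale_deviation_expectation K :
  Ex (multiscale_deviation K) <= (H ^+ 2 + 1) / 2 * ((Num.sqrt n%:R)^-1 * scale_sum R d K).
Proof.
pose r : R := Num.sqrt (2 ^+ d).
have one k : Ex (dev k) <= (H ^+ 2 + 1) / 2 * ((Num.sqrt n%:R)^-1 * r ^+ k.+1).
  have N0 : (0 < 2 ^ d * (2 ^ k) ^ d)%N by rewrite muln_gt0 !expn_gt0.
  apply: (le_trans (label_deviation_expectation mOm X_law X_ind mu_meas uH H0 (@mc k) n0 N0 (card_cell d k))).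
  rewrite ler_wpM2l ?divr_ge0 ?addr_ge0 ?sqr_ge0//.
  rewrite (_ : _%:R = (r ^+ k.+1) ^+ 2); last first.
    by rewrite natrM !natrX [RHS]exprAC /r sqr_sqrtr ?exprn_ge0// exprS; congr (_ * _); rewrite exprAC.
  by rewrite sqrtrM ?sqr_ge0// sqrtr_sqr ger0_norm ?exprn_ge0 ?sqrtr_ge0// sqrtrV// mulrC.
have b4 k : bounded_mfun setT (fun w => 4^-1 ^+ k * dev k.+1 w).
  by apply: bounded_mfunM => //; exact: bounded_mfun_cst.
have bP g : bounded_mfun setT g -> P.-integrable setT (EFin \o g).
  by move=> bg; exact: bounded_mfun_integrable.
rewrite RintegralD//; [|exact/bP/bounded_mfun_sum|exact/bP].
rewrite Rintegral_sum//.
have -> : (H ^+ 2 + 1) / 2 * ((Num.sqrt n%:R)^-1 * scale_sum R d K) =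
    \sum_(k < K) 4^-1 ^+ k * ((H ^+ 2 + 1) / 2 * ((Num.sqrt n%:R)^-1 * r ^+ k.+2)) +
    (H ^+ 2 + 1) / 2 * ((Num.sqrt n%:R)^-1 * r ^+ 1).
  rewrite /scale_sum -/r expr1 !mulrDr [LHS]addrC; congr (_ + _).
  rewrite !mulr_sumr; apply: eq_bigr => k _.
  rewrite [(r / 4) ^+ k]exprMn (_ : r ^+ k.+2 = r ^+ 2 * r ^+ k); last by rewrite -exprD.
  by move: (r ^+ k) (4^-1 ^+ k) => p q; ring.
apply: lerD; last exact: one.
apply: ler_sum => k _; rewrite RintegralZl//; last exact/bP.
by rewrite ler_wpM2l ?exprn_ge0.
Qed.

End multiscale_deviation.

Lemma sum_lin4 (R : pzRingType) (I : Type) (s : seq I) (a b p q : R) (A B A' B' : I -> R) :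
  \sum_(i <- s) (a * A i + b * B i + (p * A' i + q * B' i)) =
  a * \sum_(i <- s) A i + b * \sum_(i <- s) B i +
  (p * \sum_(i <- s) A' i + q * \sum_(i <- s) B' i).
Proof. by rewrite !big_split/= !mulr_sumr. Qed.

Section discrepancy_bound.
Context (R : realType) (d : nat).
Context dW (W : measurableType dW) (P : probability W R).
Local Notation E := 'rV[R]_d.
Variables (Om : set E) (f : E -> R) (mu nu : {finite_measure set E -> \bar R}).
Local Notation Z := (argmin_cost Om f).
Local Notation psi y := (fine (c_transform Om f y)).
Hypothesis mOm : measurable Om.
Hypotheses (M0 : 0 < mass Om mu) (N0 : 0 < mass Om nu).
Variables (X Y : nat -> {RV P >-> E}).
Hypothesis X_law : forall i A, measurable A -> distribution P (X i) A = normalized Om mu A.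
Hypothesis Y_law : forall i A, measurable A -> distribution P (Y i) A = normalized Om nu A.
Hypothesis balance : forall A, measurable A ->
  (\int[mu]_(x in Om `&` A) (expR (- f x))%:E =
   \int[nu]_(y in Om `&` Z @^-1` A) (expR (- psi y))%:E)%E.
Hypothesis mZ : measurable_fun setT (Z : E -> E).
Variable H : R.
Hypotheses (H0 : 0 <= H) (mf : measurable_fun Om (fun x => expR (- f x)))
  (mpsi : measurable_fun Om (fun y => expR (- psi y)))
  (fH : forall x, Om x -> 0 <= expR (- f x) <= H)
  (psiH : forall y, Om y -> 0 <= expR (- psi y) <= H).
Variables (B : R) (n m : nat).
Hypotheses (n0 : (0 < n)%N) (m0 : (0 < m)%N).
Variables (w : W) (Mx My : R).
Hypotheses (XOm : forall i, Om (X i w)) (YOm : forall j, Om (Y j w)).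

Lemma measurable_cell_argmin k q : measurable [set y | cell B k (Z y) = q].
Proof.
rewrite -[X in measurable X]setTI.
exact: (mZ measurableT (measurable_cell B q)).
Qed.

Local Notation devX k := (label_deviation Om X (fun x => expR (- f x)) (cell B k) n w).
Local Notation devY k :=
  (label_deviation Om Y (fun y => expR (- psi y)) (fun y => cell B k (Z y)) m w).

Lemma cell_discrepancy_le k :
  cell_discrepancy Om f B (fun i : 'I_n => X i w) (fun j : 'I_m => Y j w) Mx My k <=
  H * (`|Mx - mass Om mu| + `|My - mass Om nu|) +
  (mass Om mu * devX k + mass Om nu * devY k).
Proof.
rewrite /cell_discrepancy /block_discrepancy.
pose u x := expR (- f x); pose v y := expR (- psi y).
pose c : E -> _ := cell B k; pose c' y := cell B k (Z y).
have mc q : measurable [set x | c x = q] by exact: measurable_cell.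
have mc' q : measurable [set x | c' x = q] by exact: measurable_cell_argmin.
under eq_bigr => q _.
  rewrite (sum_label_empirical_mean u c Mx q (fun i _ => XOm i)).
  rewrite (sum_label_empirical_mean v c' My q (fun i _ => YOm i)).
  over.
have em_ge0 (Q : finType) (X' : nat -> {RV P >-> E}) u' (c'' : E -> Q) n' q :
    (forall x, Om x -> 0 <= u' x <= H) ->
    0 <= empirical_mean n' X' (label_part Om u' c'' q) w.
  move=> u'H; rewrite mulr_ge0 ?invr_ge0//; apply: sumr_ge0 => i _.
  by have /andP[] := label_part_bounds u'H H0 c'' q (X' i w).
(* Mass balance on the cell [q]: both weighted samples have the same expected mass there. *)
have bal q : mass Om mu * Rintegral P setT (fun w => label_part Om u c q (X 0 w)) =
    mass Om nu * Rintegral P setT (fun w => label_part Om v c' q (Y 0 w)).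
  apply: EFin_inj.
  rewrite (label_part_expectation mOm M0 X_law mf fH H0 mc).
  rewrite (label_part_expectation mOm N0 Y_law mpsi psiH H0 mc').
  exact: (balance (mc q)).
apply: (le_trans (ler_sum _ (fun q _ => discrepancy_term_le Mx My (bal q) (ltW M0) (ltW N0)
  (em_ge0 _ X u c n q fH) (em_ge0 _ Y v c' m q psiH)))).
rewrite sum_lin4; apply: lerD; last exact: lexx.
rewrite mulrDr; apply: lerD; rewrite mulrC ler_wpM2r//.
  by apply: (sum_empirical_mean_label fH).
by apply: (sum_empirical_mean_label psiH).
Qed.

Lemma discrepancy_sum_le K : Mx <= 2 * mass Om mu ->
  discrepancy_sum Om f B (fun i : 'I_n => X i w) (fun j : 'I_m => Y j w) Mx My K <=
  2 * mass Om mu * H * 4^-1 ^+ K + 3 * H * (`|Mx - mass Om mu| + `|My - mass Om nu|) +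
  (mass Om mu * multiscale_deviation Om X (fun x => expR (- f x)) (fun k => cell B k) n K w +
   mass Om nu * multiscale_deviation Om Y (fun y => expR (- psi y))
     (fun k y => cell B k (Z y)) m K w).
Proof.
move=> Mx2; rewrite /discrepancy_sum.
set D := H * (`|Mx - mass Om mu| + `|My - mass Om nu|).
have D0 : 0 <= D by rewrite mulr_ge0// addr_ge0.
have s1 : \sum_(i < n) Mx / n%:R * expR (- f (X i w)) <= 2 * mass Om mu * H.
  rewrite -mulr_sumr; have nR : 0 < n%:R :> R by rewrite ltr0n.
  have h : \sum_(i < n) expR (- f (X i w)) <= n%:R * H.
    have -> : n%:R * H = \sum_(i < n) H by rewrite sumr_const card_ord mulr_natl.
    by apply: ler_sum => i _; have /andP[] := fH (XOm i).
  have h0 : 0 <= \sum_(i < n) expR (- f (X i w)) by apply: sumr_ge0 => i _; exact: expR_ge0.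
  rewrite mulrAC ler_pdivrMr//.
  apply: (@le_trans _ _ (2 * mass Om mu * \sum_(i < n) expR (- f (X i w)))).
    by rewrite ler_wpM2r.
  by rewrite -[leRHS]mulrA [H * _]mulrC ler_wpM2l// mulr_ge0// ltW.
(* The mass-estimation error [D] occurs once per level. This sum and the level-0 term give the
   factor [3]. *)
have geo : \sum_(k < K) 4^-1 ^+ k <= 2 :> R.
  have : (4^-1 - 1) * \sum_(k < K) 4^-1 ^+ k = 4^-1 ^+ K - 1 :> R by rewrite -subrX1.
  have : 0 <= 4^-1 ^+ K :> R by rewrite exprn_ge0.
  lra.
pose F k := mass Om mu * devX k + mass Om nu * devY k.
have s2 : \sum_(k < K) 4^-1 ^+ k * cell_discrepancy Om f B (fun i : 'I_n => X i w)
    (fun j : 'I_m => Y j w) Mx My k.+1 <= 2 * D + \sum_(k < K) 4^-1 ^+ k * F k.+1.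
  apply: (@le_trans _ _ (\sum_(k < K) (4^-1 ^+ k * D + 4^-1 ^+ k * F k.+1))).
    by apply: ler_sum => k _; rewrite -mulrDr ler_wpM2l ?exprn_ge0// cell_discrepancy_le.
  by rewrite big_split/= lerD2r -mulr_suml ler_wpM2r.
have s3 := cell_discrepancy_le 0; rewrite -/D -/(F 0%N) in s3.
have s4 : 4^-1 ^+ K * \sum_(i < n) Mx / n%:R * expR (- f (X i w)) <= 2 * mass Om mu * H * 4^-1 ^+ K.
  by rewrite mulrC ler_wpM2r// exprn_ge0.
apply: (le_trans (lerD (lerD s4 s2) s3)).
rewrite (_ : 3 * H * (`|Mx - mass Om mu| + `|My - mass Om nu|) = 3 * D); last by rewrite /D mulrA.
have -> : mass Om mu * multiscale_deviation Om X (fun x => expR (- f x)) (fun k => cell B k) n K w +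
   mass Om nu * multiscale_deviation Om Y (fun y => expR (- psi y))
     (fun k y => cell B k (Z y)) m K w = \sum_(k < K) 4^-1 ^+ k * F k.+1 + F 0%N.
  rewrite /multiscale_deviation /F !mulrDr addrACA !mulr_sumr -big_split/=; congr (_ + _).
  by apply: eq_bigr => k _; rewrite mulrDr; congr (_ + _); rewrite mulrCA.
by move: (F 0%N) (\sum_(k < K) _ * F _) (2 * mass Om mu * H * _) => p q s; lra.
Qed.

End discrepancy_bound.

Lemma relative_error_bounds (R : realFieldType) (a b : R) :
  0 < a -> 2 / a * `|b - a| < 1 -> a / 2 < b < 2 * a.
Proof.
move=> a0; rewrite mulrAC ltr_pdivrMr// mul1r -ltr_pdivlMl// mulrC ltr_norml => /andP[h1 h2].
by apply/andP; split; lra.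
Qed.

(** [sn], [sm] and [sl] stand for the inverse square roots of [n], [m] and their minimum, [e] and
    [S] for the finest squared scale and the scale sum at a depth adapted to the minimum. The
    inverse masses convert plain rates into rates weighted by [Mu] and [Nu]. *)
Lemma risk_constant_arith (R : realType)
  (A' H c c0 D0 C Cr Mu Nu iM iN a b rn rm rl L e sn sm sl S n1 h2 : R) :
  0 < Mu -> 0 < Nu -> Mu * iM = 1 -> Nu * iN = 1 -> 0 <= A' -> 0 <= H -> 0 <= c -> 0 <= c0 ->
  0 <= D0 -> 0 <= C -> 0 <= Cr -> 0 <= a -> 0 <= b -> 0 <= rn -> 0 <= rm -> 1 <= L ->
  0 <= e -> 0 <= S -> 0 <= sn -> 0 <= sm ->
  sn <= sl -> sm <= sl -> e + sl * S <= Cr * rl -> rl <= rn + rm -> n1 <= rn -> h2 <= C * (L * rn) ->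
  A' * L * (2 * Mu * H * e + 3 * H * (a + b) + c * (Mu * (sn * S) + Nu * (sm * S))) +
  c0 * h2 * Mu + D0 * Mu * (C * n1 + (2 * iM * a + 2 * iN * b)) <=
  (A' * ((2 * Mu * H + c * (Mu + Nu)) * Cr * (iM + iN) + 3 * H) + c0 * Mu * C * (iM + iN) +
   D0 * Mu * C * (iM + iN) + 2 * D0 * Mu * (iM + iN) + 1) * L * (Mu * rn + Nu * rm + a + b).
Proof.
move=> M0 N0 eM eN A0 H0 c_ge0 c00 D00 C0 Cr0 a0 b0 rn0 rm0 L1 e0 S0 sn0 sm0 snl sml hK hl hn hh.
have iM0 : 0 <= iM by rewrite -(pmulr_rge0 _ M0) eM.
have iN0 : 0 <= iN by rewrite -(pmulr_rge0 _ N0) eN.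
have L0 : 0 <= L by exact: le_trans L1.
set D := Mu * rn + Nu * rm + a + b.
have Mr0 : 0 <= Mu * rn by rewrite mulr_ge0// ltW.
have Nr0 : 0 <= Nu * rm by rewrite mulr_ge0// ltW.
have D0' : 0 <= D by rewrite !addr_ge0.
have abD : a + b <= D by rewrite /D; lra.
have rD : rn + rm <= (iM + iN) * D.
  have -> : (iM + iN) * D = (Mu * iM) * rn + (Nu * iN) * rm + iN * (Mu * rn) + iM * (Nu * rm) +
      (iM + iN) * (a + b) by rewrite /D; ring.
  rewrite eM eN !mul1r; have := mulr_ge0 iN0 Mr0; have := mulr_ge0 iM0 Nr0.
  have := mulr_ge0 (addr_ge0 iM0 iN0) (addr_ge0 a0 b0); lra.
have i0 : 0 <= iM + iN by exact: addr_ge0.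
have rnD : rn <= (iM + iN) * D by lra.
have eS : e + sl * S <= Cr * ((iM + iN) * D).
  by apply: (le_trans hK); rewrite ler_wpM2l//; lra.
have LD : D <= L * D by rewrite ler_peMl.
have sS : sn * S <= sl * S by rewrite ler_wpM2r.
have sS' : sm * S <= sl * S by rewrite ler_wpM2r.
have sl0 : 0 <= sl * S by rewrite mulr_ge0// (le_trans sn0).
have h1 : 2 * Mu * H * e + 3 * H * (a + b) + c * (Mu * (sn * S) + Nu * (sm * S)) <=
    ((2 * Mu * H + c * (Mu + Nu)) * Cr * (iM + iN) + 3 * H) * D.
  have q0 : 0 <= 2 * Mu * H + c * (Mu + Nu).
    by rewrite addr_ge0// ?mulr_ge0 ?addr_ge0 ?(ltW M0) ?(ltW N0).
  apply: (@le_trans _ _ ((2 * Mu * H + c * (Mu + Nu)) * (e + sl * S) + 3 * H * D)).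
    have k1 : 3 * H * (a + b) <= 3 * H * D by rewrite ler_wpM2l// mulr_ge0.
    have k2 : c * (Mu * (sn * S) + Nu * (sm * S)) <= c * (Mu + Nu) * (sl * S).
      rewrite -mulrA ler_wpM2l// mulrDl.
      by apply: lerD; rewrite ler_wpM2l// ltW.
    have k3 : 0 <= 2 * Mu * H * (sl * S) by apply: mulr_ge0 => //; rewrite !mulr_ge0 ?(ltW M0).
    have k4 : 0 <= c * (Mu + Nu) * e by rewrite !mulr_ge0 ?addr_ge0 ?(ltW M0) ?(ltW N0).
    by rewrite mulrDl !mulrDr; move: k1 k2 k3 k4; rewrite !mulrDr; lra.
  rewrite [leRHS]mulrDl lerD2r.
  by apply: (le_trans (ler_wpM2l q0 eS)); rewrite !mulrA.
have h2' : c0 * h2 * Mu <= c0 * Mu * C * (iM + iN) * (L * D).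
  rewrite [leLHS]mulrAC -[leRHS]mulrA -[leRHS]mulrA ler_wpM2l ?mulr_ge0 ?(ltW M0)//.
  apply: (le_trans hh); rewrite ler_wpM2l// mulrCA ler_wpM2l//.
have h3 : D0 * Mu * (C * n1 + (2 * iM * a + 2 * iN * b)) <=
    (D0 * Mu * C * (iM + iN) + 2 * D0 * Mu * (iM + iN)) * (L * D).
  have DM : 0 <= D0 * Mu by rewrite mulr_ge0// ltW.
  have -> : (D0 * Mu * C * (iM + iN) + 2 * D0 * Mu * (iM + iN)) * (L * D) =
      D0 * Mu * (C * ((iM + iN) * (L * D)) + 2 * ((iM + iN) * (L * D))) by ring.
  rewrite ler_wpM2l//; apply: lerD.
    rewrite ler_wpM2l//; apply: (le_trans hn); apply: (le_trans rnD); exact: ler_wpM2l.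
  have k1 : (iM + iN) * (a + b) <= (iM + iN) * (L * D) by rewrite ler_wpM2l// (le_trans abD).
  have := mulr_ge0 iM0 b0; have := mulr_ge0 iN0 a0; move: k1; rewrite !mulrDr !mulrDl; lra.
have h1' : A' * L * (2 * Mu * H * e + 3 * H * (a + b) + c * (Mu * (sn * S) + Nu * (sm * S))) <=
    A' * ((2 * Mu * H + c * (Mu + Nu)) * Cr * (iM + iN) + 3 * H) * (L * D).
  apply: (le_trans (ler_wpM2l (mulr_ge0 A0 L0) h1)).
  by rewrite le_eqVlt; apply/orP; left; apply/eqP; ring.
have LD0 : 0 <= L * D by rewrite mulr_ge0.
apply: (le_trans (lerD (lerD h1' h2') h3)).
by rewrite -[leRHS]mulrA [leRHS]mulrDl mul1r !mulrDl; lra.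
Qed.

(** * Risk of a generic nearest-neighbour estimator *)

Section plan_estimator.
Context (R : realType) (d : nat) (d0 : (0 < d)%N).
Context dW (W : measurableType dW) (P : probability W R).
Local Notation E := 'rV[R]_d.
Local Notation leb := (lebesgue_rV R d).
Variables (Om : set E) (f : E -> R) (mu nu : {finite_measure set E -> \bar R}).
Local Notation Z := (argmin_cost Om f).
Local Notation psi y := (fine (c_transform Om f y)).
Local Notation rate := (emp_rate R d).
Local Notation Mu := (mass Om mu).
Local Notation Nu := (mass Om nu).
Hypothesis mOm : measurable Om.
Hypotheses (M0 : 0 < Mu) (N0 : 0 < Nu).
Hypothesis mu_ac : forall A, measurable A -> leb A = 0%E -> mu A = 0%E.
Variables (X Y : nat -> {RV P >-> E}).
Hypothesis X_law : forall i A, measurable A -> distribution P (X i) A = normalized Om mu A.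
Hypothesis Y_law : forall i A, measurable A -> distribution P (Y i) A = normalized Om nu A.
Hypotheses (X_ind : mutually_independent X) (Y_ind : mutually_independent Y).
Hypothesis balance : forall A, measurable A ->
  (\int[mu]_(x in Om `&` A) (expR (- f x))%:E =
   \int[nu]_(y in Om `&` Z @^-1` A) (expR (- psi y))%:E)%E.
Hypothesis mZ : measurable_fun setT (Z : E -> E).
Variable H : R.
Hypotheses (H0 : 0 <= H) (mf : measurable_fun Om (fun x => expR (- f x)))
  (mpsi : measurable_fun Om (fun y => expR (- psi y)))
  (fH : forall x, Om x -> 0 <= expR (- f x) <= H)
  (psiH : forall y, Om y -> 0 <= expR (- psi y) <= H).
Variable B : R.
Variable good : set W.
Hypotheses (good_negligible : P.-negligible (~` good))
  (goodX : forall w, good w -> forall i, Om (X i w))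
  (goodY : forall w, good w -> forall j, Om (Y j w))
  (good_distinct : forall w, good w -> forall i k, i != k -> X i w <> X k w).
Variables (Mmu Mnu : nat -> {RV P >-> R}).

(** Both risks are treated at once: [F] holds the estimates at the sample points, [t] bounds their
    error there, [c0] measures the variation of the target, and [D0] bounds the loss on every good
    outcome. *)
Variables (V : nmodType) (F : forall n : nat, nat -> W -> 'I_n -> V) (loss : V -> E -> R)
  (t : forall n : nat, nat -> W -> 'I_n -> R) (D0 c0 T : R).
Arguments F : clear implicits.
Arguments t : clear implicits.
Hypotheses (D00 : 0 <= D0) (c00 : 0 <= c0) (T0 : 0 <= T)
  (loss_ge0 : forall z x, Om x -> 0 <= loss z x)
  (t_ge0 : forall n m w i, 0 <= t n m w i)
  (loss_le : forall n m w i x, good w -> Om x -> loss (F n m w i) x <= D0)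
  (loss_near : forall n m w i x, good w -> Om x ->
    loss (F n m w i) x <= t n m w i + c0 * enorm (x - X i w) ^+ 2)
  (t_sum : forall n m w K, (0 < n)%N -> (0 < m)%N -> good w -> 0 < Mmu n w -> 0 < Mnu m w ->
    \sum_i Mmu n w / n%:R * t n m w i <=
    T * discrepancy_sum Om f B (fun i : 'I_n => X i w) (fun j : 'I_m => Y j w)
      (Mmu n w) (Mnu m w) K).

Local Notation SX n K := (multiscale_deviation Om X (fun x => expR (- f x)) (fun k => cell B k) n K).
Local Notation SY m K := (multiscale_deviation Om Y (fun y => expR (- psi y))
     (fun k y => cell B k (Z y)) m K).
Local Notation risk n m w :=
  (\int[mu]_(x in Om) (loss (nn_extension (fun i : 'I_n => X i w) Om (F n m w) x) x)%:E)%E.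

Lemma risk_crude n m w : (0 < n)%N -> good w -> (risk n m w <= (D0 * Mu)%:E)%E.
Proof.
move=> n0 gw.
have Xinj (i k : 'I_n) : i != k -> X i w <> X k w by move=> ik; exact: good_distinct.
apply: (le_trans (nn_integral_le mOm mu_ac n0 Xinj (F := F n m w) (loss := loss)
  (t := fun=> 0) (v := Mu) (c := D0) loss_ge0 _ _ _ _)) => //.
- move=> i; rewrite /mass fineK ?fin_num_measure//; apply: le_measure; rewrite ?inE//.
    exact: voronoi_measurable.
  by move=> x [].
- by move=> i x [Ox _]; rewrite add0r; exact: loss_le.
by rewrite big1// mulr0 add0r.
Qed.

(** Each Voronoi cell has mass at most [C * ln n / n], while the empirical weight [Mmu n w / n] is
    at least [Mu / (2 * n)]. Their ratio is where the logarithm and the factor [2 / Mu] come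
    from. *)
Lemma risk_fine n m w K C h : (0 < n)%N -> (0 < m)%N -> good w -> 0 <= C -> 0 <= ln n%:R :> R ->
  (forall x, Om x -> exists2 i, (i < n)%N & enorm (x - X i w) <= h) ->
  (forall i : 'I_n, Om (X i w) ->
    mu (voronoi (fun k : 'I_n => X k w) Om i) <= (C * (ln n%:R / n%:R))%:E)%E ->
  Mu / 2 <= Mmu n w -> Mmu n w <= 2 * Mu -> 0 < Mnu m w ->
  (risk n m w <= (2 * C * T / Mu * ln n%:R *
    (2 * Mu * H * 4^-1 ^+ K + 3 * H * (`|Mmu n w - Mu| + `|Mnu m w - Nu|) +
     (Mu * SX n K w + Nu * SY m K w)) + c0 * h ^+ 2 * Mu)%:E)%E.
Proof.
move=> n0 m0 gw C0 l0 near vor Mlo Mhi My0.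
have Xinj (i k : 'I_n) : i != k -> X i w <> X k w by move=> ik; exact: good_distinct.
have Mx0 : 0 < Mmu n w by apply: lt_le_trans Mlo; rewrite divr_gt0.
have nR : 0 < n%:R :> R by rewrite ltr0n.
apply: (le_trans (nn_integral_le mOm mu_ac n0 Xinj (F := F n m w) (loss := loss)
  (t := t n m w) (v := C * (ln n%:R / n%:R)) (c := c0 * h ^+ 2) loss_ge0 _ _ _ _)) => //.
- by rewrite mulr_ge0 ?sqr_ge0.
- by move=> i; apply: vor; exact: goodX.
- move=> i x [Ox hx]; apply: (le_trans (loss_near m i gw Ox)); rewrite lerD2l ler_wpM2l//.
  have [k kn xk] := near x Ox.
  have hik : enorm (x - X i w) <= enorm (x - X k w).
    have [<-//|ki] := eqVneq (Ordinal kn) i.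
    exact: (hx (Ordinal kn) ki).
  have hh := le_trans hik xk.
  by rewrite ler_sqr ?nnegrE ?enorm_ge0// (le_trans (enorm_ge0 _) hh).
rewrite lee_fin lerD2r.
have S0 : 0 <= \sum_i t n m w i by apply: sumr_ge0.
set D := (_ + _ * (_ + _) + _).
have tD : Mmu n w / n%:R * \sum_i t n m w i <= T * D.
  rewrite mulr_sumr; apply: (le_trans (t_sum K n0 m0 gw Mx0 My0)).
  rewrite ler_wpM2l//.
  apply: (discrepancy_sum_le mOm M0 N0 X_law Y_law balance mZ H0 mf mpsi fH psiH) => //.
    exact: goodX.
  exact: goodY.
have tD2 : Mu / 2 / n%:R * \sum_i t n m w i <= T * D.
  by apply: le_trans tD; rewrite ler_wpM2r// ler_pM2r ?invr_gt0.
have {tD2} tD2 : n%:R^-1 * \sum_i t n m w i <= 2 / Mu * (T * D).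
  rewrite -(ler_pM2l (_ : 0 < Mu / 2)) ?divr_gt0// mulrA; apply: (le_trans tD2).
  by rewrite mulrA (_ : Mu / 2 * (2 / Mu) = 1) ?mul1r//; field; rewrite gt_eqF.
have := ler_wpM2l (mulr_ge0 C0 l0) tD2; rewrite mulrA => h1.
rewrite (_ : C * (ln n%:R / n%:R) = C * ln n%:R * n%:R^-1); last by rewrite mulrA.
apply: (le_trans h1).
by rewrite le_eqVlt; apply/orP; left; apply/eqP; move: (D) (Mu^-1) => p q; ring.
Qed.

(** One bound for all good outcomes. If the bracket multiplying [D0 * Mu] is below [1], then [w] is
    outside [U] and both mass estimates are within a factor two, so [risk_fine] applies; otherwise
    that term alone exceeds the crude bound. *)
Lemma risk_le n m w K C h (U : set W) : (0 < n)%N -> (0 < m)%N -> good w ->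
  0 <= C -> 0 <= ln n%:R :> R ->
  (~ U w -> (forall x, Om x -> exists2 i, (i < n)%N & enorm (x - X i w) <= h) /\
    (forall i : 'I_n, Om (X i w) ->
      mu (voronoi (fun k : 'I_n => X k w) Om i) <= (C * (ln n%:R / n%:R))%:E)%E) ->
  (risk n m w <= (2 * C * T / Mu * ln n%:R *
    (2 * Mu * H * 4^-1 ^+ K + 3 * H * (`|Mmu n w - Mu| + `|Mnu m w - Nu|) +
     (Mu * SX n K w + Nu * SY m K w)) + c0 * h ^+ 2 * Mu +
     D0 * Mu * (\1_U w + (2 / Mu * `|Mmu n w - Mu| + 2 / Nu * `|Mnu m w - Nu|)))%:E)%E.
Proof.
move=> n0 m0 gw C0 l0 cov.
have S0 k (q : nat -> {RV P >-> E}) u (c : forall k, E -> {ffun 'I_d -> 'I_(2 ^ k).+1}) :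
    0 <= multiscale_deviation Om q u c k K w.
  by apply: addr_ge0; apply: sumr_ge0 => i _ //; rewrite mulr_ge0 ?exprn_ge0// sumr_ge0.
have A0 : 0 <= 2 * C * T / Mu * ln n%:R *
    (2 * Mu * H * 4^-1 ^+ K + 3 * H * (`|Mmu n w - Mu| + `|Mnu m w - Nu|) +
     (Mu * SX n K w + Nu * SY m K w)).
  apply: mulr_ge0.
    by rewrite mulr_ge0// divr_ge0 ?(ltW M0)// !mulr_ge0.
  have e0 : 0 <= 4^-1 ^+ K :> R by rewrite exprn_ge0.
  have := mulr_ge0 (ltW M0) (S0 n X _ (fun k => cell B k)).
  have := mulr_ge0 (ltW N0) (S0 m Y _ (fun k y => cell B k (Z y))).
  by move=> h1 h2; rewrite addr_ge0 ?addr_ge0 ?mulr_ge0 ?(ltW M0) ?(ltW N0).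
have A1 : 0 <= c0 * h ^+ 2 * Mu by rewrite mulr_ge0 ?(ltW M0)// mulr_ge0 ?sqr_ge0.
have DM : 0 <= D0 * Mu by rewrite mulr_ge0 ?(ltW M0).
have x0 : 0 <= 2 / Mu * `|Mmu n w - Mu| by rewrite mulr_ge0// divr_ge0// ltW.
have y0 : 0 <= 2 / Nu * `|Mnu m w - Nu| by rewrite mulr_ge0// divr_ge0// ltW.
have u0 : 0 <= \1_U w :> R by [].
have [bad|nbad] := pselect (1 <= \1_U w + (2 / Mu * `|Mmu n w - Mu| + 2 / Nu * `|Mnu m w - Nu|)).
  apply: (le_trans (risk_crude m n0 gw)); rewrite lee_fin.
  apply: (@le_trans _ _ (D0 * Mu * 1)); first by rewrite mulr1.
  by apply: (le_trans (ler_wpM2l DM bad)); rewrite lerDr addr_ge0.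
have {nbad} nbad : \1_U w + (2 / Mu * `|Mmu n w - Mu| + 2 / Nu * `|Mnu m w - Nu|) < 1.
  by rewrite ltNge; apply/negP.
have nU : ~ U w.
  move=> Uw; move: nbad; rewrite indicE mem_set//= => nbad.
  by have := addr_ge0 x0 y0; rewrite leNgt; move: nbad; rewrite gtrDl => ->.
have [near vor] := cov nU.
have hx : 2 / Mu * `|Mmu n w - Mu| < 1 by apply: le_lt_trans nbad; rewrite addrCA lerDl addr_ge0.
have hy : 2 / Nu * `|Mnu m w - Nu| < 1 by apply: le_lt_trans nbad; rewrite addrA lerDr addr_ge0.
have /andP[hx1 hx2] := relative_error_bounds M0 hx.
have /andP[hy1 hy2] := relative_error_bounds N0 hy.
apply: (le_trans (risk_fine K n0 m0 gw C0 l0 near vor (ltW hx1) (ltW hx2) _)).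
  by apply: lt_trans hy1; rewrite divr_gt0.
by rewrite lee_fin lerDl mulr_ge0// !addr_ge0.
Qed.

Variables (a b : nat -> R).
Hypotheses (a0 : forall n, 0 <= a n) (b0 : forall m, 0 <= b m).
Hypotheses (Ea : exists N, forall n, (N <= n)%N -> (\int[P]_w (`|Mmu n w - Mu|)%:E <= (a n)%:E)%E)
  (Eb : exists N, forall m, (N <= m)%N -> (\int[P]_w (`|Mnu m w - Nu|)%:E <= (b m)%:E)%E).

Lemma risk_expectation_le n m K C h (U : set W) (A : R) : (0 < n)%N -> (0 < m)%N ->
  0 <= C -> 0 <= ln n%:R :> R -> measurable U ->
  (forall w, ~ U w -> (forall x, Om x -> exists2 i, (i < n)%N & enorm (x - X i w) <= h) /\
    (forall i : 'I_n, Om (X i w) ->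
      mu (voronoi (fun k : 'I_n => X k w) Om i) <= (C * (ln n%:R / n%:R))%:E)%E) ->
  (\int[P]_w (`|Mmu n w - Mu|)%:E <= (a n)%:E)%E ->
  (\int[P]_w (`|Mnu m w - Nu|)%:E <= (b m)%:E)%E ->
  (P U <= (C / n%:R)%:E)%E ->
  A = 2 * C * T / Mu * ln n%:R ->
  (\int[P]_w risk n m w <= (A * (2 * Mu * H * 4^-1 ^+ K + 3 * H * (a n + b m) +
    (H ^+ 2 + 1) / 2 * (Mu * ((Num.sqrt n%:R)^-1 * scale_sum R d K) +
      Nu * ((Num.sqrt m%:R)^-1 * scale_sum R d K))) + c0 * h ^+ 2 * Mu +
    D0 * Mu * (C / n%:R + (2 / Mu * a n + 2 / Nu * b m)))%:E)%E.
Proof.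
move=> n0 m0 C0 l0 mU cov Ean Ebm PU AE.
have A0 : 0 <= A by rewrite AE mulr_ge0// divr_ge0 ?(ltW M0)// !mulr_ge0.
(* [bd] gathers the bounded terms. The mass errors may be unbounded and are integrated separately,
   with coefficients [ca] and [cb]. *)
pose bd w := A * (2 * Mu * H * 4^-1 ^+ K + (Mu * SX n K w + Nu * SY m K w)) +
  c0 * h ^+ 2 * Mu + D0 * Mu * \1_U w.
pose ca := A * (3 * H) + D0 * Mu * (2 / Mu).
pose cb := A * (3 * H) + D0 * Mu * (2 / Nu).
have ca0 : 0 <= ca by rewrite addr_ge0 ?mulr_ge0 ?invr_ge0 ?(ltW M0).
have cb0 : 0 <= cb by rewrite addr_ge0 ?mulr_ge0 ?invr_ge0 ?(ltW M0) ?(ltW N0).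
have S0 k (q : nat -> {RV P >-> E}) u (c : forall k, E -> {ffun 'I_d -> 'I_(2 ^ k).+1}) w :
    0 <= multiscale_deviation Om q u c k K w.
  by apply: addr_ge0; apply: sumr_ge0 => i _ //; rewrite mulr_ge0 ?exprn_ge0// sumr_ge0.
have bd0 w : 0 <= bd w.
  have e0 : 0 <= 4^-1 ^+ K :> R by rewrite exprn_ge0.
  have h1 := mulr_ge0 (ltW M0) (S0 n X (fun x => expR (- f x)) (fun k => cell B k) w).
  have h2 := mulr_ge0 (ltW N0) (S0 m Y (fun y => expR (- psi y)) (fun k y => cell B k (Z y)) w).
  rewrite /bd !addr_ge0//.
  - by apply: mulr_ge0 => //; apply: addr_ge0; [rewrite !mulr_ge0 ?(ltW M0)|exact: addr_ge0].
  - by rewrite mulr_ge0 ?(ltW M0)// mulr_ge0 ?sqr_ge0.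
  - by rewrite mulr_ge0 ?mulr_ge0 ?(ltW M0).
have bSX : bounded_mfun setT (SX n K).
  apply: (bounded_mfun_multiscale_deviation X mOm mf fH H0) => k q; exact: measurable_cell.
have bSY : bounded_mfun setT (SY m K).
  apply: (bounded_mfun_multiscale_deviation Y mOm mpsi psiH H0) => k q.
  exact: measurable_cell_argmin.
have bI : bounded_mfun setT (\1_U : W -> R).
  split; first exact: measurable_indic.
  by exists 1 => // w _; rewrite indicE; case: (_ \in _); rewrite ?normr1 ?normr0.
have bc r : bounded_mfun setT (fun _ : W => r : R) by exact: bounded_mfun_cst.
have bXY : bounded_mfun setT (fun w => Mu * SX n K w + Nu * SY m K w).
  by apply: bounded_mfunD; apply: bounded_mfunM.
have bA : bounded_mfun setT (fun w => A * (2 * Mu * H * 4^-1 ^+ K + (Mu * SX n K w + Nu * SY m K w))).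
  by apply: bounded_mfunM => //; apply: bounded_mfunD.
have bDU : bounded_mfun setT (fun w => D0 * Mu * \1_U w) by apply: bounded_mfunM.
have bAc : bounded_mfun setT (fun w =>
    A * (2 * Mu * H * 4^-1 ^+ K + (Mu * SX n K w + Nu * SY m K w)) + c0 * h ^+ 2 * Mu).
  exact: bounded_mfunD.
have bbd : bounded_mfun setT bd by exact: bounded_mfunD.
have bP g : bounded_mfun setT g -> P.-integrable setT (EFin \o g).
  by move=> bg; exact: bounded_mfun_integrable.
have mMmu : measurable_fun setT (fun w => `|Mmu n w - Mu|).
  by apply: measurableT_comp => //; apply: measurable_funB => //; exact: measurable_funPT.
have mMnu : measurable_fun setT (fun w => `|Mnu m w - Nu|).
  by apply: measurableT_comp => //; apply: measurable_funB => //; exact: measurable_funPT.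
have m1 : measurable_fun setT (fun w => (`|Mmu n w - Mu|)%:E) by exact/measurable_EFinP.
have m2 : measurable_fun setT (fun w => (`|Mnu m w - Nu|)%:E) by exact/measurable_EFinP.
have m3 : measurable_fun setT (fun w => (bd w)%:E) by apply/measurable_EFinP; case: bbd.
have m4 : measurable_fun setT (fun w => (ca%:E * (`|Mmu n w - Mu|)%:E)%E).
  by apply/measurable_EFinP; apply: measurable_funM.
have m5 : measurable_fun setT (fun w => (cb%:E * (`|Mnu m w - Nu|)%:E)%E).
  by apply/measurable_EFinP; apply: measurable_funM.
have p1 w : [set: W] w -> (0 <= (`|Mmu n w - Mu|)%:E)%E by rewrite lee_fin.
have p2 w : [set: W] w -> (0 <= (`|Mnu m w - Nu|)%:E)%E by rewrite lee_fin.
have p3 w : [set: W] w -> (0 <= (bd w)%:E)%E by rewrite lee_fin.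
have p4 w : [set: W] w -> (0 <= ca%:E * (`|Mmu n w - Mu|)%:E)%E by rewrite -EFinM lee_fin mulr_ge0.
have p5 w : [set: W] w -> (0 <= cb%:E * (`|Mnu m w - Nu|)%:E)%E by rewrite -EFinM lee_fin mulr_ge0.
have p45 w : [set: W] w -> (0 <= ca%:E * (`|Mmu n w - Mu|)%:E + cb%:E * (`|Mnu m w - Nu|)%:E)%E.
  by move=> _; rewrite adde_ge0// ?p4 ?p5.
have m45 : measurable_fun setT (fun w =>
    (ca%:E * (`|Mmu n w - Mu|)%:E + cb%:E * (`|Mnu m w - Nu|)%:E)%E).
  exact: emeasurable_funD.
apply: (@le_trans _ _ (\int[P]_w (ca%:E * (`|Mmu n w - Mu|)%:E + cb%:E * (`|Mnu m w - Nu|)%:E + (bd w)%:E))%E).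
  apply: (ge0_le_integral_negligible measurableT good_negligible).
  - by move=> w _; apply: integral_ge0 => x Ox; rewrite lee_fin loss_ge0.
  - by move=> w _; rewrite adde_ge0 ?p45 ?p3.
  - exact: emeasurable_funD.
  move=> w _ /contrapT gw.
  apply: (le_trans (risk_le K n0 m0 gw C0 l0 (cov w))).
  rewrite -!EFinM -!EFinD lee_fin le_eqVlt; apply/orP; left; apply/eqP.
  rewrite /ca /cb /bd -AE; move: (4^-1 ^+ K) (SX n K w) (SY m K w) (\1_U w : R) => e s s' u.
  by move: `|Mmu n w - Mu| `|Mnu m w - Nu| (A) (2 / Mu) (2 / Nu) => x y A' i j; ring.
rewrite ge0_integralD// ge0_integralD// ge0_integralZl ?lee_fin// ge0_integralZl ?lee_fin//.
rewrite (bounded_mfun_EFin P measurableT bbd).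
have P1 : fine (P [set: W]) = 1 by rewrite probability_setT.
have Ebd : Rintegral P setT bd <= A * (2 * Mu * H * 4^-1 ^+ K +
    (H ^+ 2 + 1) / 2 * (Mu * ((Num.sqrt n%:R)^-1 * scale_sum R d K) +
      Nu * ((Num.sqrt m%:R)^-1 * scale_sum R d K))) + c0 * h ^+ 2 * Mu + D0 * Mu * (C / n%:R).
  rewrite /bd RintegralD//; [|exact: bP|exact: bP].
  apply: lerD; last first.
    rewrite RintegralZl//; last exact: bP.
    rewrite ler_wpM2l ?mulr_ge0 ?(ltW M0)//.
    rewrite /Rintegral -lee_fin fineK; last by have := integrable_fin_num measurableT (bP _ bI).
    by rewrite integral_indic// setIT.
  rewrite RintegralD//; [|exact: bP|exact: bP].
  rewrite (Rintegral_cst _ measurableT) P1 mulr1 lerD2r.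
  rewrite RintegralZl//; last by apply: bP; exact: bounded_mfunD.
  rewrite ler_wpM2l// RintegralD//; [|exact: bP|exact: bP].
  rewrite (Rintegral_cst _ measurableT) P1 mulr1 lerD2l.
  rewrite RintegralD//; [|by apply: bP; exact: bounded_mfunM|by apply: bP; exact: bounded_mfunM].
  rewrite RintegralZl//; last exact: bP.
  rewrite RintegralZl//; last exact: bP.
  rewrite mulrDr; apply: lerD; rewrite mulrCA ler_wpM2l ?(ltW M0) ?(ltW N0)//.
    apply: (multiscale_deviation_expectation mOm X_law X_ind mf fH H0) => // k q.
    exact: measurable_cell.
  apply: (multiscale_deviation_expectation mOm Y_law Y_ind mpsi psiH H0) => // k q.
  exact: measurable_cell_argmin.
apply: (@le_trans _ _ ((ca * a n)%:E + (cb * b m)%:E + (Rintegral P setT bd)%:E)%E).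
  by rewrite !EFinM leeD// leeD// lee_wpmul2l ?lee_fin.
rewrite -!EFinD lee_fin; apply: (le_trans (lerD (lexx _) Ebd)).
rewrite le_eqVlt; apply/orP; left; apply/eqP; rewrite /ca /cb.
move: (4^-1 ^+ K) (scale_sum R d K) (A) (2 / Mu) (2 / Nu) => e s A' i j.
by move: (Num.sqrt n%:R)^-1 (Num.sqrt m%:R)^-1 (C / n%:R) => x y z; ring.
Qed.

Hypothesis cover : exists2 C : R, 0 < C & exists N : nat, forall n : nat, (N <= n)%N ->
  exists (U : set W) (h : R), [/\ measurable U, (P U <= (C / n%:R)%:E)%E,
    h ^+ 2 <= C * (ln n%:R * rate n) &
    forall w, ~ U w ->
      (forall x, Om x -> exists2 i, (i < n)%N & enorm (x - X i w) <= h) /\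
      (forall i : 'I_n, Om (X i w) ->
        mu (voronoi (fun k : 'I_n => X k w) Om i) <= (C * (ln n%:R / n%:R))%:E)%E].

Lemma risk_rate : exists C : R, 0 < C /\ exists N : nat, forall n m : nat,
  (N <= n)%N -> (N <= m)%N ->
  (\int[P]_w risk n m w <= (C * ln n%:R * (Mu * rate n + Nu * rate m + a n + b m))%:E)%E.
Proof.
have [C C0 [N1 cov]] := cover.
have [Cr Cr0 ms] := multiscale_rate R d0.
have [N2 hN2] := ln_ge1_eventually R.
have [N3 hN3] := Ea; have [N4 hN4] := Eb.
pose iM := Mu^-1; pose iN := Nu^-1; pose c := (H ^+ 2 + 1) / 2.
have iM0 : 0 < iM by rewrite invr_gt0.
have iN0 : 0 < iN by rewrite invr_gt0.
have c0' : 0 <= c by rewrite divr_ge0// addr_ge0// sqr_ge0.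
have A0 : 0 <= 2 * C * T / Mu by rewrite divr_ge0 ?(ltW M0)// !mulr_ge0// ltW.
exists (2 * C * T / Mu * ((2 * Mu * H + c * (Mu + Nu)) * Cr * (iM + iN) + 3 * H) +
  c0 * Mu * C * (iM + iN) + D0 * Mu * C * (iM + iN) + 2 * D0 * Mu * (iM + iN) + 1); split.
  have i0 : 0 <= iM + iN by rewrite addr_ge0// ltW.
  have MN : 0 <= Mu + Nu by rewrite addr_ge0// ltW.
  have q0 : 0 <= (2 * Mu * H + c * (Mu + Nu)) * Cr * (iM + iN) + 3 * H.
    rewrite addr_ge0 ?(mulr_ge0 (ler0n R 3) H0)// mulr_ge0// mulr_ge0 ?(ltW Cr0)//.
    by apply: addr_ge0; apply: mulr_ge0 => //; rewrite mulr_ge0 ?(ltW M0).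
  by rewrite ltr_pwDr// !addr_ge0 ?mulr_ge0 ?invr_ge0 ?(ltW M0) ?(ltW C0).
exists (maxn 1 (maxn (maxn N1 N2) (maxn N3 N4))) => n m.
rewrite !geq_max => /and3P[n0 /andP[nN1 nN2] /andP[nN3 nN4]] /and3P[m0 /andP[mN1 mN2] /andP[mN3 mN4]].
have n1 := hN2 n nN2; have m1 := hN2 m mN2.
have l1 : 1 <= ln (minn n m)%:R :> R by apply: hN2; rewrite leq_min nN2.
(* A single depth must serve both samples; it is adapted to the smaller one, whose rate is at most
   the sum of the two rates. *)
have [K hK] := ms _ l1.
have [U [h [mU PU hh near]]] := cov n nN1.
apply: (le_trans (risk_expectation_le K n0 m0 (ltW C0) (le_trans ler01 n1) mU near (hN3 n nN3)
  (hN4 m mN4) PU erefl)).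
rewrite lee_fin.
have isq (k l : nat) : (0 < l)%N -> (l <= k)%N -> (Num.sqrt k%:R)^-1 <= (Num.sqrt l%:R)^-1 :> R.
  move=> l0 lk; rewrite lef_pV2 ?posrE ?sqrtr_gt0 ?ltr0n ?(leq_trans l0 lk)//.
  by rewrite ler_wsqrtr// ler_nat.
have lmin : (0 < minn n m)%N by rewrite leq_min n0.
have rl : rate (minn n m) <= rate n + rate m.
  have rn0 := emp_rate_gt0 d n1; have rm0 := emp_rate_gt0 d m1.
  by rewrite /minn; case: ifP => _; [rewrite lerDl ltW|rewrite lerDr ltW].
have S0 : 0 <= scale_sum R d K.
  by rewrite /scale_sum addr_ge0 ?sqrtr_ge0// mulr_ge0 ?sqr_ge0// sumr_ge0.
apply: (@risk_constant_arith R (2 * C * T / Mu) H c c0 D0 C Cr Mu Nu iM iN (a n) (b m) (rate n)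
  (rate m) (rate (minn n m)) (ln n%:R) (4^-1 ^+ K) (Num.sqrt n%:R)^-1 (Num.sqrt m%:R)^-1
  (Num.sqrt (minn n m)%:R)^-1 (scale_sum R d K) n%:R^-1 (h ^+ 2)) => //;
  rewrite ?(ltW C0) ?(ltW Cr0) ?exprn_ge0 ?invr_ge0 ?sqrtr_ge0//.
- by rewrite divff ?gt_eqF.
- by rewrite divff ?gt_eqF.
- by rewrite ltW// emp_rate_gt0.
- by rewrite ltW// emp_rate_gt0.
- by apply: isq => //; exact: geq_minl.
- by apply: isq => //; exact: geq_minr.
- exact: inv_le_emp_rate.
Qed.

End plan_estimator.

(** * Consequences of two-sided density bounds *)

Section bounded_density.
Context (R : realType) (d : nat).
Local Notation E := 'rV[R]_d.
Local Notation leb := (lebesgue_rV R d).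
Variables (Om : set E) (mu : {finite_measure set E -> \bar R}) (p : E -> R) (bmin bmax : R).
Hypotheses (mOm : measurable Om) (M0 : 0 < mass Om mu).
Hypothesis mu_p : has_density Om (normalized Om mu) p.
Hypotheses (bmin0 : 0 < bmin) (p_bounds : forall x, Om x -> bmin <= p x <= bmax).

Lemma mass_set_neq0 : Om !=set0.
Proof.
apply/set0P/eqP => Om0; have := M0; rewrite /mass Om0 measure0 ltxx//.
Qed.

Lemma density_bound_gt0 : 0 < bmax.
Proof.
have [x Ox] := mass_set_neq0; have /andP[h1 h2] := p_bounds Ox.
exact: lt_le_trans bmin0 (le_trans h1 h2).
Qed.

Lemma density_ge A : measurable A -> (bmin%:E * leb (A `&` Om) <= normalized Om mu A)%E.
Proof.
move=> mA; have [mp ->//] := mu_p.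
rewrite setIC -integral_cst; last exact: measurableI.
apply: ge0_le_integral_gen => x [Ox _]; rewrite lee_fin; first exact: ltW.
by have /andP[] := p_bounds Ox.
Qed.

Lemma density_le A : measurable A -> (normalized Om mu A <= bmax%:E * leb (A `&` Om))%E.
Proof.
move=> mA; have [mp ->//] := mu_p.
rewrite setIC -integral_cst; last exact: measurableI.
apply: ge0_le_integral_gen => x [_ Ox]; rewrite lee_fin; have /andP[h1 h2] := p_bounds Ox => //.
exact: le_trans (ltW bmin0) h1.
Qed.

Lemma density_ac A : measurable A -> leb A = 0%E -> mu A = 0%E.
Proof.
move=> mA A0; have lA : leb (A `&` Om) = 0%E.
  apply/eqP; rewrite -measure_le0 -A0; apply: le_measure; rewrite ?inE//; exact: measurableI.
have := density_le mA; rewrite lA mule0 /normalized => h.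
apply/eqP; rewrite -measure_le0; rewrite pmule_rle0 in h => //.
by rewrite lte_fin invr_gt0.
Qed.

End bounded_density.

Lemma compact_in_box (R : realType) (d : nat) (Om : set 'rV[R]_d) : compact Om ->
  exists2 B : R, 0 < B & forall x, Om x -> in_box B x.
Proof.
move=> /compact_bounded[M [_ hM]]; exists (d%:R * (`|M| + 1) + 1) => [|x Ox i].
  by rewrite ltr_wpDl// mulr_ge0// addr_ge0.
apply: (le_trans (enorm_coord x i)); apply: (le_trans (enorm_mx_norm x)).
rewrite -[leLHS]addr0 lerD// ler_wpM2l//; apply: (hM (`|M| + 1)) => //.
by rewrite ltr_pwDr// ler_norm.
Qed.

Lemma sqnorm_bound (R : realType) (d : nat) (Om : set 'rV[R]_d) (f : 'rV[R]_d -> R) (L : R) :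
  compact Om -> Om !=set0 -> 0 <= L ->
  (forall x z, Om x -> Om z -> enorm (T0 Om f x - T0 Om f z) <= L * enorm (x - z)) ->
  exists2 Dm : R, 0 <= Dm &
    forall x y, Om x -> Om y -> sqnorm (y - x) <= Dm /\ sqnorm (y - T0 Om f x) <= Dm.
Proof.
move=> cOm [x0 Ox0] L0 T0L.
have [M [_ /(_ (`|M| + 1))]] := compact_bounded cOm.
rewrite ltr_pwDr// ?ler_norm// => /(_ isT) hM.
pose D := d%:R * (`|M| + 1).
have D0 : 0 <= D by rewrite mulr_ge0// addr_ge0.
have hD x : Om x -> enorm x <= D.
  by move=> Ox; apply: (le_trans (enorm_mx_norm _)); rewrite ler_wpM2l//; exact: hM.
have hD2 x y : Om x -> Om y -> enorm (y - x) <= 2 * D.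
  move=> Ox Oy; apply: (le_trans (enormD _ _)); rewrite enormN mulr_natl mulr2n.
  exact: lerD (hD _ Oy) (hD _ Ox).
pose K := 2 * D + enorm (x0 - T0 Om f x0) + L * (2 * D).
have K1 : 2 * D <= K by rewrite /K -addrA lerDl addr_ge0 ?enorm_ge0// mulr_ge0// mulr_ge0.
have K0 : 0 <= K by apply: le_trans K1; rewrite mulr_ge0.
exists (K ^+ 2) => [|x y Ox Oy]; first exact: sqr_ge0.
rewrite -!enorm_le//; split; first exact: le_trans (hD2 _ _ Ox Oy) K1.
apply: (le_trans (enormB_trans (T0 Om f x0) _ _)); apply: lerD.
  apply: (le_trans (enormB_trans x0 _ _)); rewrite lerD2r; exact: hD2.
by apply: (le_trans (T0L _ _ Ox0 Ox)); rewrite ler_wpM2l// hD2.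
Qed.

(** Both risks are instances of [risk_rate]. What differs is the loss, its uniform bound, and the
    constant relating the error at sample points to the discrepancy sum. *)
Theorem theorem3 (R : realType) (d : nat) (d_gt0 : (0 < d)%N)
  (Omega : set 'rV[R]_d) (mu nu : {finite_measure set 'rV[R]_d -> \bar R})
  (mu_Omega : mu (~` Omega) = 0%E) (nu_Omega : nu (~` Omega) = 0%E)
  (mu_gt0 : 0 < mass Omega mu) (nu_gt0 : 0 < mass Omega nu)
  (phi0 : 'rV[R]_d -> R) (phi0_opt : optimal_potential Omega mu nu phi0)
  (* (A1), (A2), (A3) *)
  (A1 : hessian_bounds Omega phi0)
  (A2 : regular_domain Omega)
  (A3 : bounded_densities Omega mu nu)
  (* samples *)
  (dW : measure_display) (W : measurableType dW) (P : probability W R)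
  (X Y : nat -> {RV P >-> 'rV[R]_d})
  (X_law : forall i A, measurable A -> distribution P (X i) A = normalized Omega mu A)
  (Y_law : forall j A, measurable A -> distribution P (Y j) A = normalized Omega nu A)
  (XY_indep : mutually_independent (joint_samples X Y))
  (* mass estimators and (A4) *)
  (Mmu Mnu : nat -> {RV P >-> R})
  (Mmu_ge0 : forall n w, 0 <= Mmu n w) (Mnu_ge0 : forall m w, 0 <= Mnu m w)
  (a b : nat -> R) (a_gt0 : forall n, 0 < a n) (b_gt0 : forall m, 0 < b m)
  (a_to0 : a n @[n --> \oo] --> (0 : R)) (b_to0 : b m @[m --> \oo] --> (0 : R))
  (c : R) (c01 : 0 < c <= 1)
  (A4_mu : mass_estimator Mmu (mass Omega mu) c a)
  (A4_nu : mass_estimator Mnu (mass Omega nu) c b)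
  (* optimal plans of the empirical problems *)
  (G : forall n m : nat, {RV P >-> 'M[R]_(n, m)})
  (G_opt : forall n m w, optimal_plan (fun i : 'I_n => X i w)
    (fun j : 'I_m => Y j w) (Mmu n w) (Mnu m w) (G n m w))
  (wlo whi : R) (wlo_gt0 : 0 < wlo) (wlo_whi : wlo < whi)
  (w_range : forall x, Omega x -> wlo <= expR (- phi0 x) <= whi) :
  exists C : R, 0 < C /\ exists N : nat, forall n m : nat,
    (N <= n)%N -> (N <= m)%N ->
    (maxe
      (\int[P]_w \int[mu]_(x in Omega)
        (sqnorm (T1NN (fun i : 'I_n => X i w) (fun j : 'I_m => Y j w) Omega
                   (G n m w) x - T0 Omega phi0 x))%:E)
      (\int[P]_w \int[mu]_(x in Omega)
        (`|lambda1NN (fun i : 'I_n => X i w) (fun j : 'I_m => Y j w) (Mmu n w)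
             wlo whi Omega (G n m w) x - lambda0 Omega phi0 x| ^+ 2)%:E)
    <= (C * ln n%:R * (mass Omega mu * emp_rate R d n
                       + mass Omega nu * emp_rate R d m + a n + b m))%:E)%E.
Proof.
have [kappa [kappa01 f_hess]] := A1.
have [Om_compact Om_convex [eps0 [del0 [eps00 del00 Om_reg]]]] := A2.
have [p [q [bmin [bmax [mu_p nu_q bmin0 pq_bounds]]]]] := A3.
have p_bounds x : Omega x -> bmin <= p x <= bmax by move=> /pq_bounds[].
have q_bounds x : Omega x -> bmin <= q x <= bmax by move=> /pq_bounds[].
have [_ opt] := phi0_opt.
have f_cont : {within Omega, continuous phi0} by have [[[]]] := opt.
have psi_cont : {within Omega, continuous (fun y => fine (c_transform Omega phi0 y))}.
  by have [[[]]] := opt.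
have mOm := compact_mx_measurable Om_compact.
have Om_neq0 := mass_set_neq0 mu_gt0.
have bmax0 := density_bound_gt0 mu_gt0 bmin0 p_bounds.
have mu_ac := density_ac mOm mu_gt0 mu_p bmin0 p_bounds.
have nu_ac := density_ac mOm nu_gt0 nu_q bmin0 q_bounds.
(* Positive mass and absolute continuity give positive volume, hence the interior ball needed for
   the Lipschitz bound on [T0]. *)
have leb_Om : lebesgue_rV R d Omega != 0%E.
  by apply/eqP => /(mu_ac _ mOm) e; have := mu_gt0; rewrite /mass e ltxx.
have [x0 [rho [rho0 ball_Om]]] := convex_interior Om_convex leb_Om mOm.
have [L L0 T0L] := T0_lipschitz Om_convex kappa01 f_hess rho0 ball_Om Om_compact.
have [Dm Dm0 DmP] := sqnorm_bound Om_compact Om_neq0 (ltW L0) T0L.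
have [B B0 OmB] := compact_in_box Om_compact.
have f_bd := within_bounded_mfun Om_compact f_cont.
have psi_bd := within_bounded_mfun Om_compact psi_cont.
have [mf _] := bounded_mfun_expR (bounded_mfunN f_bd).
have [mpsi [Mpsi Mpsi0 psiM]] := bounded_mfun_expR (bounded_mfunN psi_bd).
pose H := whi + Mpsi.
have whi0 : 0 < whi by exact: lt_trans wlo_whi.
have H0 : 0 <= H by rewrite addr_ge0// ltW.
have fH x : Omega x -> 0 <= expR (- phi0 x) <= H.
  by move=> /w_range/andP[_ h]; rewrite expR_ge0 (le_trans h)// lerDl.
have psiH y : Omega y -> 0 <= expR (- fine (c_transform Omega phi0 y)) <= H.
  by move=> /psiM h; rewrite expR_ge0 (le_trans (ler_norm _))// (le_trans h)// lerDr ltW.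
have X_ind := mutually_independentl XY_indep.
have Y_ind := mutually_independentr XY_indep.
(* The almost sure properties on which all pointwise bounds rest; the complement is a countable
   union of null events. *)
pose good : set W := [set w | [/\ forall i, Omega (X i w), forall j, Omega (Y j w),
  forall j, T0 Omega phi0 (argmin_cost Omega phi0 (Y j w)) = Y j w &
  forall i k, i != k -> X i w <> X k w]].
have good_negligible : P.-negligible (~` good).
  have N1 := negligible_bigcup_count (sample_in mOm mu_Omega X_law).
  have N2 := negligible_bigcup_count (sample_in mOm nu_Omega Y_law).
  have N3 := negligible_bigcup_count (fun j => law_negligible Y_law j
    (T0_argmin_ae Om_compact Om_convex Om_neq0 kappa01 f_hess opt (ltW L0) T0L mu_ac)).
  have N4 : P.-negligible (\bigcup_(ik : nat * nat) [set w | ik.1 != ik.2 /\ X ik.1 w = X ik.2 w]).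
    apply: negligible_bigcup_count => ik; have [e|ik12] := eqVneq ik.1 ik.2.
      by apply: negligibleS (negligible_set0 _) => w /= [].
    by apply: negligibleS (sample_distinct d_gt0 X_law X_ind mu_ac ik12) => w [].
  apply: negligibleS (negligibleU (negligibleU N1 N2) (negligibleU N3 N4)) => w /= nw.
  apply: contrapT => h; apply: nw.
  have hX i : Omega (X i w) by apply: contrapT => hi; apply: h; left; left; exists i.
  have hY j : Omega (Y j w) by apply: contrapT => hj; apply: h; left; right; exists j.
  split => // [j|i k ik e]; last by apply: h; right; right; exists (i, k).
  by apply: contrapT => hj; apply: h; right; left; exists j.
have goodX w : good w -> forall i, Omega (X i w) by case.
have goodY w : good w -> forall j, Omega (Y j w) by case.
have goodT w : good w -> forall j, T0 Omega phi0 (argmin_cost Omega phi0 (Y j w)) = Y j w by case.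
have goodD w : good w -> forall i k, i != k -> X i w <> X k w by case.
have Ea : exists N, forall n, (N <= n)%N ->
    (\int[P]_w (`|Mmu n w - mass Omega mu|)%:E <= (a n)%:E)%E.
  have [_ _ [N _ hN]] := A4_mu; exists N => n Nn; have := hN n Nn.
  by rewrite unlock.
have Eb : exists N, forall n, (N <= n)%N ->
    (\int[P]_w (`|Mnu n w - mass Omega nu|)%:E <= (b n)%:E)%E.
  have [_ _ [N _ hN]] := A4_nu; exists N => n Nn; have := hN n Nn.
  by rewrite unlock.
have a0 n : 0 <= a n by exact: ltW.
have b0 n : 0 <= b n by exact: ltW.
have k0 : 0 < kappa by case/andP: kappa01.
have gap0 : 0 <= gap_const d kappa B.
  by rewrite /gap_const addr_ge0// mulr_ge0 ?invr_ge0 ?mulr_ge0 ?sqr_ge0// ltW.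
have Tc0 : 0 <= That_const d kappa L wlo Dm B.
  rewrite /That_const mulr_ge0// mulr_ge0 ?divr_ge0 ?(ltW wlo_gt0)//.
  by rewrite addr_ge0// divr_ge0 ?mulr_ge0 ?sqr_ge0// ltW.
have lc0 : 0 <= lambda_const d kappa L wlo whi Dm B.
  rewrite /lambda_const; apply: addr_ge0; apply: mulr_ge0 => //.
    by apply: mulr_ge0 (sqr_ge0 _); rewrite mulr_ge0// ltW.
  by apply: mulr_ge0 => //; apply: mulr_ge0; exact: sqr_ge0.
have balance := mass_balance Om_compact Om_convex Om_neq0 kappa01 f_hess opt.
have mZ := argmin_measurable Om_compact Om_convex Om_neq0 kappa01 f_hess opt.
have cover := covering_scale d_gt0 mOm mu_gt0 X_law X_ind bmin0 bmax0
  (density_ge mOm mu_p bmin0 p_bounds) (density_le mOm mu_p bmin0 p_bounds)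
  eps00 del00 Om_reg B0 OmB.
pose risk_rate_at V F loss t D0 c0 T := @risk_rate R d d_gt0 dW W P Omega phi0 mu nu mOm mu_gt0 nu_gt0
  mu_ac X Y X_law Y_law X_ind Y_ind balance mZ H H0 mf mpsi fH psiH B good good_negligible
  goodX goodY goodD Mmu Mnu V F loss t D0 c0 T.
pose Th n m w := That (fun i : 'I_n => X i w) (fun j : 'I_m => Y j w) (G n m w).
have ThM n m w i z (M : R) : good w -> 0 <= M -> (forall x, Omega x -> sqnorm (x - z) <= M) ->
    sqnorm (Th n m w i - z) <= M.
  move=> gw M0 hM; apply: (That_sqnorm_le (G_opt n m w)) => // [j|]; apply: hM.
    exact: (goodY w gw j).
  exact: (goodX w gw i).
(* Passing from the error at [x] to the error at the nearest sample point doubles both squares,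
   hence the factors [2] in the parameters below. *)
have sq (u v s : 'rV[R]_d) : sqnorm (u - s) <= 2 * sqnorm (u - v) + 2 * sqnorm (v - s).
  by rewrite -(subrKA v); exact: sqnormD_le.
have [C1 [C10 [N1 rate1]]] : exists C : R, 0 < C /\ exists N : nat, forall n m : nat,
    (N <= n)%N -> (N <= m)%N ->
    (\int[P]_w \int[mu]_(x in Omega)
        (sqnorm (nn_extension (fun i : 'I_n => X i w) Omega (Th n m w) x - T0 Omega phi0 x))%:E
    <= (C * ln n%:R * (mass Omega mu * emp_rate R d n
                       + mass Omega nu * emp_rate R d m + a n + b m))%:E)%E.
  apply: (risk_rate_at _ Th (fun z x => sqnorm (z - T0 Omega phi0 x))
    (fun n m w i => 2 * sqnorm (Th n m w i - T0 Omega phi0 (X i w)))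
    Dm (2 * L ^+ 2) (2 * That_const d kappa L wlo Dm B)) => //.
  - by rewrite mulr_ge0// sqr_ge0.
  - by rewrite mulr_ge0.
  - by move=> z x _; exact: sqnorm_ge0.
  - by move=> n m w i; rewrite mulr_ge0// sqnorm_ge0.
  - move=> n m w i x gw Ox; apply: ThM => // y Oy.
    by have [] := DmP x y Ox Oy.
  - move=> n m w i x gw Ox; have h := T0L _ _ (goodX w gw i) Ox.
    apply: (le_trans (sq _ (T0 Omega phi0 (X i w)) _)).
    rewrite lerD2l -mulrA ler_pM2l// -enorm_sqr -exprMn.
    rewrite ler_sqr ?nnegrE ?enorm_ge0 ?mulr_ge0 ?enorm_ge0 ?(ltW L0)//.
    by rewrite (enormBC x).
  - move=> n m w K n0 m0 gw Mx0 My0.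
    have h := sum_That_T0_le Om_compact Om_convex Om_neq0 kappa01 f_hess f_cont (ltW L0) T0L
      wlo_gt0 w_range Dm0 DmP B0 OmB n0 m0 Mx0 My0 (fun i => goodX w gw i) (fun j => goodY w gw j)
      (fun j => goodT w gw j) (G_opt n m w) K.
    rewrite -mulrA; apply: le_trans (ler_wpM2l (ler0n R 2) h).
    by rewrite mulr_sumr; apply: ler_sum => i _; rewrite mulrCA.
pose Lh n m w := lambdahat (fun i : 'I_n => X i w) (fun j : 'I_m => Y j w) (Mmu n w) wlo whi (G n m w).
pose ll := lambda_lip L whi Dm.
have w_le x : Omega x -> expR (- phi0 x) <= whi by move=> /w_range/andP[].
have ll0 x z := @lambda0_lip _ _ _ _ _ Om_convex kappa01 f_hess _ T0L _ _ whi0 w_le Dm0 DmP x z.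
(* Common upper bound of [lambda0] and of the clipped estimator. Both are nonnegative, so the loss
   is at most [ub ^+ 2]. *)
pose ub := whi * expR (Dm / 4).
have ub0 : 0 <= ub by rewrite mulr_ge0 ?expR_ge0// ltW.
have [C2 [C20 [N2 rate2]]] : exists C : R, 0 < C /\ exists N : nat, forall n m : nat,
    (N <= n)%N -> (N <= m)%N ->
    (\int[P]_w \int[mu]_(x in Omega)
        (`|nn_extension (fun i : 'I_n => X i w) Omega (Lh n m w) x - lambda0 Omega phi0 x| ^+ 2)%:E
    <= (C * ln n%:R * (mass Omega mu * emp_rate R d n
                       + mass Omega nu * emp_rate R d m + a n + b m))%:E)%E.
  apply: (risk_rate_at _ Lh (fun z x => `|z - lambda0 Omega phi0 x| ^+ 2)
    (fun n m w i => 2 * (Lh n m w i - lambda0 Omega phi0 (X i w)) ^+ 2)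
    (ub ^+ 2) (2 * ll ^+ 2) (2 * lambda_const d kappa L wlo whi Dm B)) => //.
  - exact: sqr_ge0.
  - by rewrite mulr_ge0// sqr_ge0.
  - by rewrite mulr_ge0.
  - by move=> n m w i; rewrite mulr_ge0// sqr_ge0.
  - move=> n m w i x gw Ox.
    have l1 : 0 <= lambda0 Omega phi0 x <= ub by rewrite expR_ge0/= (lambda0_le w_le DmP).
    have l2 : 0 <= Lh n m w i <= ub.
      have /andP[c1 c2] := clip_bounds (ahat (Mmu n w) (G n m w) i ^+ 2) (ltW wlo_whi).
      rewrite /Lh /lambdahat mulr_ge0 ?expR_ge0 ?(le_trans (ltW wlo_gt0) c1)//=.
      apply: ler_pM => //; first exact: le_trans (ltW wlo_gt0) c1.
      rewrite ler_expR ler_pM2r ?invr_gt0// sqnormBC; apply: ThM => // y Oy.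
      by have [] := DmP (X i w) y (goodX w gw i) Oy.
    have /andP[l11 l12] := l1; have /andP[l21 l22] := l2.
    rewrite ler_sqr ?nnegrE// ler_norml; apply/andP; split.
      by rewrite -(sub0r ub) lerB.
    by rewrite -(subr0 ub) lerB.
  - move=> n m w i x gw Ox; have h := ll0 _ _ (goodX w gw i) Ox.
    rewrite (enormBC x); have h2 : `|lambda0 Omega phi0 (X i w) - lambda0 Omega phi0 x| ^+ 2 <=
        ll ^+ 2 * enorm (X i w - x) ^+ 2.
      by rewrite -exprMn ler_sqr ?nnegrE// (le_trans (normr_ge0 _) h).
    move: h2; rewrite !real_normK ?num_real// -[2 * ll ^+ 2 * _]mulrA.
    move: (Lh n m w i) (lambda0 Omega phi0 (X i w)) (lambda0 Omega phi0 x) (ll ^+ 2 * _) => u v s e h2.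
    have := sqr_ge0 (u - v - (v - s)); rewrite (_ : u - s = (u - v) + (v - s)); last by ring.
    by move: (u - v) (v - s) h2 => u' v'; rewrite sqrrB sqrrD; lra.
  - move=> n m w K n0 m0 gw Mx0 My0.
    have h := sum_lambdahat_lambda0_le Om_compact Om_convex Om_neq0 kappa01 f_hess f_cont (ltW L0) T0L
      wlo_gt0 wlo_whi w_range Dm0 DmP B0 OmB n0 m0 Mx0 My0 (fun i => goodX w gw i)
      (fun j => goodY w gw j) (fun j => goodT w gw j) (G_opt n m w) K.
    rewrite -mulrA; apply: le_trans (ler_wpM2l (ler0n R 2) h).
    by rewrite mulr_sumr; apply: ler_sum => i _; rewrite mulrCA.
have [N3 hN3] := ln_ge1_eventually R.
exists (C1 + C2); split; first exact: addr_gt0.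
exists (maxn N1 (maxn N2 N3)) => n m.
rewrite !geq_max => /and3P[nN1 nN2 nN3] /and3P[mN1 mN2 mN3].
have D0 : 0 <= ln n%:R * (mass Omega mu * emp_rate R d n + mass Omega nu * emp_rate R d m + a n + b m).
  rewrite mulr_ge0 ?(le_trans ler01 (hN3 n nN3))// !addr_ge0// mulr_ge0 ?(ltW mu_gt0) ?(ltW nu_gt0)//.
    by rewrite ltW// emp_rate_gt0 ?hN3.
  by rewrite ltW// emp_rate_gt0 ?hN3.
rewrite ge_max; apply/andP; split.
  apply: (le_trans (rate1 n m nN1 mN1)); rewrite lee_fin -!mulrA ler_wpM2r//.
  by rewrite lerDl ltW.
apply: (le_trans (rate2 n m nN2 mN2)); rewrite lee_fin -!mulrA ler_wpM2r//.
by rewrite lerDr ltW.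
Qed.
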